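(* Let $\Omega\subset\mathbb{R}^2$ be a bounded domain with smooth boundary, let $H_0\in\mathbb{R}\setminus\{0\}$, and let $\lambda_1>0$ be the first eigenvalue of $-\Delta$ in $\Omega$ under the homogeneous Dirichlet boundary condition. For $v\in H_0^1(\Omega;\mathbb{R}^3)$ set $$E(v)=\frac12\int_\Omega|\nabla v|^2\,dx\,dy+\frac{2H_0}{3}\int_\Omega v\cdot (v_x\wedge v_y)\,dx\,dy .$$ Let $u_0\in H_0^1(\Omega;\mathbb{R}^3)$ satisfy $$E(u_0)<\frac{\lambda_1}{6}\|u_0\|_2^2 ,$$ and let $u$ be the local regular solution, with maximal existence time $T\in(0,+\infty]$, of the problem $$\begin{cases} u_t=\Delta u-2H_0\,u_x\wedge u_y, & (x,y,t)\in\Omega\times(0,T),\\ u=0, & (x,y,t)\in\partial\Omega\times(0,T),\\ u(\cdot,0)=u_0, & \text{in }\Omega.\end{cases}$$ Then $u$ blows up in finite time, i.e. $T<+\infty$, and moreover $$T\le \frac{16\|u_0\|_2^2}{\lambda_1\|u_0\|_2^2-6E(u_0)} .$$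
   Context: Here $\wedge$ is the wedge (cross) product in $\mathbb{R}^3$, $u_x,u_y$ are the partial derivatives of the $\mathbb{R}^3$-valued map $u$ with respect to the spatial variables $(x,y)\in\Omega$, and $\|\cdot\|_2$ is the norm of $L^2(\Omega;\mathbb{R}^3)$. For $v\in H_0^1(\Omega;\mathbb{R}^3)$ the integral $\int_\Omega v\cdot(v_x\wedge v_y)\,dx\,dy$ is understood as the value of the unique continuous extension to $H_0^1(\Omega;\mathbb{R}^3)$ of this functional from $C_c^\infty(\Omega;\mathbb{R}^3)$ (it exists by Wente's inequality). A regular solution on $[0,T)$ is a classical solution of the problem, of class $C^{2+\alpha,1+\alpha/2}$ on $\overline\Omega\times(0,T)$ for some $\alpha\in(0,1)$, which attains the initial datum $u_0$ continuously in $H_0^1(\Omega;\mathbb{R}^3)$ as $t\to0^+$. Regular solutions satisfy the known energy identity $$\int_{t_1}^{t_2}\int_\Omega|u_t|^2\,dx\,dy\,dt+E(u(t_2))=E(u(t_1)),\qquad 0\le t_1\le t_2<T.$$ The maximal existence time $T\in(0,+\infty]$ is the supremum of the times up to which the solution exists as a regular solution. ''Blows up in finite time'' means that $T<+\infty$, i.e. the regular solution does not exist globally in time. *)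

(* Defs.v *)
From HB Require Import structures.
From mathcomp Require Import all_boot all_order all_algebra.
From mathcomp Require Import all_classical all_reals all_analysis.

Set Implicit Arguments.
Unset Strict Implicit.
Unset Printing Implicit Defensive.

Import Order.TTheory GRing.Theory Num.Theory.
Import numFieldNormedType.Exports.

Local Open Scope classical_set_scope.
Local Open Scope ring_scope.

Section Plane.
Context {R : realType}.

Definition ex : R * R := (1, 0).
Definition ey : R * R := (0, 1).
Definition axis (b : bool) : R * R := if b then ey else ex.

Definition mu2 : set (measurableTypeR R * measurableTypeR R) -> \bar R :=
  (@lebesgue_measure R \x @lebesgue_measure R)%E.
HB.instance Definition _ := Measure.on mu2.

Definition dot (a b : 'rV[R]_3) : R := \sum_(i < 3) a 0 i * b 0 i.

Definition wedge (a b : 'rV[R]_3) : 'rV[R]_3 :=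
  \row_(i < 3) (a 0 (i + 1) * b 0 (i + 2) - a 0 (i + 2) * b 0 (i + 1)).

Definition coord (v : R * R -> 'rV[R]_3) (i : 'I_3) : R * R -> R :=
  fun p => v p 0 i.

Definition boundary (Om : set (R * R)) : set (R * R) :=
  closure Om `\` interior Om.

End Plane.

Section Smooth.
Context {R : realType}.

Definition iter_partial (s : seq bool) (f : R * R -> R) : R * R -> R :=
  foldr (fun b g => 'D_(axis b) g) f s.

Definition smooth_on (U : set (R * R)) (f : R * R -> R) : Prop :=
  forall (s : seq bool) (p : R * R), U p ->
    {for p, continuous (iter_partial s f)} /\
    forall b, derivable (iter_partial s f) p (axis b).

(* Near each boundary point the domain is a strict sublevel set of a smooth
   function without critical points. *)
Definition smooth_boundary (Om : set (R * R)) : Prop :=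
  forall p, boundary Om p ->
    exists (U : set (R * R)) (rho : R * R -> R),
      [/\ open U, U p, smooth_on U rho,
          (forall q, U q -> exists b, 'D_(axis b) rho q != 0)
        & Om `&` U = [set q | rho q < 0] `&` U].

Definition smooth_bounded_domain (Om : set (R * R)) : Prop :=
  [/\ open Om, connected Om, Om !=set0, bounded_set Om & smooth_boundary Om].

Definition test_function (Om : set (R * R)) (phi : R * R -> R) : Prop :=
  smooth_on setT phi /\
  exists K : set (R * R),
    [/\ compact K, K `<=` Om & forall p, ~ K p -> phi p = 0].

Definition test_field (Om : set (R * R)) (phi : R * R -> 'rV[R]_3) : Prop :=
  forall i, test_function Om (coord phi i).

End Smooth.

(* Elements of L^2 and H^1_0 are represented by functions on the plane, of
   which only the values almost everywhere in the domain matter. *)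

Section Sobolev.
Context {R : realType}.
Implicit Types (Om : set (R * R)) (f g : R * R -> R)
  (v : R * R -> 'rV[R]_3).

Definition L2 Om f : Prop :=
  measurable_fun (Om : set (measurableTypeR R * measurableTypeR R)) f /\
  (@mu2 R).-integrable Om (fun p => ((f p) ^+ 2)%:E).

Definition weak_partial Om (b : bool) f g : Prop :=
  L2 Om g /\
  forall phi, test_function Om phi ->
    \int[@mu2 R]_(p in Om) (f p * 'D_(axis b) phi p) =
    - \int[@mu2 R]_(p in Om) (g p * phi p).

(* A representative of the weak partial derivative, unique almost everywhere;
   only meaningful when one exists. *)
Definition wD Om (b : bool) f : R * R -> R :=
  xget (cst 0) [set g | weak_partial Om b f g].

Definition H1 Om f : Prop :=
  L2 Om f /\ forall b, exists g, weak_partial Om b f g.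

Definition L2sq Om f : R := \int[@mu2 R]_(p in Om) (f p ^+ 2).

Definition grad_inner Om f g : R :=
  \int[@mu2 R]_(p in Om) (\sum_(b : bool) wD Om b f p * wD Om b g p).

Definition H1norm Om f : R := Num.sqrt (L2sq Om f + grad_inner Om f f).

Definition H10 Om f : Prop :=
  H1 Om f /\
  forall eps : R, 0 < eps ->
    exists2 phi, test_function Om phi & H1norm Om (f \- phi) < eps.

Definition vH10 Om v : Prop := forall i, H10 Om (coord v i).

Definition vL2norm Om v : R := Num.sqrt (\sum_(i < 3) L2sq Om (coord v i)).

Definition dirichlet Om v : R :=
  \sum_(i < 3) grad_inner Om (coord v i) (coord v i).

Definition vH1norm Om v : R := Num.sqrt (vL2norm Om v ^+ 2 + dirichlet Om v).

Definition eigenvalue_dirichlet Om (lam : R) : Prop :=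
  exists phi, [/\ H10 Om phi, L2sq Om phi != 0
    & forall psi, H10 Om psi ->
        grad_inner Om phi psi =
        lam * \int[@mu2 R]_(p in Om) (phi p * psi p)].

Definition first_eigenvalue Om (lam : R) : Prop :=
  eigenvalue_dirichlet Om lam /\
  forall mu, eigenvalue_dirichlet Om mu -> lam <= mu.

(* V is the H^1-continuous extension to H^1_0 of the functional
   v |-> \int v . (v_x /\ v_y) on test fields. Its values on H^1_0 are
   determined by density; that it exists is Wente's theorem. *)
Definition volume_extension Om (V : (R * R -> 'rV[R]_3) -> R) : Prop :=
  (forall phi, test_field Om phi ->
     V phi =
     \int[@mu2 R]_(p in Om)
       dot (phi p) (wedge ('D_ex phi p) ('D_ey phi p))) /\
  (forall v, vH10 Om v -> forall eps : R, 0 < eps ->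
     exists2 delta : R, 0 < delta &
       forall w, vH10 Om w -> vH1norm Om (w \- v) < delta ->
         `|V w - V v| < eps).

Definition energy Om (H0 : R) (V : (R * R -> 'rV[R]_3) -> R) v : R :=
  2^-1 * dirichlet Om v + 2 * H0 / 3 * V v.

End Sobolev.

(* Evolving fields take the time first: u t p. *)

Section Solutions.
Context {R : realType}.
Implicit Types (Om : set (R * R)) (u : R -> R * R -> 'rV[R]_3)
  (T : \bar R).

Definition dt u : R -> R * R -> 'rV[R]_3 :=
  fun t p => 'D_1 (fun s : R => u s p) t.

Definition dspace (b : bool) u : R -> R * R -> 'rV[R]_3 :=
  fun t => 'D_(axis b) (u t).

(* The norms of the plane and of 'rV_3 are sup norms; this only affects the
   constant M. *)
Definition parabolic_holder (alpha : R) (A : set (R * R)) (I : set R) u :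
    Prop :=
  exists M : R, forall t s p q, I t -> I s -> A p -> A q ->
    `|u t p| <= M /\
    `|u t p - u s q| <= M * (`|p - q| `^ alpha + `|t - s| `^ (alpha / 2)).

(* Class C^{2+alpha,1+alpha/2} on closure(Om) x (0,T), that is, on
   closure(Om) x [t1,t2] for all 0 < t1 <= t2 < T.  A derivative that is
   parabolic-Hölder on Om x [t1,t2] extends uniquely, with the same estimate,
   to closure(Om) x [t1,t2]. *)
Definition parabolic_class (alpha : R) Om T u : Prop :=
  (forall t p, 0 < t -> (t%:E < T)%E -> Om p ->
     [/\ derivable (fun s : R => u s p) t 1,
         forall b, derivable (u t) p (axis b)
       & forall b c, derivable (dspace b u t) p (axis c)]) /\
  (forall t1 t2 : R, 0 < t1 -> t1 <= t2 -> (t2%:E < T)%E ->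
     let I := [set t | t1 <= t <= t2] in
     [/\ parabolic_holder alpha (closure Om) I u,
         parabolic_holder alpha Om I (dt u),
         forall b, parabolic_holder alpha Om I (dspace b u)
       & forall b c, parabolic_holder alpha Om I (dspace c (dspace b u))]).

Definition regular_solution Om (H0 : R)
    (u0 : R * R -> 'rV[R]_3) T u : Prop :=
  (exists2 alpha : R, 0 < alpha < 1 & parabolic_class alpha Om T u) /\
  [/\ (forall t p, 0 < t -> (t%:E < T)%E -> Om p ->
         dt u t p =
         dspace false (dspace false u) t p + dspace true (dspace true u) t p
         - (2 * H0) *: wedge ('D_ex (u t) p) ('D_ey (u t) p)),
      (forall t p, 0 < t -> (t%:E < T)%E -> boundary Om p -> u t p = 0),
      {ae @mu2 R, forall p, Om p -> u 0 p = u0 p},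
      (forall t, 0 <= t -> (t%:E < T)%E -> vH10 Om (u t))
    & vH1norm Om (u t \- u0) @[t --> 0^'+] --> (0 : R)].

Definition max_existence_time Om (H0 : R)
    (u0 : R * R -> 'rV[R]_3) : \bar R :=
  ereal_sup [set T : \bar R |
    (0 < T)%E /\ exists u, regular_solution Om H0 u0 T u].

End Solutions.

(* Main.v *)
(* Let y(t) = |u(t)|_2^2, let E(t) be the energy of u(t), and Z = lambda1 y - 6 E. Testing the
   equation with u and with u_t gives y' = -6 E + |grad u|_2^2 and E' = -|u_t|_2^2. Since lambda1
   is the minimum of the Rayleigh quotient, y' >= Z; hence exp(-lambda1 t) Z is nondecreasing and
   Z stays positive. By Cauchy-Schwarz y'^2 <= 4 y |u_t|_2^2, so that
   Z' >= 6 |u_t|_2^2 >= (3/2) (y'/y) Z, and therefore (y/Z)' <= -1/2. As y/Z > 0, the solution cannot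
   live longer than 2 y(s)/Z(s) after the time s; letting s tend to 0 yields the bound even with
   the constant 2 in place of 16.

   The volume term of E is only given on test fields and by continuity. On a bounded C^1 field v
   of H^1_0 it is the integral of v . (v_x /\ v_y), because v is the limit of the test fields
   K sin(phi/K), phi a test field close to v, whose sup norm K grows slowly. *)
Require Import Defs.
From HB Require Import structures.
From mathcomp Require Import all_boot all_order all_algebra.
From mathcomp Require Import all_classical all_reals all_analysis.
From mathcomp Require Import measurable_realfun ring lra.
Import Order.TTheory GRing.Theory Num.Theory.
Import numFieldNormedType.Exports.
Local Open Scope classical_set_scope.
Local Open Scope ring_scope.

Set Implicit Arguments.
Unset Strict Implicit.
Unset Printing Implicit Defensive.

(* The library file vector.v also defines a [coord]. *)
Local Notation coord := Defs.coord.

(** * Measures on the plane *)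

Section PlaneMeasure.
Context {R : realType}.
Implicit Types (Om A : set (R * R)) (f : R * R -> R).

Local Notation mR := (measurableTypeR R).
Local Notation leb := (@lebesgue_measure R).

(** The hypothesis on [lambda1] only says that it is the least Dirichlet eigenvalue. To get
    [poincare] from it, the infimum of the Rayleigh quotients must itself be an eigenvalue, so a
    minimizer has to be produced. Compactness in L^2 comes from Poincaré's inequality on the cells
    of a fine grid, and the parallelogram law upgrades it to convergence in H^1.

    The regularity class controls u_t and the second space derivatives, but not the gradient of u_t,
    so the energy cannot be differentiated under the integral sign. Its increments are estimated
    instead. The difference of the solution at two times, at distance h, lies in H^1_0, and
    integration by parts moves its derivatives onto second derivatives of the solution. The squared
    gradient of the difference then has integral of order h e, where e is a modulus of continuity in
    time; the pointwise bound would only give e^2, which need not be o(h).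

    The datum is merely in H^1_0, so the differential inequality is used on [s, t] with s > 0, and
    the passage to s = 0 rests on the continuity of mass and energy in the H^1 norm. *)

Definition rect (a b c d : R) : set (R * R) := `]a, b[ `*` `]c, d[.

(** An enumeration of the rectangles with rational corners, a countable base of the plane; a code
    that decodes to nothing stands for the empty set. Countability is what puts open sets into the
    product sigma-algebra. *)
Definition ratrect (n : nat) : set (R * R) :=
  if @unpickle (rat * rat * (rat * rat))%type n is Some q then
    rect (ratr q.1.1) (ratr q.1.2) (ratr q.2.1) (ratr q.2.2)
  else set0.

(** Balls of the sup norm are squares, so rationals between the coordinates of [p] and the sides of
    such a square serve as corners. The closed rectangle must fit into [Om] as well, because it
    becomes the compact support of a bump. *)
Lemma open_subrect Om p : open Om -> Om p ->
  exists n, ratrect n p /\ exists a b c d : R,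
    [/\ ratrect n = rect a b c d & `[a, b] `*` `[c, d] `<=` Om].
Proof.
move=> oOm Omp.
have /nbhs_ballP[e /= e0 peOm] : nbhs p Om by exact: open_nbhs_nbhs.
have rat_near (x : R) : exists q1 q2 : rat,
    [/\ x - e < ratr q1, ratr q1 < x, x < ratr q2 & ratr q2 < x + e].
  have /rat_in_itvoo[q1] : x - e < x by lra.
  rewrite in_itv/= => /andP[q1a q1b].
  have /rat_in_itvoo[q2] : x < x + e by lra.
  rewrite in_itv/= => /andP[q2a q2b].
  by exists q1, q2.
have [a [b [pa ap pb bp]]] := rat_near p.1.
have [c [d [pc cp pd dp]]] := rat_near p.2.
exists (pickle ((a, b), (c, d))).
have -> : ratrect (pickle ((a, b), (c, d))) =
    rect (ratr a) (ratr b) (ratr c) (ratr d).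
  by rewrite /ratrect pickleK.
split; first by split; rewrite /= in_itv /=; apply/andP.
exists (ratr a), (ratr b), (ratr c), (ratr d); split => //.
move=> q [/=]; rewrite !in_itv/= => /andP[q1 q2] /andP[q3 q4].
by apply: peOm; split; rewrite /ball/= ltr_distlC; lra.
Qed.

Lemma measurable_rect a b c d :
  measurable (rect a b c d : set (mR * mR)).
Proof. by apply: measurableX; exact: measurable_itv. Qed.

Lemma measurable_ratrect n : measurable (ratrect n : set (mR * mR)).
Proof.
rewrite /ratrect; case: unpickle => [[[a b] [c d]]|//].
exact: measurable_rect.
Qed.

Lemma open_bigcup_ratrect Om : open Om ->
  Om = \bigcup_n (if `[< ratrect n `<=` Om >] then ratrect n else set0).
Proof.
move=> oOm; apply/seteqP; split => p.
  move=> /(open_subrect oOm)[n [np [a [b [c [d [nE abcd]]]]]]].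
  exists n => //; case: ifPn => // /asboolPn[].
  rewrite nE; apply: subset_trans abcd.
  by apply: setSX; exact: subset_itv_oo_cc.
by move=> [n _]; case: ifPn => // /asboolP; exact.
Qed.

Lemma measurable_open_plane Om : open Om -> measurable (Om : set (mR * mR)).
Proof.
move=> /open_bigcup_ratrect ->; apply: bigcupT_measurable => n.
by case: ifPn => // _; exact: measurable_ratrect.
Qed.

Lemma continuous_measurable_plane Om f : open Om ->
  (forall p, Om p -> {for p, continuous f}) ->
  measurable_fun (Om : set (mR * mR)) f.
Proof.
move=> oOm cf; apply: (measurability _ (RGenOpens.measurableE R)).
move=> _ [_ [a [b ->] <-]]; apply: measurable_open_plane.
rewrite openE => p [Omp abfp].
apply: filterI; first exact: open_nbhs_nbhs.
have : nbhs (f p) [set` `]a, b[].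
  by apply: open_nbhs_nbhs; split; [exact: interval_open|].
by move/(cf p Omp).
Qed.

Lemma mu2_rect (A B : set R) : measurable (A : set mR) ->
  measurable (B : set mR) -> @mu2 R (A `*` B) = (leb A * leb B)%E.
Proof. by move=> mA mB; rewrite /mu2 product_measure1E. Qed.

Lemma bounded_subsquare Om : bounded_set Om ->
  exists2 L : R, 0 < L & Om `<=` rect (- L) L (- L) L.
Proof.
move=> [M [_ hM]].
exists (`|M| + 2); first by rewrite ltr_wpDl.
move=> p Omp.
have : `|p| <= `|M| + 1.
  by apply: hM => //; rewrite (le_lt_trans (ler_norm M))// ltrDl.
rewrite prod_normE ge_max => /andP[p1 p2].
have := ler_norm p.1; have := ler_norm p.2.
have := ler_norm (- p.1); have := ler_norm (- p.2); rewrite !normrN => *.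
by split; rewrite /= in_itv/=; lra.
Qed.

Lemma mu2_bounded_lty Om : open Om -> bounded_set Om -> (@mu2 R Om < +oo)%E.
Proof.
move=> oOm /bounded_subsquare[L L0 OmL].
apply: (@le_lt_trans _ _ (@mu2 R (rect (- L) L (- L) L))).
  by apply: le_measure => //; rewrite inE; [exact: measurable_open_plane|exact: measurable_rect].
by rewrite mu2_rect ?lebesgue_measure_itv//=; case: ifPn => _; rewrite ?mul0e -?EFinB -?EFinM ltry.
Qed.

End PlaneMeasure.

(** * The inner product of square-integrable functions *)

Lemma discriminant_le0 (R : realFieldType) (a b c : R) : 0 <= c ->
  (forall t, 0 <= a + 2 * t * b + t ^+ 2 * c) -> b ^+ 2 <= a * c.
Proof.
move=> c0 H; have [c00|cn0] := eqVneq c 0.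
  have [->|bn0] := eqVneq b 0; first by rewrite expr0n/= c00 mulr0.
  (* Without its quadratic term the polynomial is affine, and this [t] gives it the value -1. *)
  exfalso; have := H (- (a + 1) / (2 * b)); rewrite c00 mulr0 addr0.
  have -> : 2 * (- (a + 1) / (2 * b)) * b = - (a + 1) by field.
  lra.
have cp : 0 < c by rewrite lt_def cn0.
have := H (- b / c).
have -> : a + 2 * (- b / c) * b + (- b / c) ^+ 2 * c = a - b ^+ 2 / c by field.
by rewrite subr_ge0 ler_pdivrMr.
Qed.

Section L2theory.
Context {R : realType}.
Local Notation mR := (measurableTypeR R).
Variable Om : set (R * R).
Hypothesis mOm : measurable (Om : set (mR * mR)).
Implicit Types (f g h : R * R -> R).

Definition ip f g : R := \int[@mu2 R]_(p in Om) (f p * g p).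

Definition intg f := (@mu2 R).-integrable Om (EFin \o f).

Lemma intg_measurable f : intg f -> measurable_fun (Om : set (mR * mR)) f.
Proof. by move/integrableP => [/measurable_EFinP]. Qed.

Lemma eq_intg f g : (forall p, Om p -> f p = g p) -> intg f -> intg g.
Proof. by move=> fg; apply: eq_integrable => // p; rewrite inE => /fg/= ->. Qed.

Lemma intgD f g : intg f -> intg g -> intg (f \+ g).
Proof. by move=> F G; have := integrableD mOm F G; apply: eq_integrable. Qed.

Lemma intgZ a f : intg f -> intg (fun p => a * f p).
Proof. by move=> F; have := integrableZl mOm a F; apply: eq_integrable. Qed.

Lemma intgN f : intg f -> intg (\- f).
Proof. by move=> /(intgZ (-1)); apply: eq_intg => p _; rewrite mulN1r. Qed.

Lemma intgB f g : intg f -> intg g -> intg (f \- g).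
Proof. by move=> F /intgN; exact: intgD. Qed.

Lemma le_intg f g : measurable_fun (Om : set (mR * mR)) f -> intg g ->
  (forall p, Om p -> `|f p| <= g p) -> intg f.
Proof.
move=> mf ig fg; apply: (le_integrable mOm _ _ ig).
  exact/measurable_EFinP.
move=> p Omp; rewrite /= lee_fin (le_trans (fg _ Omp))//; exact: ler_norm.
Qed.

Lemma eq_Rint f g : (forall p, Om p -> f p = g p) ->
  \int[@mu2 R]_(p in Om) f p = \int[@mu2 R]_(p in Om) g p.
Proof. by move=> fg; apply: eq_Rintegral => p; rewrite inE => /fg. Qed.

Lemma RintD f g : intg f -> intg g ->
  \int[@mu2 R]_(p in Om) (f p + g p) =
  \int[@mu2 R]_(p in Om) f p + \int[@mu2 R]_(p in Om) g p.
Proof. exact: RintegralD. Qed.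

Lemma RintB f g : intg f -> intg g ->
  \int[@mu2 R]_(p in Om) (f p - g p) =
  \int[@mu2 R]_(p in Om) f p - \int[@mu2 R]_(p in Om) g p.
Proof. exact: RintegralB. Qed.

Lemma RintZ a f : intg f ->
  \int[@mu2 R]_(p in Om) (a * f p) = a * \int[@mu2 R]_(p in Om) f p.
Proof. exact: RintegralZl. Qed.

Lemma intg_sum (I : Type) (s : seq I) (F : I -> R * R -> R) :
  (forall i, intg (F i)) -> intg (fun p => \sum_(i <- s) F i p).
Proof.
move=> iF; elim: s => [|i s IH].
  apply: (@eq_intg (cst 0)); first by move=> p _; rewrite big_nil.
  exact: integrable0.
apply: (@eq_intg (F i \+ (fun p => \sum_(i <- s) F i p))).
  by move=> p _; rewrite big_cons.
exact: intgD.
Qed.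

Lemma Rint_sum (I : Type) (s : seq I) (F : I -> R * R -> R) :
  (forall i, intg (F i)) ->
  \int[@mu2 R]_(p in Om) (\sum_(i <- s) F i p) =
  \sum_(i <- s) \int[@mu2 R]_(p in Om) F i p.
Proof.
move=> iF; elim: s => [|i s IH].
  rewrite big_nil (@eq_Rint _ (cst 0)) ?Rintegral_cst ?mul0r// => p _.
  by rewrite big_nil.
rewrite big_cons -IH -RintD//; last exact: intg_sum.
by apply: eq_Rint => p _; rewrite big_cons.
Qed.

Lemma L2_sqr f : L2 Om f -> intg (fun p => f p ^+ 2).
Proof. by case. Qed.

Lemma eq_L2 f g : (forall p, Om p -> f p = g p) -> L2 Om f -> L2 Om g.
Proof.
move=> fg [mf if2]; split.
  by apply: eq_measurable_fun mf => p; rewrite inE => /fg.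
by apply: eq_intg if2 => p /fg/= ->.
Qed.

Lemma L2_intgM f g : L2 Om f -> L2 Om g -> intg (fun p => f p * g p).
Proof.
move=> [mf if2] [mg ig2].
apply: (@le_intg _ (fun p => f p ^+ 2 + g p ^+ 2)).
- exact: measurable_funM.
- exact: intgD.
- move=> p _; rewrite normrM -(real_normK (num_real (f p))) -(real_normK (num_real (g p))).
  by have := sqr_ge0 (`|f p| - `|g p|); have := sqr_ge0 (`|f p| + `|g p|); nra.
Qed.

Lemma L2D f g : L2 Om f -> L2 Om g -> L2 Om (f \+ g).
Proof.
move=> f2 g2; split; first by apply: measurable_funD; [exact: f2.1|exact: g2.1].
apply: (@eq_intg ((fun p => f p ^+ 2) \+ ((fun p => 2 * (f p * g p)) \+ (fun p => g p ^+ 2)))).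
  by move=> p _ /=; ring.
by apply: intgD; [exact: f2.2|apply: intgD; [exact/intgZ/L2_intgM|exact: g2.2]].
Qed.

Lemma L2Z a f : L2 Om f -> L2 Om (fun p => a * f p).
Proof.
move=> f2; split; first by apply: measurable_funM => //; exact: f2.1.
apply: (@eq_intg (fun p => a ^+ 2 * (f p ^+ 2))).
  by move=> p _ /=; ring.
exact/intgZ/f2.2.
Qed.

Lemma L2N f : L2 Om f -> L2 Om (\- f).
Proof. by move=> /(L2Z (-1)); apply: eq_L2 => p _; rewrite mulN1r. Qed.

Lemma L2B f g : L2 Om f -> L2 Om g -> L2 Om (f \- g).
Proof. by move=> F /L2N; exact: L2D. Qed.

Lemma ipC f g : ip f g = ip g f.
Proof. by apply: eq_Rint => p _; rewrite mulrC. Qed.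

Lemma L2sqE f : L2sq Om f = ip f f.
Proof. by apply: eq_Rint => p _; rewrite expr2. Qed.

Lemma eq_ip f g f' g' : (forall p, Om p -> f p = f' p) ->
  (forall p, Om p -> g p = g' p) -> ip f g = ip f' g'.
Proof. by move=> ff gg; apply: eq_Rint => p Omp; rewrite ff ?gg. Qed.

Lemma ipDl f g h : L2 Om f -> L2 Om g -> L2 Om h ->
  ip (f \+ g) h = ip f h + ip g h.
Proof.
move=> f2 g2 h2; rewrite /ip -RintD; [|exact: L2_intgM..].
by apply: eq_Rint => p _ /=; rewrite mulrDl.
Qed.

Lemma ipDr f g h : L2 Om f -> L2 Om g -> L2 Om h ->
  ip h (f \+ g) = ip h f + ip h g.
Proof. by move=> *; rewrite ipC ipDl// !(ipC h). Qed.

Lemma ipZl a f g : L2 Om f -> L2 Om g -> ip (fun p => a * f p) g = a * ip f g.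
Proof.
move=> f2 g2; rewrite /ip -RintZ; last exact: L2_intgM.
by apply: eq_Rint => p _ /=; rewrite mulrA.
Qed.

Lemma ipZr a f g : L2 Om f -> L2 Om g -> ip f (fun p => a * g p) = a * ip f g.
Proof. by move=> *; rewrite ipC ipZl// (ipC f). Qed.

Lemma ipNl f g : L2 Om f -> L2 Om g -> ip (\- f) g = - ip f g.
Proof.
move=> f2 g2; rewrite -mulN1r -ipZl//; apply: eq_ip => // p _.
by rewrite mulN1r.
Qed.

Lemma ipBl f g h : L2 Om f -> L2 Om g -> L2 Om h ->
  ip (f \- g) h = ip f h - ip g h.
Proof. by move=> f2 g2 h2; rewrite -ipNl// -ipDl//; exact: L2N. Qed.

Lemma ipBr f g h : L2 Om f -> L2 Om g -> L2 Om h ->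
  ip h (f \- g) = ip h f - ip h g.
Proof. by move=> *; rewrite ipC ipBl// !(ipC h). Qed.

Lemma ip_ge0 f : 0 <= ip f f.
Proof. by apply: Rintegral_ge0 => p _; rewrite -expr2 sqr_ge0. Qed.

Lemma ip_sqrD f g : L2 Om f -> L2 Om g ->
  ip (f \+ g) (f \+ g) = ip f f + 2 * ip f g + ip g g.
Proof.
move=> f2 g2; have fg2 := L2D f2 g2.
by rewrite ipDl// !ipDr// (ipC g f); ring.
Qed.

Lemma ip_sqrB f g : L2 Om f -> L2 Om g ->
  ip (f \- g) (f \- g) = ip f f - 2 * ip f g + ip g g.
Proof.
move=> f2 g2; have fg2 := L2B f2 g2.
by rewrite ipBl// !ipBr// (ipC g f); ring.
Qed.

Lemma ip_CS f g : L2 Om f -> L2 Om g -> ip f g ^+ 2 <= ip f f * ip g g.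
Proof.
move=> f2 g2; apply: discriminant_le0; first exact: ip_ge0.
move=> t; have tg2 := L2Z t g2.
have := ip_ge0 (f \+ (fun p => t * g p)).
by rewrite ip_sqrD// ipZl// !ipZr//; lra.
Qed.

Lemma ip_sqrD_le f g : L2 Om f -> L2 Om g ->
  ip (f \+ g) (f \+ g) <= 2 * ip f f + 2 * ip g g.
Proof.
move=> f2 g2; have := ip_ge0 (f \- g).
by rewrite ip_sqrB// ip_sqrD//; lra.
Qed.

Lemma ip_sqrB_le f g : L2 Om f -> L2 Om g ->
  ip (f \- g) (f \- g) <= 2 * ip f f + 2 * ip g g.
Proof.
move=> f2 g2; have := ip_ge0 (f \+ g).
by rewrite ip_sqrB// ip_sqrD//; lra.
Qed.

Lemma ip_normal0 f g : L2 Om f -> L2 Om g -> ip f f = 0 -> ip f g = 0.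
Proof.
move=> f2 g2 f0; have := ip_CS f2 g2; rewrite f0 mul0r.
by have := sqr_ge0 (ip f g) => a b; apply/eqP; rewrite -sqrf_eq0 eq_le a b.
Qed.

Hypothesis fOm : (@mu2 R Om < +oo)%E.

Lemma bounded_intg f M : measurable_fun (Om : set (mR * mR)) f ->
  (forall p, Om p -> `|f p| <= M) -> intg f.
Proof.
move=> mf fM; apply: measurable_bounded_integrable => //.
exists M; split; first exact: num_real.
by move=> x Mx p /= Omp; rewrite (le_trans (fM p Omp))// ltW.
Qed.

Lemma bounded_L2 f M : measurable_fun (Om : set (mR * mR)) f ->
  (forall p, Om p -> `|f p| <= M) -> L2 Om f.
Proof.
move=> mf fM; split => //; apply: (@bounded_intg _ (M ^+ 2)).
  exact: measurable_funX.
by move=> p Omp; rewrite normrX lerXn2r ?nnegrE ?fM// (le_trans _ (fM p Omp)).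
Qed.

Lemma L2_cst a : L2 Om (cst a).
Proof. by apply: (@bounded_L2 _ `|a|). Qed.

Lemma L2_intg f : L2 Om f -> intg f.
Proof.
move=> f2; have := L2_intgM f2 (L2_cst 1).
by apply: eq_intg => p _ /=; rewrite mulr1.
Qed.

End L2theory.

(** * Smooth functions and test functions *)

Section DirectionalDerivative.
Context {R : realType} {V : normedModType R}.
Implicit Types (f g : V -> R) (p v : V).

(** Both difference quotients are the same function of the increment. The chain rule and the
    restriction to horizontal and vertical lines thereby reduce to calculus in one variable. *)
Lemma is_derive_line f p v (t df : R) :
  is_derive (t *: v + p) v f df <->
  is_derive t 1 (fun h : R => f (h *: v + p)) df.
Proof.
have E : (fun h : R => h^-1 *: ((f \o shift (t *: v + p)) (h *: v) - f (t *: v + p))) =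
  (fun h : R => h^-1 *: (((fun h : R => f (h *: v + p)) \o shift t) (h *: 1) -
     f (t *: v + p))).
  apply/funext => h /=.
  by rewrite addrA -scalerDl [h *: 1]mulr1.
have Ed : derivable f (t *: v + p) v =
    derivable (fun h : R => f (h *: v + p)) t 1 by rewrite /derivable E.
have ED : 'D_v f (t *: v + p) = 'D_1 (fun h : R => f (h *: v + p)) t.
  by rewrite /derive E.
split=> -[d1 d2].
  by apply: DeriveDef; [rewrite -Ed|rewrite -ED].
by apply: DeriveDef; [rewrite Ed|rewrite ED].
Qed.

Lemma is_deriveDf f g p v a b : is_derive p v f a -> is_derive p v g b ->
  is_derive p v (fun x => f x + g x) (a + b).
Proof. by move=> fa gb; exact: is_deriveD. Qed.

Lemma is_deriveMf f g p v a b : is_derive p v f a -> is_derive p v g b ->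
  is_derive p v (fun x => f x * g x) (a * g p + f p * b).
Proof.
move=> fa gb; have -> : a * g p + f p * b = f p *: b + g p *: a.
  by rewrite addrC (mulrC a).
exact: (is_deriveM fa gb).
Qed.

Lemma is_deriveZf k f p v a : is_derive p v f a ->
  is_derive p v (fun x => k * f x) (k * a).
Proof. by move=> fa; exact: is_deriveZ. Qed.

Lemma is_deriveBf f g p v a b : is_derive p v f a -> is_derive p v g b ->
  is_derive p v (fun x => f x - g x) (a - b).
Proof. by move=> fa gb; exact: is_deriveB. Qed.

Lemma is_deriveXf n f p v a : is_derive p v f a ->
  is_derive p v (fun x => f x ^+ n) (n%:R * f p ^+ n.-1 * a).
Proof.
move=> fa; rewrite (_ : (fun x => _) = f ^+ n); last first.
  by apply/funext => x; rewrite exprfctE.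
exact: is_deriveX.
Qed.

Lemma is_derive_chain (F : R -> R) f p v a b :
  is_derive p v f a -> is_derive (f p) 1 F b ->
  is_derive p v (fun x => F (f x)) (b * a).
Proof.
move=> fa Fb; have E : p = 0 *: v + p by rewrite scale0r add0r.
rewrite [X in is_derive X]E; apply/is_derive_line.
apply: (@is_derive1_comp R F (fun h => f (h *: v + p)) 0 b a).
  by rewrite scale0r add0r.
by apply/is_derive_line; rewrite -E.
Qed.

End DirectionalDerivative.

Section Slices.
Context {R : realType}.
Implicit Types (f g : R * R -> R) (p : R * R).

Lemma axis_line (b : bool) (t : R) p : t *: axis b + p =
  if b then (p.1, t + p.2) else (t + p.1, p.2).
Proof.
case: p => x y; case: b; rewrite /axis /ex /ey /=.
  by congr (_, _) => /=; rewrite ?scaler0 ?add0r// /GRing.scale/= mulr1.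
by congr (_, _) => /=; rewrite ?scaler0 ?add0r// /GRing.scale/= mulr1.
Qed.

Lemma is_derive_slice1 f x y df :
  is_derive (x, y) (axis false) f df <-> is_derive x 1 (fun s : R => f (s, y)) df.
Proof.
have E : (fun h : R => f (h *: axis false + (0, y))) = (fun s : R => f (s, y)).
  by apply/funext => h; rewrite axis_line /= addr0.
have := is_derive_line f (0, y) (axis false) x df.
by rewrite E axis_line /= addr0.
Qed.

Lemma is_derive_slice2 f x y df :
  is_derive (x, y) (axis true) f df <-> is_derive y 1 (fun s : R => f (x, s)) df.
Proof.
have E : (fun h : R => f (h *: axis true + (x, 0))) = (fun s : R => f (x, s)).
  by apply/funext => h; rewrite axis_line /= addr0.
have := is_derive_line f (x, 0) (axis true) y df.
by rewrite E axis_line /= addr0.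
Qed.

End Slices.

(** * Algebras of functions stable under differentiation *)

Section SmoothAlgebra.
Context {R : realType}.
Implicit Types (f g : R * R -> R) (S : set (R * R -> R)).

(** [smooth_on] speaks of all iterated partials, so the induction has to run over a class that
    differentiation preserves. The algebra generated by [S] is such a class, by the Leibniz rule, as
    soon as the partials of the elements of [S] fall back into it. *)
Inductive falg S : (R * R -> R) -> Prop :=
| falg_base f : S f -> falg S f
| falg_cst a : falg S (fun=> a)
| falg_add f g : falg S f -> falg S g -> falg S (fun p => f p + g p)
| falg_mul f g : falg S f -> falg S g -> falg S (fun p => f p * g p).

Lemma smooth_falg S :
  (forall f, S f -> continuous f) ->
  (forall f b p, S f -> derivable f p (axis b)) ->
  (forall f b, S f -> falg S ('D_(axis b) f)) ->
  forall f, falg S f -> smooth_on setT f.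
Proof.
move=> Sc Sd SD.
have falg_c f : falg S f -> continuous f.
  elim=> {f}[f /Sc//|a|f g _ cf _ cg|f g _ cf _ cg] p.
  - exact: cvg_cst.
  - by apply: cvgD; [exact: cf|exact: cg].
  - by apply: cvgM; [exact: cf|exact: cg].
have falg_d f b : falg S f ->
    (forall p, derivable f p (axis b)) /\ falg S ('D_(axis b) f).
  elim=> {f}[f Sf|a|f g Ff [df Df] Fg [dg Dg]|f g Ff [df Df] Fg [dg Dg]].
  - by split => [p|]; [exact: Sd|exact: SD].
  - split => [p|]; first exact: derivable_cst.
    rewrite (_ : 'D_(axis b) _ = fun=> 0); first exact: falg_cst.
    by apply/funext => p; rewrite derive_cst.
  - have D p := is_deriveDf (derivableP (df p)) (derivableP (dg p)).
    split => [p|]; first by case: (D p).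
    rewrite (_ : 'D_(axis b) _ = fun p => 'D_(axis b) f p + 'D_(axis b) g p).
      exact: falg_add.
    by apply/funext => p; case: (D p).
  - have D p := is_deriveMf (derivableP (df p)) (derivableP (dg p)).
    split => [p|]; first by case: (D p).
    rewrite (_ : 'D_(axis b) _ = fun p => 'D_(axis b) f p * g p + f p * 'D_(axis b) g p).
      by apply: falg_add; apply: falg_mul.
    by apply/funext => p; case: (D p).
have falg_iter s f : falg S f -> falg S (iter_partial s f).
  by move=> Ff; elim: s => //= b s /(falg_d _ b)[].
move=> f Ff s p _; split; first exact/falg_c/falg_iter.
by move=> b; have [] := falg_d _ b (falg_iter s _ Ff).
Qed.

Lemma smooth_continuous f : smooth_on setT f -> continuous f.
Proof. by move=> sf p; have [] := sf [::] p I. Qed.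

Lemma smooth_derivable f b p : smooth_on setT f -> derivable f p (axis b).
Proof. by move=> sf; have [_] := sf [::] p I. Qed.

(** [foldr] differentiates along the last letter first, so an additional inner derivative is a
    letter appended at the end of the word. *)
Lemma smooth_partial f b : smooth_on setT f -> smooth_on setT ('D_(axis b) f).
Proof. by move=> sf s; have := sf (rcons s b); rewrite /iter_partial foldr_rcons. Qed.

Lemma smooth_is_derive f b p : smooth_on setT f ->
  is_derive p (axis b) f ('D_(axis b) f p).
Proof. by move=> sf; apply/derivableP/smooth_derivable. Qed.

Lemma falg_smooth f : falg (smooth_on setT) f -> smooth_on setT f.
Proof.
apply: smooth_falg => {f}.
- by move=> f /smooth_continuous.
- by move=> f b p; exact: smooth_derivable.
- by move=> f b /(@smooth_partial _ b) sf; exact: falg_base.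
Qed.

Lemma smooth_cst a : smooth_on setT (fun=> a : R).
Proof. exact/falg_smooth/falg_cst. Qed.

Lemma smoothD f g : smooth_on setT f -> smooth_on setT g ->
  smooth_on setT (fun p => f p + g p).
Proof. by move=> sf sg; apply/falg_smooth/falg_add; exact: falg_base. Qed.

Lemma smoothM f g : smooth_on setT f -> smooth_on setT g ->
  smooth_on setT (fun p => f p * g p).
Proof. by move=> sf sg; apply/falg_smooth/falg_mul; exact: falg_base. Qed.

(** Differentiation of the sine brings in the cosine, so both compositions are taken as generators,
    next to all smooth functions. *)
Lemma smooth_sin f : smooth_on setT f -> smooth_on setT (fun p => sin (f p)).
Proof.
move=> sf; pose S := [set g | smooth_on setT g \/ g = (fun p => sin (f p)) \/
  g = (fun p => cos (f p))].
have dsin b p := is_derive_chain (smooth_is_derive b p sf) (is_derive_sin (f p)).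
have dcos b p := is_derive_chain (smooth_is_derive b p sf) (is_derive_cos (f p)).
apply: (@smooth_falg S); last by apply: falg_base; right; left.
- move=> g [/smooth_continuous//|[->|->]] p.
    apply: (@continuous_comp _ _ _ f sin); last exact: continuous_sin.
    exact: smooth_continuous.
  apply: (@continuous_comp _ _ _ f cos); last exact: continuous_cos.
  exact: smooth_continuous.
- move=> g b p [sg|[->|->]]; first exact: smooth_derivable.
    by case: (dsin b p).
  by case: (dcos b p).
- have SDf b : falg S ('D_(axis b) f) by apply: falg_base; left; exact: smooth_partial.
  move=> g b [sg|[->|->]]; first by apply: falg_base; left; exact: smooth_partial.
    rewrite (_ : 'D_(axis b) _ = fun p => cos (f p) * 'D_(axis b) f p).
      by apply: falg_mul => //; apply: falg_base; right; right.
    by apply/funext => p; case: (dsin b p).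
  rewrite (_ : 'D_(axis b) _ = fun p => (-1 * sin (f p)) * 'D_(axis b) f p).
    apply: falg_mul => //; apply: falg_mul; first exact: falg_cst.
    by apply: falg_base; right; left.
  by apply/funext => p; rewrite mulN1r; case: (dcos b p).
Qed.

End SmoothAlgebra.

(** * Smooth bumps with compact support *)

Section Bump.
Context {R : realType}.
Implicit Types (s : R) (k : nat).

(* [exp (-1/s)] times a power of [1/s]: this family is closed under differentiation. *)
Definition ebump k s : R := if 0 < s then s^-1 ^+ k * expR (- s^-1) else 0.

Lemma ebump_ge0 k s : 0 <= ebump k s.
Proof.
rewrite /ebump; case: ifPn => // s0.
by rewrite mulr_ge0 ?expR_ge0// exprn_ge0// invr_ge0 ltW.
Qed.

(** The exponential series bounds [expR s^-1] from below by its term of degree [k.+1], one more than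
    the power of [s^-1] in [ebump k]. The surplus factor [s] gives the decay at the origin. *)
Lemma ebump_le k s : ebump k s <= (k.+1)`!%:R * `|s|.
Proof.
rewrite /ebump; case: ifPn => [s0|_]; last by rewrite mulr_ge0.
rewrite gtr0_norm// expRN.
have si0 : 0 < s^-1 by rewrite invr_gt0.
have fac0 : 0 < (k.+1)`!%:R :> R by rewrite ltr0n fact_gt0.
rewrite ler_pdivrMr ?expR_gt0//.
have h : (s^-1) ^+ k.+1 / (k.+1)`!%:R <= expR s^-1.
  by apply: le_trans (expR_ge1Dxn k (ltW si0)); rewrite lerDr.
apply: le_trans (ler_wpM2l _ h); last by rewrite mulr_ge0// ltW.
rewrite exprS le_eqVlt; apply/orP; left; apply/eqP.
by field; rewrite gt_eqF//= gt_eqF.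
Qed.

Lemma ebump_cvg0 k : ebump k s @[s --> (0:R)] --> (0:R).
Proof.
apply: (@squeeze_cvgr _ _ _ _ (fun=> 0) (fun s => (k.+1)`!%:R * `|s|)).
- by near=> s; rewrite ebump_ge0 ebump_le.
- exact: cvg_cst.
- rewrite -[X in _ --> X](mulr0 ((k.+1)`!%:R)); apply: cvgM; first exact: cvg_cst.
  by rewrite -[X in _ --> X](@normr0 R R); apply: cvg_norm; exact: cvg_id.
Unshelve. all: by end_near. Qed.

Lemma is_derive_ebump k s :
  is_derive s 1 (ebump k) (- k%:R * ebump k.+1 s + ebump k.+2 s).
Proof.
have [s0|s0|->] := ltgtP s 0.
- apply: (@near_eq_is_derive _ _ _ (cst 0)).
    by near=> t; rewrite /ebump ifF//; apply/negbTE; rewrite -leNgt ltW//; near: t; exact: lt_nbhsl.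
  by rewrite /ebump ltNge (ltW s0)/= mulr0 addr0; exact: is_derive_cst.
- apply: (@near_eq_is_derive _ _ _ (fun s => s^-1 ^+ k * expR (- s^-1))).
    by near=> t; rewrite /ebump ifT//; near: t; exact: lt_nbhsr.
  have sn0 : s != 0 by rewrite gt_eqF.
  have dV : is_derive s 1 (fun s : R => s^-1) (- s ^- 2).
    apply: DeriveDef; first exact: derivableV.
    by rewrite deriveV// derive_id [_ *: _]mulr1.
  have dX := is_deriveXf k dV.
  have dN : is_derive s 1 (fun s : R => - s^-1) (s ^- 2).
    by rewrite -[s ^- 2]opprK; exact: is_deriveN.
  have dE := is_derive_chain dN (is_derive_expR (- s^-1)).
  have dM := is_deriveMf dX dE. apply: (is_derive_eq dM).
  rewrite /ebump s0; case: k {dX dM} => [|k] /=.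
    by rewrite !mulr0n oppr0 !mul0r !add0r expr0 mul1r -exprVn mulrC.
  by rewrite -!exprVn !exprS; ring.
(* At the origin the difference quotient of [ebump k] is [ebump k.+1] itself, which tends to 0. *)
- have E : (fun h : R => h^-1 *: ((ebump k \o shift 0) (h *: 1) - ebump k 0)) @ 0^' -->
      (0 : R).
    apply: (@cvg_trans _ (ebump k.+1 @ 0^')); last exact: cvg_within_filter (ebump_cvg0 k.+1).
    apply: near_eq_cvg; near=> h.
    have h0 : h != 0 by near: h; exact: nbhs_dnbhs_neq.
    have e0 : ebump k 0 = 0 by rewrite /ebump ltxx.
    rewrite /= addr0 e0 subr0 [h *: 1]mulr1 /ebump.
    case: ifPn => _; last by rewrite scaler0.
    by rewrite exprS -mulrA.
  apply: DeriveDef; first by apply/cvg_ex; exists 0.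
  by rewrite /ebump ltxx mulr0 addr0; apply/cvg_lim.
Unshelve. all: by end_near. Qed.

End Bump.

Section TestFunctions.
Context {R : realType}.
Implicit Types (Om : set (R * R)) (f g phi : R * R -> R).

Lemma ebump_continuous k : continuous (@ebump R k).
Proof.
move=> s; have [d _] := is_derive_ebump k s.
exact/differentiable_continuous/derivable1_diffP.
Qed.

Lemma continuous_affine (a b c : R) :
  continuous (fun p : R * R => a * p.1 + b * p.2 + c).
Proof.
move=> p; apply: cvgD; last exact: cvg_cst.
by apply: cvgD; (apply: cvgM; [exact: cvg_cst|]); [exact: cvg_fst|exact: cvg_snd].
Qed.

Lemma is_derive_affine (a b c : R) (d : bool) p :
  is_derive p (axis d) (fun p : R * R => a * p.1 + b * p.2 + c) (if d then b else a).
Proof.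
have H (a' c' x : R) : is_derive x 1 (fun s => a' * s + c') a'.
  have H := is_deriveDf (is_deriveZf a' (is_derive_id x (1 : R))) (is_derive_cst c' x 1).
  by apply: (is_derive_eq H); rewrite addr0 mulr1.
case: p => x y; case: d.
  apply/is_derive_slice2; rewrite (_ : (fun s => _) = fun s => b * s + (a * x + c)) //.
  by apply/funext => s /=; ring.
apply/is_derive_slice1; rewrite (_ : (fun s => _) = fun s => a * s + (b * y + c)) //.
by apply/funext => s /=; ring.
Qed.

Lemma smooth_ebump_affine k (a b c : R) :
  smooth_on setT (fun p : R * R => ebump k (a * p.1 + b * p.2 + c)).
Proof.
pose S := [set f | exists k (a b c : R),
  f = (fun p : R * R => ebump k (a * p.1 + b * p.2 + c))].
have D k' a' b' c' d p := is_derive_chain (is_derive_affine a' b' c' d p)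
  (is_derive_ebump k' (a' * p.1 + b' * p.2 + c')).
apply: (@smooth_falg _ S); last by apply: falg_base; exists k, a, b, c.
- move=> _ [k' [a' [b' [c' ->]]]] p.
  apply: (@continuous_comp _ _ _ (fun p : R * R => a' * p.1 + b' * p.2 + c') (ebump k')).
    exact: continuous_affine.
  exact: ebump_continuous.
- by move=> _ d p [k' [a' [b' [c' ->]]]]; case: (D k' a' b' c' d p).
- move=> _ d [k' [a' [b' [c' ->]]]].
  rewrite (_ : 'D_(axis d) _ = fun p => ((fun=> - k'%:R) p *
    (fun p => ebump k'.+1 (a' * p.1 + b' * p.2 + c')) p +
    (fun p => ebump k'.+2 (a' * p.1 + b' * p.2 + c')) p) * (fun=> if d then b' else a') p).
    apply: falg_mul; last exact: falg_cst.
    apply: falg_add; last by apply: falg_base; do 4 eexists.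
    by apply: falg_mul; [exact: falg_cst|apply: falg_base; do 4 eexists].
  by apply/funext => p; case: (D k' a' b' c' d p).
Qed.

(** One factor for each side of the rectangle. The coefficients 0, 1 and -1 are written out so that
    each factor is literally an instance of [smooth_ebump_affine]. *)
Definition rect_bump (a b c d : R) (p : R * R) : R :=
  ebump 0 (1 * p.1 + 0 * p.2 - a) * ebump 0 (-1 * p.1 + 0 * p.2 + b) *
  (ebump 0 (0 * p.1 + 1 * p.2 - c) * ebump 0 (0 * p.1 + -1 * p.2 + d)).

Lemma smooth_rect_bump a b c d : smooth_on setT (rect_bump a b c d).
Proof. by apply: smoothM; apply: smoothM; exact: smooth_ebump_affine. Qed.

Lemma ebump0_gt0 (s : R) : (0 < ebump 0 s) = (0 < s).
Proof. by rewrite /ebump; case: ifPn => // _; rewrite expr0 mul1r expR_gt0. Qed.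

Lemma ebump0_le1 (s : R) : ebump 0 s <= 1.
Proof.
rewrite /ebump; case: ifPn => // s0.
by rewrite expr0 mul1r expRN invf_le1 ?expR_gt0// -expR0 ler_expR invr_ge0 ltW.
Qed.

Lemma rect_bump_bounds a b c d p : 0 <= rect_bump a b c d p <= 1.
Proof.
rewrite /rect_bump !mulr_ge0 ?ebump_ge0//=.
by rewrite !mulr_ile1 ?mulr_ge0 ?ebump_ge0 ?ebump0_le1.
Qed.

Lemma rect_bump_gt0 a b c d p : rect a b c d p -> 0 < rect_bump a b c d p.
Proof.
move=> [/=]; rewrite !in_itv/= => /andP[p1 p2] /andP[p3 p4].
by rewrite /rect_bump !mulr_gt0// ebump0_gt0; lra.
Qed.

Lemma rect_bump_eq0 a b c d p : ~ rect a b c d p -> rect_bump a b c d p = 0.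
Proof.
have pos (s : R) : ebump 0 s != 0 -> 0 < s.
  by rewrite -ebump0_gt0 lt_def ebump_ge0 andbT.
move=> np; apply/eqP; apply: contrapT => /negP.
rewrite /rect_bump !mulf_eq0 !negb_or.
move=> /andP[/andP[/pos h1 /pos h2] /andP[/pos h3 /pos h4]]; apply: np.
by split; rewrite /= in_itv/=; lra.
Qed.

Lemma test_support Om phi : test_function Om phi ->
  exists K, [/\ compact K, closed K, K `<=` Om & forall p, ~ K p -> phi p = 0].
Proof.
move=> [_ [K [cK KOm K0]]]; exists K; split => //.
exact: (compact_closed (@norm_hausdorff _ _) cK).
Qed.

Lemma test_rect_bump Om a b c d : `[a, b] `*` `[c, d] `<=` Om ->
  test_function Om (rect_bump a b c d).
Proof.
move=> abcd; split; first exact: smooth_rect_bump.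
exists (`[a, b] `*` `[c, d]); split => //.
  by apply: compact_setX; exact: segment_compact.
move=> p np; apply: rect_bump_eq0; apply: contra_not np.
by apply: setSX; exact: subset_itv_oo_cc.
Qed.

Lemma test0 Om : test_function Om (fun=> 0).
Proof.
split; first exact: smooth_cst.
by exists set0; split => //; exact: compact0.
Qed.

Lemma testD Om f g : test_function Om f -> test_function Om g ->
  test_function Om (fun p => f p + g p).
Proof.
move=> [sf [K [cK KO f0]]] [sg [L [cL LO g0]]]; split; first exact: smoothD.
exists (K `|` L); split; [exact: compactU|by rewrite subUset|].
by move=> p /not_orP[pK pL]; rewrite f0// g0// addr0.
Qed.

Lemma testMl Om f g : smooth_on setT g -> test_function Om f ->
  test_function Om (fun p => g p * f p).
Proof.
move=> sg [sf [K [cK KO f0]]]; split; first exact: smoothM.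
by exists K; split => // p pK; rewrite f0// mulr0.
Qed.

Lemma testZ Om a f : test_function Om f -> test_function Om (fun p => a * f p).
Proof. by apply: testMl; exact: smooth_cst. Qed.

Lemma testB Om f g : test_function Om f -> test_function Om g ->
  test_function Om (fun p => f p - g p).
Proof.
move=> tf tg; have := testD tf (testZ (-1) tg).
by congr (test_function _ _); apply/funext => p; rewrite mulN1r.
Qed.

Lemma test_sin Om f : test_function Om f -> test_function Om (fun p => sin (f p)).
Proof.
move=> [sf [K [cK KO f0]]]; split; first exact: smooth_sin.
by exists K; split => // p pK; rewrite f0// sin0.
Qed.

(** A sum of bumps may exceed 1, whereas this smooth form of a union stays between 0 and 1 when the
    [f i] do, so it can approximate an indicator. *)
Lemma test_union Om (f : nat -> R * R -> R) n :
  (forall i, test_function Om (f i)) ->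
  test_function Om (fun p => 1 - \prod_(i < n) (1 - f i p)).
Proof.
move=> tf; elim: n => [|n IH].
  rewrite (_ : (fun p => _) = fun=> 0); first exact: test0.
  by apply/funext => p; rewrite big_ord0 subrr.
have := testB (testD IH (tf n)) (testMl IH.1 (tf n)).
congr (test_function _ _); apply/funext => p.
by rewrite big_ord_recr/=; ring.
Qed.

Lemma test_partial_eq0 Om f b : test_function Om f ->
  exists K, [/\ compact K, closed K, K `<=` Om,
    (forall p, ~ K p -> f p = 0) & forall p, ~ K p -> 'D_(axis b) f p = 0].
Proof.
move=> tf; have [K [cK clK KO f0]] := test_support tf.
exists K; split => // p pK.
rewrite (@near_eq_derive _ _ _ f (cst 0)) ?derive_cst//.
have : nbhs p (~` K) by apply: open_nbhs_nbhs; split => //; exact: closed_openC.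
by apply: filterS => q /f0.
Qed.

Lemma test_partial Om f b : test_function Om f ->
  test_function Om ('D_(axis b) f).
Proof.
move=> tf; split; first exact/smooth_partial/tf.1.
by have [K [cK clK KO f0 Df0]] := test_partial_eq0 b tf; exists K.
Qed.

Lemma test_bounded Om f : test_function Om f -> exists2 M, 0 < M & forall p, `|f p| <= M.
Proof.
move=> [sf [K [cK KO f0]]].
have cfK : {within K, continuous f}.
  exact/continuous_subspaceT/smooth_continuous.
have /compact_bounded[M [_ hM]] := continuous_compact cfK cK.
exists (`|M| + 1) => [|p]; first by rewrite ltr_wpDl.
have [Kp|nKp] := pselect (K p); last by rewrite f0// normr0 addr_ge0.
apply: hM; last by exists p.
by rewrite (le_lt_trans (ler_norm M))// ltrDl.
Qed.

End TestFunctions.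

(** * Integration by parts *)

Section CompactIntegrationByParts.
Context {R : realType}.
Local Notation mR := (measurableTypeR R).
Local Notation leb := (@lebesgue_measure R).
Implicit Types (Om : set (R * R)) (f g phi : R * R -> R).

Lemma FTC_segment (F f : R -> R) (a b : R) : a <= b -> continuous f ->
  (forall x : R, is_derive x 1 F (f x)) ->
  (\int[leb]_(x in `[a, b]) (f x)%:E = (F b - F a)%:E)%E.
Proof.
rewrite le_eqVlt => /predU1P[<-|ab] cf dF.
  by rewrite set_itv1 integral_set1 subrr.
have cF x : {for x, continuous F}.
  by apply/differentiable_continuous/derivable1_diffP; case: (dF x).
rewrite EFinB; apply: continuous_FTC2 => //.
- exact: continuous_subspaceT.
- split; [by move=> x _; case: (dF x)|exact/cvg_at_right_filter/cF|].
  exact/cvg_at_left_filter/cF.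
- by move=> x _; rewrite derive1E; case: (dF x).
Qed.

Lemma integral_derive_compact (F f : R -> R) (L : R) : 0 < L -> continuous f ->
  (forall x : R, is_derive x 1 F (f x)) ->
  (forall x : R, x \notin `[- L, L] -> F x = 0 /\ f x = 0) ->
  (\int[leb]_x (f x)%:E = 0)%E.
Proof.
move=> L0 cf dF F0.
(* One unit beyond [L]: the endpoints must lie outside [[- L, L]], where [F] is known to vanish. *)
transitivity (\int[leb]_(x in `[(- (L + 1))%R, (L + 1)%R]) (f x)%:E)%E.
  rewrite [RHS]integral_mkcond; apply: eq_integral => x _.
  rewrite patchE; case: ifPn => // /negP; rewrite inE /= in_itv/= => xL.
  congr EFin; apply: (F0 x _).2; rewrite in_itv/=; apply/negP => /andP[h1 h2].
  by apply: xL; apply/andP; split; lra.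
rewrite (FTC_segment _ cf dF); last by lra.
rewrite !(F0 _ _).1 ?subrr//; rewrite in_itv/=; apply/negP => /andP[h1 h2]; lra.
Qed.

Lemma int_partial_compact (b : bool) g (L : R) : 0 < L ->
  (forall p, derivable g p (axis b)) -> continuous ('D_(axis b) g) ->
  (forall p, ~ (`[- L, L] `*` `[- L, L]) p -> g p = 0 /\ 'D_(axis b) g p = 0) ->
  \int[@mu2 R]_p 'D_(axis b) g p = 0.
Proof.
move=> L0 dg cf g0; set f := 'D_(axis b) g.
pose Q : set (mR * mR) := `[- L, L] `*` `[- L, L].
have mf : measurable_fun (setT : set (mR * mR)) f.
  by apply: continuous_measurable_plane => [|p _]; [exact: openT|exact: cf].
have mQ : measurable Q by apply: measurableX; exact: measurable_itv.
have fQ : f = f \_ Q.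
  apply/funext => p; rewrite patchE; case: ifPn => // /negP; rewrite inE => nQ.
  by case: (g0 p nQ).
have iQ : ((leb \x leb)%E).-integrable Q (EFin \o f).
  have cQ : compact (`[- L, L] `*` `[- L, L] : set (R * R)).
    by apply: compact_setX; exact: segment_compact.
  have cfQ : {within (`[- L, L] `*` `[- L, L] : set (R * R)), continuous f}.
    exact/continuous_subspaceT/cf.
  have /compact_bounded[M [_ hM]] := continuous_compact cfQ cQ.
  apply: measurable_bounded_integrable => //.
  - rewrite [X in (X < _)%E](mu2_rect (measurable_itv _) (measurable_itv _)).
    rewrite lebesgue_measure_itv /=; case: ifPn => _; last by rewrite mul0e ltry.
    by rewrite -EFinB -EFinM ltry.
  - exact: measurable_funTS.
  - exists M; split; first exact: num_real.
    by move=> x Mx p /= Qp; apply: hM => //; exists p.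
have iT : ((leb \x leb)%E).-integrable setT (EFin \o f).
  move: iQ; rewrite integrable_mkcond// (_ : (EFin \o f) \_ Q = EFin \o f)//.
  by rewrite {2}fQ -restrict_EFin.
rewrite /Rintegral; set I := (\int[_]_p _)%E; suff -> : I = 0%E by [].
(* In Fubini's theorem the variable of differentiation is integrated first, so that the inner
   integral already vanishes. *)
case: b @f {mf fQ iQ} dg cf g0 iT @I => f dg cf g0 iT I.
- rewrite /I -(integral12_prod_meas1 iT) integral0_eq// => x _.
  apply: (@integral_derive_compact (fun y => g (x, y)) (fun y => f (x, y)) L) => //.
  + move=> y; apply: (@continuous_comp _ _ _ (fun y => (x, y)) f); last exact: cf.
    exact: (cvg_pair (cvg_cst x) cvg_id).
  + by move=> y; apply/is_derive_slice2; exact: derivableP.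
  + by move=> y /negP yL; apply: g0 => -[_ /=].
- rewrite /I -(integral21_prod_meas1 iT) integral0_eq// => y _.
  apply: (@integral_derive_compact (fun x => g (x, y)) (fun x => f (x, y)) L) => //.
  + move=> x; apply: (@continuous_comp _ _ _ (fun x => (x, y)) f); last exact: cf.
    exact: (cvg_pair cvg_id (cvg_cst y)).
  + by move=> x; apply/is_derive_slice1; exact: derivableP.
  + by move=> x /negP xL; apply: g0 => -[/= + _].
Qed.

End CompactIntegrationByParts.

Section WeakDerivative.
Context {R : realType}.
Variable Om : set (R * R).
Hypotheses (oOm : open Om) (bOm : bounded_set Om).
Implicit Types (f g phi : R * R -> R).

Let mOm := measurable_open_plane oOm.
Let fOm := mu2_bounded_lty oOm bOm.

Lemma continuous_bounded_L2 f M : (forall p, Om p -> {for p, continuous f}) ->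
  (forall p, Om p -> `|f p| <= M) -> L2 Om f.
Proof.
by move=> cf fM; apply: (bounded_L2 mOm fOm _ fM); exact: continuous_measurable_plane.
Qed.

Lemma test_L2 phi : test_function Om phi -> L2 Om phi.
Proof.
move=> tphi; have [M M0 hM] := test_bounded tphi.
apply: (@continuous_bounded_L2 _ M) => p _; last exact: hM.
exact/smooth_continuous/tphi.1.
Qed.

Lemma test_partial_L2 b phi : test_function Om phi -> L2 Om ('D_(axis b) phi).
Proof. by move=> tphi; exact/test_L2/test_partial. Qed.

(** Nothing is known about [f] off [Om], but every point outside has a neighbourhood that misses the
    support of [phi]. Hence [phi p * f p] is continuously differentiable along the axis on the whole
    plane with compact support, and its derivative has integral 0. *)
Lemma classical_weak_partial b f df : L2 Om f -> L2 Om df ->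
  (forall p, Om p -> {for p, continuous f}) ->
  (forall p, Om p -> {for p, continuous df}) ->
  (forall p, Om p -> is_derive p (axis b) f (df p)) ->
  weak_partial Om b f df.
Proof.
move=> f2 df2 cf cdf Df; split => // phi tphi.
have [K [cK clK KO phi0 dphi0]] := test_partial_eq0 b tphi.
have cphi := smooth_continuous tphi.1.
have cdphi := smooth_continuous (smooth_partial b tphi.1).
pose h := fun p => 'D_(axis b) phi p * f p + phi p * df p.
have nearK p : ~ Om p -> \forall q \near p, ~ K q.
  move=> nOm; have : nbhs p (~` K).
    apply: open_nbhs_nbhs; split; first exact: closed_openC.
    by move=> /KO.
  exact: filterS.
pose g := fun p : R * R => phi p * f p.
have Dg (p : R * R) : is_derive p (axis b) g (h p).
  have [Op|nOp] := pselect (Om p).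
    by apply: is_deriveMf; [exact/smooth_is_derive/tphi.1|exact: Df].
  have nKp : ~ K p by move=> /KO.
  rewrite /h dphi0// phi0// !mul0r addr0.
  apply: (@near_eq_is_derive _ _ _ (cst (0:R))).
  by apply: filterS (nearK _ nOp) => q nKq; rewrite /g phi0// mul0r.
have hE : 'D_(axis b) g = h.
  by apply/funext => p; case: (Dg p).
have ch : continuous h.
  move=> p; have [Op|nOp] := pselect (Om p).
    by apply: cvgD; apply: cvgM; [exact: cdphi|exact: cf|exact: cphi|exact: cdf].
  have nKp : ~ K p by move=> /KO.
  have C : {near p, cst (h p) =1 h}.
    apply: filterS (nearK _ nOp) => q nKq.
    by rewrite /h /= !dphi0// !phi0// !mul0r.
  by apply: (cvg_trans (near_eq_cvg C)); exact: cvg_cst.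
have [L L0 OmL] := bounded_subsquare bOm.
have I0 : \int[@mu2 R]_p h p = 0.
  rewrite -hE; apply: (@int_partial_compact _ b g L L0).
  - by move=> p; have [] := Dg p.
  - by rewrite hE.
  move=> p np; have nKp : ~ K p.
    move=> /KO /OmL pL; apply: np; move: pL.
    by apply: setSX; exact: subset_itv_oo_cc.
  by split; [rewrite /g phi0// mul0r|have [_ ->] := Dg p; rewrite /h dphi0// phi0// !mul0r addr0].
have IOm : \int[@mu2 R]_(p in Om) h p = 0.
  rewrite Rintegral_mkcond -I0; apply: eq_Rintegral => p _.
  rewrite patchE; case: ifPn => // /negP; rewrite inE => nOm.
  have nKp : ~ K p by move=> /KO.
  by rewrite /h dphi0// phi0// !mul0r addr0.
apply/eqP; rewrite -addr_eq0; apply/eqP; rewrite -IOm /h RintD//.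
- by congr (_ + _); apply: eq_Rint => p _; rewrite mulrC.
- by apply: L2_intgM => //; exact: test_partial_L2.
- by apply: L2_intgM => //; exact: test_L2.
Qed.

Lemma test_weak_partial b phi : test_function Om phi ->
  weak_partial Om b phi ('D_(axis b) phi).
Proof.
move=> tphi; apply: classical_weak_partial.
- exact: test_L2.
- exact: test_partial_L2.
- by move=> p _; exact/smooth_continuous/tphi.1.
- by move=> p _; exact/smooth_continuous/smooth_partial/tphi.1.
- by move=> p _; exact/smooth_is_derive/tphi.1.
Qed.

End WeakDerivative.

(** * The fundamental lemma of the calculus of variations *)

Section FundamentalLemma.
Context {R : realType}.
Local Notation mR := (measurableTypeR R).
Implicit Types (f g h phi : R * R -> R) (A U : set (R * R)).

(** The coordinate projections are continuous, so the Borel sets of the plane contain the generators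
    of the product sigma-algebra. This lets a monotone class argument start from the open sets. *)
Lemma measurable_sub_sigma_open A : measurable (A : set (mR * mR)) ->
  <<s @open (R * R)%type >> A.
Proof.
pose T := g_sigma_algebraType (@open (R * R)%type).
have op (f : R * R -> R) : continuous f -> measurable_fun (setT : set T) (f : T -> mR).
  move=> cf; apply: (measurability _ (RGenOpens.measurableE R)).
  move=> _ [_ [a [b ->] <-]]; apply: sub_sigma_algebra; rewrite setTI.
  by apply: open_comp => [p _|]; [exact: cf|exact: interval_open].
have fstc : continuous (@fst R R) by move=> p; exact: cvg_fst.
have sndc : continuous (@snd R R) by move=> p; exact: cvg_snd.
apply: smallest_sub; first exact: smallest_sigma_algebra.
move=> B [[C mC <-]|[C mC <-]].
- exact: (op _ fstc measurableT C mC).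
- exact: (op _ sndc measurableT C mC).
Qed.

Variable Om : set (R * R).
Hypotheses (oOm : open Om) (bOm : bounded_set Om).

Let mOm := measurable_open_plane oOm.
Let fOm := mu2_bounded_lty oOm bOm.

Lemma Rint_dominated (f_ : nat -> R * R -> R) f h :
  (forall n, measurable_fun (Om : set (mR * mR)) (f_ n)) ->
  (forall p, Om p -> f_ ^~ p @ \oo --> f p) ->
  intg Om h -> (forall n p, Om p -> `|f_ n p| <= h p) ->
  \int[@mu2 R]_(p in Om) f_ n p @[n --> \oo] --> \int[@mu2 R]_(p in Om) f p.
Proof.
move=> mf ff ih fh; apply: fine_cvg; rewrite fineK.
  apply: (@dominated_cvg _ _ _ _ _ mOm _ _ (EFin \o h)) => //.
  - by move=> n; apply/measurable_EFinP.
  - by move=> p Op; apply/cvg_EFin; [exact: nearW|exact: ff].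
have mf' : measurable_fun (Om : set (mR * mR)) f.
  exact: (measurable_fun_cvg mf ff).
apply: (integrable_fin_num mOm); apply: (le_intg mOm mf' ih) => p Op.
apply: (cvgr_to_le (cvg_norm (ff p Op))).
by near=> n; exact: fh.
Unshelve. all: by end_near. Qed.

(* The functions 1 - \prod_(k <= n) (1 - b_k)^n, with b_k bumps on rational rectangles. *)
Lemma open_test_approx (W : set (R * R)) : open W ->
  exists phi : nat -> R * R -> R,
   [/\ forall n, test_function W (phi n),
       forall n p, 0 <= phi n p <= 1 &
       forall p, phi ^~ p @ \oo --> (\1_W p : R)].
Proof.
move=> oW.
have /choice[beta Hbeta] : forall n, exists b : R * R -> R,
    [/\ test_function W b, forall p, 0 <= b p <= 1 &
    (exists a b c d, ratrect n = rect a b c d /\ `[a, b] `*` `[c, d] `<=` W) ->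
      forall p, ratrect n p -> 0 < b p].
  move=> n.
  have [[a [b [c [d [nE abcd]]]]]|nex] := pselect (exists a b c d : R,
      ratrect n = rect a b c d /\ `[a, b] `*` `[c, d] `<=` W).
    exists (rect_bump a b c d); split; first exact: test_rect_bump.
      by move=> p; exact: rect_bump_bounds.
    by move=> _ p; rewrite nE; exact: rect_bump_gt0.
  exists (fun=> 0); split; [exact: test0|by move=> p; rewrite lexx ler01|].
  by move=> /nex.
(* The power is written as a product of complements so that [test_union] applies at both levels. The
   growing exponent lets a single bump that is positive at [p] drive the whole product to 0. *)
pose gam n k p := 1 - \prod_(i < n) (1 - beta k p).
exists (fun n p => 1 - \prod_(k < n) (1 - gam n k p)).
have gE n k p : 1 - gam n k p = (1 - beta k p) ^+ n.
  by rewrite /gam opprB addrCA subrr addr0 prodr_const card_ord.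
have b01 k p : 0 <= 1 - beta k p <= 1.
  by have [_ /(_ p)/andP[? ?] _] := Hbeta k; apply/andP; split; lra.
have pr01 n p : 0 <= \prod_(k < n) (1 - gam n k p) <= 1.
  rewrite prodr_ge0/=; last by move=> k _; rewrite gE exprn_ge0//; case/andP: (b01 k p).
  apply: prodr_ile1 => k _; rewrite gE; have /andP[? ?] := b01 k p.
  by rewrite exprn_ge0// exprn_ile1.
split.
- move=> n; apply: test_union => k; apply: (@test_union _ _ (fun=> beta k)) => _.
  by case: (Hbeta k).
- by move=> n p; have := pr01 n p => /andP[? ?]; apply/andP; split; lra.
- move=> p; have [Wp|nWp] := pselect (W p); last first.
    rewrite indicE memNset//.
    apply: (@cvg_trans _ ((fun=> 0 : R) @ \oo)); last exact: cvg_cst.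
    apply: near_eq_cvg; near=> n; rewrite big1 ?subrr// => k _.
    rewrite gE; have [[_ [K [_ KW K0]]] _ _] := Hbeta k.
    by rewrite K0 ?subr0 ?expr1n// => /KW.
  have [m [mp [a [b [c [d abcd]]]]]] := open_subrect oW Wp.
  have [_ /(_ p)/andP[bm0 bm1] /(_ _ p mp) bmp] := Hbeta m.
  have {}bmp : 0 < beta m p by apply: bmp; exists a, b, c, d.
  rewrite indicE mem_set// -[X in _ --> X]subr0.
  apply: cvgB; first exact: cvg_cst.
  apply: (@squeeze_cvgr _ _ _ _ (fun=> 0) (fun n => (1 - beta m p) ^+ n)).
  + near=> n; have /andP[-> _]/= := pr01 n p.
    have mn : (m < n)%N by near: n; exact: nbhs_infty_gt.
    rewrite (bigD1 (Ordinal mn))//= gE ler_piMr ?exprn_ge0 ?subr_ge0//.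
    apply: prodr_ile1 => k _; rewrite gE; have /andP[? ?] := b01 k p.
    by rewrite exprn_ge0// exprn_ile1.
  + exact: cvg_cst.
  + by apply: cvg_expr; rewrite ger0_norm ?subr_ge0//; lra.
Unshelve. all: by end_near. Qed.

Lemma test_subset A U phi : A `<=` U -> test_function A phi -> test_function U phi.
Proof.
by move=> AU [s [K [cK KA K0]]]; split => //; exists K; split => // p /KA /AU.
Qed.

Lemma test_ip0_open g U : L2 Om g ->
  (forall phi, test_function Om phi -> ip Om g phi = 0) -> open U ->
  \int[@mu2 R]_(p in Om) (g p * \1_U p) = 0.
Proof.
move=> g2 g0 oU; have [phi [tphi phi01 phi1]] := open_test_approx (openI oOm oU).
have tO n : test_function Om (phi n) by apply: test_subset (tphi n) => p [].
have : \int[@mu2 R]_(p in Om) (g p * phi n p) @[n --> \oo] -->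
    \int[@mu2 R]_(p in Om) (g p * \1_U p).
  apply: (@Rint_dominated _ _ (fun p => `|g p|)).
  - by move=> n; apply: measurable_funM; [exact: g2.1|exact: (test_L2 oOm bOm (tO n)).1].
  - move=> p Op; apply: cvgM; first exact: cvg_cst.
    rewrite (_ : \1_U p = \1_(Om `&` U) p)//.
    by rewrite !indicE in_setI (mem_set Op).
  - exact: (integrable_norm (L2_intg mOm fOm g2)).
  - move=> n p _; have /andP[p0 p1] := phi01 n p.
    by rewrite normrM ler_piMr// ger0_norm.
move/cvg_lim => <-//; rewrite (_ : (fun n => _) = fun=> 0); first exact: lim_cst.
by apply/funext => n; exact: g0.
Qed.

(** Orthogonality passes from test functions to indicators of open sets by dominated convergence.
    The measurable sets over which [g] has integral 0 form a lambda-system containing the pi-system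
    of open sets, hence are all measurable sets; the set where [g] is positive then shows that [|g|]
    has integral 0. *)
Lemma fundamental_lemma g : L2 Om g ->
  (forall phi, test_function Om phi -> ip Om g phi = 0) -> ip Om g g = 0.
Proof.
move=> g2 g0.
have ig : intg Om g by exact: (L2_intg mOm fOm).
have iA A : measurable (A : set (mR * mR)) -> intg Om (fun p => g p * \1_A p).
  move=> mA; apply: (le_intg mOm _ (integrable_norm ig)).
    by apply: measurable_funM; [exact: g2.1|exact: measurable_indic].
  by move=> p _; rewrite normrM indicE normr_nat ler_piMr// lern1; case: (_ \in _).
pose H : set (set (R * R)) := [set A | measurable (A : set (mR * mR)) /\
  \int[@mu2 R]_(p in Om) (g p * \1_A p) = 0].
have Hsys : lambda_system setT H.
  split => //.
  - split; first exact: measurableT.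
    by apply: test_ip0_open => //; exact: openT.
  - move=> A B BA [mA A0] [mB B0]; split; first exact: measurableD.
    transitivity (\int[@mu2 R]_(p in Om) (g p * \1_A p) -
        \int[@mu2 R]_(p in Om) (g p * \1_B p)); last by rewrite A0 B0 subrr.
    rewrite -RintB; [|exact: mOm|exact: iA..].
    apply: eq_Rint => p _; rewrite -mulrBr; congr (_ * _).
    rewrite !indicE in_setD; have [Bp|Bp] := boolP (p \in B).
      by rewrite (mem_set (BA _ (set_mem Bp))) andbF subrr.
    by rewrite andbT subr0.
  - move=> F ndF HF; split; first by apply: bigcupT_measurable => n; case: (HF n).
    have : \int[@mu2 R]_(p in Om) (g p * \1_(F n) p) @[n --> \oo] -->
        \int[@mu2 R]_(p in Om) (g p * \1_(\bigcup_n F n) p).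
      apply: (@Rint_dominated _ _ (fun p => `|g p|)).
      + by move=> n; apply: intg_measurable; apply: iA; case: (HF n).
      + move=> p Op; apply: cvgM; first exact: cvg_cst.
        have [[n _ Fnp]|nF] := pselect ((\bigcup_n F n) p).
          apply: (@cvg_trans _ ((fun=> 1 : R) @ \oo)).
            apply: near_eq_cvg; near=> m; rewrite !indicE mem_set//.
            have nm : (n <= m)%N by near: m; exact: nbhs_infty_ge.
            by move: Fnp; apply/subsetPset/ndF.
          by rewrite indicE mem_set; [exact: cvg_cst|exists n].
        apply: (@cvg_trans _ ((fun=> 0 : R) @ \oo)).
          apply: near_eq_cvg; near=> m; rewrite !indicE memNset// => Fm.
          by apply: nF; exists m.
        by rewrite indicE memNset//; exact: cvg_cst.
      + exact: (integrable_norm ig).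
      + move=> n p _; rewrite normrM indicE normr_nat ler_piMr// lern1.
        by case: (_ \in _).
    move/cvg_lim => <-//; rewrite (_ : (fun n => _) = fun=> 0); first exact: lim_cst.
    by apply/funext => n; case: (HF n).
have all0 A : measurable (A : set (mR * mR)) ->
    \int[@mu2 R]_(p in Om) (g p * \1_A p) = 0.
  move=> /measurable_sub_sigma_open sA.
  have := @lambda_system_subset _ (@open (R * R)%type) (@openI _) setT H Hsys.
  have oH : @open (R * R)%type `<=` H.
    move=> U oU; split; first exact: measurable_open_plane.
    exact: test_ip0_open.
  by move=> /(_ oH (fun _ _ => @subsetT _ _) A sA) [].
pose P := Om `&` g @^-1` `]0, +oo[.
have mP : measurable (P : set (mR * mR)) by apply: g2.1 => //; exact: measurable_itv.
have nE p : Om p -> `|g p| = 2 * (g p * \1_P p) - g p.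
  move=> Op; rewrite indicE; have [gp|gp] := ltP 0 (g p).
    rewrite mem_set ?gtr0_norm//=; last by split => //=; rewrite in_itv/= gp.
    by rewrite mulr1; ring.
  rewrite memNset ?ler0_norm//=; first by rewrite mulr0; ring.
  by move=> [_ /=]; rewrite in_itv/= andbT ltNge gp.
have n0 : \int[@mu2 R]_(p in Om) `|g p| = 0.
  rewrite (eq_Rint nE) (RintB mOm (intgZ mOm 2 (iA _ mP)) ig).
  rewrite (RintZ mOm 2 (iA _ mP)) all0// mulr0.
  rewrite sub0r (eq_Rint (g := fun p => g p * \1_setT p)).
    by rewrite all0 ?oppr0//; exact: measurableT.
  by move=> p _; rewrite indicT mulr1.
have ae0 : ae_eq (@mu2 R) Om (EFin \o g) (cst 0%E).
  apply/ae_eq_integral_abs => //; first by apply/measurable_EFinP; exact: g2.1.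
  have : (\int[@mu2 R]_(p in Om) `|(g p)%:E|)%E \is a fin_num.
    exact: (integrable_fin_num mOm (integrable_abse ig)).
  move/fineK => <-; congr EFin.
  by rewrite -[RHS]n0.
rewrite /ip /Rintegral (ae_eq_integral (cst 0%E)) ?integral0//.
- by apply/measurable_EFinP; apply: measurable_funM; exact: g2.1.
- by apply: filterS ae0 => p /= gp Op; have [->] := gp Op; rewrite mulr0.
Unshelve. all: by end_near. Qed.

End FundamentalLemma.

(** * Weak derivatives and the space of functions vanishing on the boundary *)

(** The last step of the density arguments: the error is proportional to an arbitrary [e], with
    whatever constant has accumulated. *)
Lemma le0_mul_eps (R : realType) (x C : R) :
  (forall e, 0 < e -> x <= C * e) -> x <= 0.
Proof.
move=> H; rewrite leNgt; apply/negP => x0.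
have C0 : 0 < `|C| + 1 by rewrite ltr_wpDl.
have := H (x / 2 / (`|C| + 1)); rewrite !divr_gt0// => /(_ isT).
apply/negP; rewrite -ltNge mulrA ltr_pdivrMr//.
apply: (@le_lt_trans _ _ (`|C| * (x / 2))).
  by rewrite ler_pM2r ?divr_gt0// ler_norm.
by have := normr_ge0 C; nra.
Qed.

Lemma lt_of_quarters (R : realType) (x y z e : R) :
  z <= 2 * x + 2 * y -> x < e / 4 -> y < e / 4 -> z < e.
Proof. lra. Qed.

Section Sobolev.
Context {R : realType}.
Variable Om : set (R * R).
Hypotheses (oOm : open Om) (bOm : bounded_set Om).
Implicit Types (f g h phi w : R * R -> R) (F G : bool -> R * R -> R).

Let mOm := measurable_open_plane oOm.

Local Notation ipO := (ip Om).

Definition gradient f F := forall b, weak_partial Om b f (F b).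

Lemma gradient_L2 f F b : gradient f F -> L2 Om (F b).
Proof. by move=> /(_ b)[]. Qed.

Lemma gradient_test phi : test_function Om phi ->
  gradient phi (fun b => 'D_(axis b) phi).
Proof. by move=> tphi b; exact: test_weak_partial. Qed.

Lemma weak_partialD b f g (F G : R * R -> R) : L2 Om f -> L2 Om g ->
  weak_partial Om b f F -> weak_partial Om b g G ->
  weak_partial Om b (f \+ g) (F \+ G).
Proof.
move=> f2 g2 [F2 wF] [G2 wG]; split => [|phi tphi]; first exact: L2D.
have dp := test_partial_L2 oOm bOm b tphi; have p2 := test_L2 oOm bOm tphi.
have := ipDl mOm f2 g2 dp; have := ipDl mOm F2 G2 p2.
by rewrite /ip => -> ->; rewrite wF// wG// opprD.
Qed.

Lemma weak_partialZ b a f (F : R * R -> R) : L2 Om f ->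
  weak_partial Om b f F -> weak_partial Om b (fun p => a * f p) (fun p => a * F p).
Proof.
move=> f2 [F2 wF]; split => [|phi tphi]; first exact: L2Z.
have dp := test_partial_L2 oOm bOm b tphi; have p2 := test_L2 oOm bOm tphi.
have := ipZl mOm a f2 dp; have := ipZl mOm a F2 p2.
by rewrite /ip => -> ->; rewrite wF// mulrN.
Qed.

Lemma weak_partialB b f g (F G : R * R -> R) : L2 Om f -> L2 Om g ->
  weak_partial Om b f F -> weak_partial Om b g G ->
  weak_partial Om b (f \- g) (F \- G).
Proof.
move=> f2 g2 [F2 wF] [G2 wG]; split => [|phi tphi]; first exact: L2B.
have dp := test_partial_L2 oOm bOm b tphi; have p2 := test_L2 oOm bOm tphi.
have := ipBl mOm f2 g2 dp; have := ipBl mOm F2 G2 p2.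
by rewrite /ip => -> ->; rewrite wF// wG// opprB addrC opprK.
Qed.

Lemma weak_partial_unique b f (F G : R * R -> R) : weak_partial Om b f F ->
  weak_partial Om b f G -> ipO (F \- G) (F \- G) = 0.
Proof.
move=> [F2 wF] [G2 wG]; apply: fundamental_lemma => //; first exact: L2B.
move=> phi tphi; have p2 := test_L2 oOm bOm tphi.
rewrite ipBl//; apply/eqP; rewrite subr_eq0; apply/eqP.
by rewrite -[LHS]opprK -[RHS]opprK -wF// -wG.
Qed.

Lemma weak_partial_ip b f (F G : R * R -> R) h : weak_partial Om b f F ->
  weak_partial Om b f G -> L2 Om h -> ipO F h = ipO G h.
Proof.
move=> wF wG h2; have [F2 _] := wF; have [G2 _] := wG.
apply/eqP; rewrite -subr_eq0 -ipBl//; apply/eqP.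
by apply: ip_normal0 => //; [exact: L2B|exact: weak_partial_unique wF wG].
Qed.

Lemma H1_gradient f : H1 Om f -> gradient f (fun b => wD Om b f).
Proof. by move=> [_ Hf] b; exact: (xgetPex (cst 0) (Hf b)). Qed.

Lemma gradient_H1 f F : L2 Om f -> gradient f F -> H1 Om f.
Proof. by move=> f2 HF; split => // b; exists (F b). Qed.

Definition gip F G := ipO (F false) (G false) + ipO (F true) (G true).

(** [wD] is an arbitrary choice among the weak derivatives. Two choices differ by a function of L^2
    norm 0, so inner products do not see the difference, and classical derivatives may be put in its
    place. *)
Lemma grad_innerE f g F G : gradient f F -> gradient g G ->
  grad_inner Om f g = gip F G.
Proof.
move=> HF HG.
have f1 b : weak_partial Om b f (wD Om b f).
  by exact: (xgetPex (cst 0) (ex_intro _ _ (HF b))).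
have g1 b : weak_partial Om b g (wD Om b g).
  by exact: (xgetPex (cst 0) (ex_intro _ _ (HG b))).
have f2 b : L2 Om (wD Om b f) by case: (f1 b).
have g2 b : L2 Om (wD Om b g) by case: (g1 b).
have -> : grad_inner Om f g = gip (fun b => wD Om b f) (fun b => wD Om b g).
  rewrite /grad_inner Rint_sum//; last by move=> b; exact: L2_intgM.
  by rewrite big_bool /= addrC.
rewrite /gip; congr (_ + _).
  rewrite (weak_partial_ip (f1 false) (HF false) (g2 false)).
  by rewrite ipC (weak_partial_ip (g1 false) (HG false) (gradient_L2 false HF)) ipC.
rewrite (weak_partial_ip (f1 true) (HF true) (g2 true)).
by rewrite ipC (weak_partial_ip (g1 true) (HG true) (gradient_L2 true HF)) ipC.
Qed.

Definition H1sq f F := ipO f f + gip F F.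

Lemma gip_ge0 F : 0 <= gip F F.
Proof. by rewrite addr_ge0// ip_ge0. Qed.

Lemma H1sq_ge0 f F : 0 <= H1sq f F.
Proof. by rewrite addr_ge0// ?gip_ge0// ip_ge0. Qed.

Lemma H1norm_sq f F : gradient f F -> H1norm Om f ^+ 2 = H1sq f F.
Proof.
move=> HF; rewrite /H1norm sqr_sqrtr (grad_innerE HF HF) L2sqE//.
exact: H1sq_ge0.
Qed.

Lemma gradientB f g F G : L2 Om f -> L2 Om g -> gradient f F -> gradient g G ->
  gradient (f \- g) (fun b => F b \- G b).
Proof. by move=> f2 g2 HF HG b; exact: weak_partialB. Qed.

Lemma gradientD f g F G : L2 Om f -> L2 Om g -> gradient f F -> gradient g G ->
  gradient (f \+ g) (fun b => F b \+ G b).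
Proof. by move=> f2 g2 HF HG b; exact: weak_partialD. Qed.

Lemma gradientZ a f F : L2 Om f -> gradient f F ->
  gradient (fun p => a * f p) (fun b p => a * F b p).
Proof. by move=> f2 HF b; exact: weak_partialZ. Qed.

Lemma H1sqD_le f g F G : L2 Om f -> L2 Om g ->
  (forall b, L2 Om (F b)) -> (forall b, L2 Om (G b)) ->
  H1sq (f \+ g) (fun b => F b \+ G b) <= 2 * H1sq f F + 2 * H1sq g G.
Proof.
move=> f2 g2 F2 G2; rewrite /H1sq /gip.
have := ip_sqrD_le mOm f2 g2.
have := ip_sqrD_le mOm (F2 false) (G2 false).
have := ip_sqrD_le mOm (F2 true) (G2 true).
lra.
Qed.

Lemma H1sqZ a f F : L2 Om f -> (forall b, L2 Om (F b)) ->
  H1sq (fun p => a * f p) (fun b p => a * F b p) = a ^+ 2 * H1sq f F.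
Proof.
by move=> f2 F2; rewrite /H1sq /gip !ipZl ?ipZr//; try exact: L2Z; ring.
Qed.

Lemma H10P f F : L2 Om f -> gradient f F ->
  H10 Om f <-> (forall e, 0 < e -> exists2 phi, test_function Om phi &
    H1sq (f \- phi) (fun b => F b \- 'D_(axis b) phi) < e).
Proof.
move=> f2 HF.
have HB phi : test_function Om phi ->
    gradient (f \- phi) (fun b => F b \- 'D_(axis b) phi).
  by move=> tphi; apply: gradientB => //; [exact: test_L2|exact: gradient_test].
split=> [[_ H] e e0|H].
  have [|phi tphi pe] := H (Num.sqrt e); first by rewrite sqrtr_gt0.
  exists phi => //; rewrite -(H1norm_sq (HB _ tphi)) -(sqr_sqrtr (ltW e0)).
  by rewrite ltr_pXn2r// nnegrE sqrtr_ge0.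
split; first exact: gradient_H1 HF.
move=> e e0; have [|phi tphi pe] := H (e ^+ 2); first by rewrite exprn_gt0.
exists phi => //; rewrite -(@ltr_pXn2r _ 2%N)// ?nnegrE ?sqrtr_ge0 ?(ltW e0)//.
by rewrite (H1norm_sq (HB _ tphi)).
Qed.

Lemma H10_L2 f : H10 Om f -> L2 Om f.
Proof. by case=> -[]. Qed.

Lemma H10_gradient f : H10 Om f -> gradient f (fun b => wD Om b f).
Proof. by case=> /H1_gradient. Qed.

Lemma test_H10 phi : test_function Om phi -> H10 Om phi.
Proof.
move=> tphi; have p2 := test_L2 oOm bOm tphi; have Hp := gradient_test tphi.
apply/(H10P p2 Hp) => e e0; exists phi => //.
have z (f : R * R -> R) : ipO (f \- f) (f \- f) = 0.
  rewrite /ip (@eq_Rint _ _ _ (cst 0)) ?Rintegral_cst ?mul0r// => p _ /=.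
  by rewrite subrr mulr0.
by rewrite /H1sq /gip !z !addr0.
Qed.

Lemma H10_closed f F : L2 Om f -> gradient f F ->
  (forall e, 0 < e -> exists g G, [/\ H10 Om g, gradient g G &
    H1sq (f \- g) (fun b => F b \- G b) < e]) -> H10 Om f.
Proof.
move=> f2 HF H; apply/(H10P f2 HF) => e e0.
have e4 : 0 < e / 4 by rewrite divr_gt0.
have [g [G [Hg HG ge]]] := H _ e4; have g2 := H10_L2 Hg.
have [phi tphi pe] := (H10P g2 HG).1 Hg _ e4.
have p2 := test_L2 oOm bOm tphi.
have L b : L2 Om (F b \- G b) by apply: (L2B mOm); exact: gradient_L2.
have L' b : L2 Om (G b \- 'D_(axis b) phi).
  by apply: (L2B mOm); [exact: gradient_L2 HG|exact: test_partial_L2].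
exists phi => //; have := H1sqD_le (L2B mOm f2 g2) (L2B mOm g2 p2) L L'.
have -> : (f \- g) \+ (g \- phi) = f \- phi.
  by apply/funext => p /=; rewrite addrA subrK.
have -> : (fun b => (F b \- G b) \+ (G b \- 'D_(axis b) phi)) =
    (fun b => F b \- 'D_(axis b) phi).
  by apply/funext => b; apply/funext => p /=; rewrite addrA subrK.
by move=> H'; exact: (lt_of_quarters H' ge pe).
Qed.

Lemma H10D f g : H10 Om f -> H10 Om g -> H10 Om (f \+ g).
Proof.
move=> Hf Hg; have f2 := H10_L2 Hf; have g2 := H10_L2 Hg.
have HF := H10_gradient Hf; have HG := H10_gradient Hg.
apply/(H10P (L2D mOm f2 g2) (gradientD f2 g2 HF HG)) => e e0.
have e4 : 0 < e / 4 by rewrite divr_gt0.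
have [phi tphi pe] := (H10P f2 HF).1 Hf _ e4.
have [psi tpsi se] := (H10P g2 HG).1 Hg _ e4.
have p2 := test_L2 oOm bOm tphi; have s2 := test_L2 oOm bOm tpsi.
exists (fun p => phi p + psi p); first exact: testD.
have Lp b : L2 Om (wD Om b f \- 'D_(axis b) phi).
  by apply: (L2B mOm); [exact: gradient_L2 HF|exact: test_partial_L2].
have Ls b : L2 Om (wD Om b g \- 'D_(axis b) psi).
  by apply: (L2B mOm); [exact: gradient_L2 HG|exact: test_partial_L2].
have := H1sqD_le (L2B mOm f2 p2) (L2B mOm g2 s2) Lp Ls.
have -> : (f \- phi) \+ (g \- psi) = (f \+ g) \- (fun p => phi p + psi p).
  by apply/funext => p /=; rewrite opprD addrACA.
have -> : (fun b => (wD Om b f \- 'D_(axis b) phi) \+ (wD Om b g \- 'D_(axis b) psi)) =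
    (fun b => (wD Om b f \+ wD Om b g) \- 'D_(axis b) (fun p => phi p + psi p)).
  apply/funext => b; apply/funext => p /=.
  have [_ ->] := is_deriveDf (smooth_is_derive b p tphi.1) (smooth_is_derive b p tpsi.1).
  by rewrite opprD addrACA.
by move=> H; exact: (lt_of_quarters H pe se).
Qed.

Lemma H10Z a f : H10 Om f -> H10 Om (fun p => a * f p).
Proof.
move=> Hf; have f2 := H10_L2 Hf; have HF := H10_gradient Hf.
apply/(H10P (L2Z mOm a f2) (gradientZ a f2 HF)) => e e0.
have e4 : 0 < e / (a ^+ 2 + 1) by rewrite divr_gt0// ltr_wpDl// sqr_ge0.
have [phi tphi pe] := (H10P f2 HF).1 Hf _ e4.
have p2 := test_L2 oOm bOm tphi.
exists (fun p => a * phi p); first exact: testZ.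
have Lp b : L2 Om (wD Om b f \- 'D_(axis b) phi).
  by apply: (L2B mOm); [exact: gradient_L2 HF|exact: test_partial_L2].
have := H1sqZ a (L2B mOm f2 p2) Lp.
have -> : (fun p => a * (f \- phi) p) = (fun p => a * f p) \- (fun p => a * phi p).
  by apply/funext => p /=; rewrite mulrBr.
have -> : (fun b p => a * (wD Om b f \- 'D_(axis b) phi) p) =
    (fun b => (fun p => a * wD Om b f p) \- 'D_(axis b) (fun p => a * phi p)).
  apply/funext => b; apply/funext => p /=.
  have [_ ->] := is_deriveZf a (smooth_is_derive b p tphi.1).
  by rewrite mulrBr.
move=> ->; move: pe; rewrite ltr_pdivlMr ?ltr_wpDl ?sqr_ge0//.
by have := H1sq_ge0 (f \- phi) (fun b => wD Om b f \- 'D_(axis b) phi); nra.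
Qed.

Lemma H10B f g : H10 Om f -> H10 Om g -> H10 Om (f \- g).
Proof.
move=> Hf /(H10Z (-1)) /(H10D Hf); congr (H10 Om _).
by apply/funext => p /=; rewrite mulN1r.
Qed.

(** Both sides are continuous in [w] for the H^1 norm, and for a test function the identity is the
    definition of the weak derivative of [f]. There is no boundary term since test functions are
    dense in H^1_0. *)
Lemma H10_ibp b w W f (F : R * R -> R) : H10 Om w -> weak_partial Om b w W ->
  L2 Om f -> weak_partial Om b f F -> ipO W f = - ipO w F.
Proof.
move=> Hw HW f2 HF; have w2 := H10_L2 Hw; have [F2 wF] := HF.
have HG := H10_gradient Hw.
rewrite (weak_partial_ip HW (HG b) f2).
apply/eqP; rewrite -addr_eq0 -sqrf_eq0 eq_le sqr_ge0 andbT; apply/eqP/eqP.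
apply: (@le0_mul_eps _ _ (2 * ipO f f + 2 * ipO F F)) => e e0.
have [phi tphi pe] := (H10P w2 HG).1 Hw _ e0.
have p2 := test_L2 oOm bOm tphi; have dp2 := test_partial_L2 oOm bOm b tphi.
have G2 c : L2 Om (wD Om c w) := gradient_L2 c HG.
have -> : ipO (wD Om b w) f + ipO w F =
    ipO (wD Om b w \- 'D_(axis b) phi) f + ipO (w \- phi) F.
  rewrite !ipBl//; have := wF _ tphi.
  by rewrite -[LHS]/(ipO _ _) -[\int[_]_(_ in _) _]/(ipO _ _) (ipC _ f) (ipC _ F); lra.
have C1 := ip_CS mOm (L2B mOm (G2 b) dp2) f2.
have C2 := ip_CS mOm (L2B mOm w2 p2) F2.
have h1 : ipO (w \- phi) (w \- phi) <= e.
  by apply: le_trans (ltW pe); rewrite lerDl gip_ge0.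
have h2 : ipO (wD Om b w \- 'D_(axis b) phi) (wD Om b w \- 'D_(axis b) phi) <= e.
  apply: le_trans (ltW pe); rewrite /H1sq /gip.
  case: b {HW HF wF dp2 C1}.
    by rewrite addrA lerDr addr_ge0// ip_ge0.
  by rewrite addrCA lerDl addr_ge0// ip_ge0.
have k1 := ler_wpM2r (ip_ge0 Om f) h2; have k2 := ler_wpM2r (ip_ge0 Om F) h1.
set x := ipO _ f in C1 *; set y := ipO _ F in C2 *.
have := sqr_ge0 (x - y); rewrite sqrrB sqrrD.
lra.
Qed.

End Sobolev.

(** * Completeness *)

Section L2completeness.
Context {R : realType}.
Local Notation mR := (measurableTypeR R).
Variable Om : set (R * R).
Hypotheses (oOm : open Om) (bOm : bounded_set Om).
Implicit Types (f g : R * R -> R).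

Let mOm := measurable_open_plane oOm.
Let fOm := mu2_bounded_lty oOm bOm.

Lemma limn_einf_le (u : (\bar R)^nat) (c : \bar R) (n : nat) :
  (forall m, (n <= m)%N -> (u m <= c)%E) -> (limn_einf u <= c)%E.
Proof.
move=> uc; rewrite limn_einf_lim; apply: lime_le; first exact: is_cvg_einfs.
near=> m; apply: le_trans (uc m _); last by near: m; exact: nbhs_infty_ge.
by apply: ereal_inf_lbound; exists m => /=.
Unshelve. all: by end_near. Qed.

Lemma EFin_ip f g : intg Om (fun p => f p * g p) ->
  (\int[@mu2 R]_(p in Om) (f p * g p)%:E)%E = (ip Om f g)%:E.
Proof. by move=> fg; rewrite /ip /Rintegral fineK//; exact: (integrable_fin_num mOm fg). Qed.

Lemma fast_cauchy_ae_cvg (f_ : nat -> R * R -> R) : (forall n, L2 Om (f_ n)) ->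
  (forall n, ip Om (f_ n.+1 \- f_ n) (f_ n.+1 \- f_ n) <= 4^-1 ^+ n) ->
  {ae @mu2 R, forall p, Om p -> cvgn (f_ ^~ p)}.
Proof.
move=> f2 fC; pose D n p := `|f_ n.+1 p - f_ n p|.
pose C := fine (@mu2 R Om) + 1.
have C0 : 0 <= C by rewrite addr_ge0// fine_ge0.
have d2 n : L2 Om (f_ n.+1 \- f_ n) by exact: (L2B mOm).
have iD n : intg Om (D n) by exact: (integrable_norm (L2_intg mOm fOm (d2 n))).
have mD n : measurable_fun (Om : set (mR * mR)) (D n) := intg_measurable (iD n).
have intD n : (\int[@mu2 R]_(p in Om) (D n p)%:E <= ((2 * C) / (2 ^ n.+1)%:R)%:E)%E.
  rewrite -[leLHS]fineK; last exact: (integrable_fin_num mOm (iD n)).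
  rewrite lee_fin -[leLHS]/(\int[@mu2 R]_(p in Om) D n p).
  (* The integral of the square is at most [a ^+ 2], so [|x| <= a + x^2 / a] integrates to at most
     [a] times the measure of [Om] plus [a], which is summable in [n]. *)
  pose a : R := 2^-1 ^+ n; have a0 : 0 < a by rewrite exprn_gt0.
  have i1 : intg Om (cst a) by apply: (L2_intg mOm fOm); exact: L2_cst.
  have i2 : intg Om (fun p => a^-1 * ((f_ n.+1 \- f_ n) p * (f_ n.+1 \- f_ n) p)).
    by apply: (intgZ mOm); exact: (L2_intgM mOm (d2 n) (d2 n)).
  have le1 : \int[@mu2 R]_(p in Om) D n p <= \int[@mu2 R]_(p in Om) (cst a p + a^-1 *
      ((f_ n.+1 \- f_ n) p * (f_ n.+1 \- f_ n) p)).
    apply: le_Rintegral; [exact: mOm|exact: (iD n)|exact: (intgD mOm i1 i2)|].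
    move=> p _; rewrite /D /=; set x := _ - _; rewrite -expr2 -(real_normK (num_real x)).
    set y := `|x|; have y0 : 0 <= y by exact: normr_ge0.
    rewrite -(ler_pM2l a0) mulrDr mulrA mulfV ?gt_eqF// mul1r.
    by have := sqr_ge0 (a - y); have := sqr_ge0 (a + y); nra.
  apply: (le_trans le1); rewrite (RintD mOm i1 i2) Rintegral_cst//.
  rewrite (RintZ mOm); last exact: (L2_intgM mOm (d2 n) (d2 n)).
  have aE : a^-1 * 4^-1 ^+ n = a.
    rewrite /a -exprVn -exprMn; congr (_ ^+ n); by field.
  have le2 : a^-1 * ip Om (f_ n.+1 \- f_ n) (f_ n.+1 \- f_ n) <= a.
    by rewrite -[leRHS]aE ler_wpM2l// invr_ge0 ltW.
  have -> : 2 * C / (2 ^ n.+1)%:R = a * fine (@mu2 R Om) + a.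
    rewrite /a /C natrX exprS exprVn; field.
    by rewrite expf_neq0.
  by rewrite lerD2l.
pose S p := (\sum_(0 <= n <oo) (D n p)%:E)%E.
have mS : measurable_fun (Om : set (mR * mR)) S.
  apply: (@ge0_emeasurable_sum _ _ _ _ (fun n p => (D n p)%:E) xpredT) => [k p _ _|k _].
    by rewrite lee_fin normr_ge0.
  by apply/measurable_EFinP; exact: mD.
have S0 p : (0 <= S p)%E by apply: nneseries_ge0 => n _ _; rewrite lee_fin normr_ge0.
have iS : (@mu2 R).-integrable Om S.
  apply/integrableP; split => //.
  under eq_integral do rewrite gee0_abs//.
  have mDE n : measurable_fun (Om : set (mR * mR)) (fun p => (D n p)%:E).
    by apply/measurable_EFinP; exact: mD.
  have D0 n p : Om p -> (0 <= (D n p)%:E)%E by move=> _; rewrite lee_fin normr_ge0.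
  rewrite /S (integral_nneseries (@mu2 R) mOm mDE D0).
  apply: (@le_lt_trans _ _ (2 * C)%:E); last exact: ltry.
  apply: le_trans (@epsilon_trick0 R (2 * C) xpredT _); last by rewrite mulr_ge0.
  apply: lee_nneseries => n _ // _.
  by apply: integral_ge0 => p _; rewrite lee_fin normr_ge0.
have := integrable_ae mOm iS; apply: filterS => p Sfin Op.
have {}Sfin := Sfin Op.
have : cvgn [normed series (telescope (f_ ^~ p))].
  apply: nondecreasing_is_cvgn.
    by apply: nondecreasing_series => n _ _; rewrite normr_ge0.
  exists (fine (S p)) => _ [n _ <-].
  rewrite -lee_fin fineK//.
  apply: le_trans (@nneseries_lim_ge R (fun n => (D n p)%:E) xpredT 0 n _); last first.
    by move=> k _ _; rewrite lee_fin normr_ge0.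
  by rewrite sumEFin.
move/normed_cvg; rewrite telescopeK => h.
have : cvgn ([sequence f_ n p - f_ 0%N p]_n + cst (f_ 0%N p)).
  by apply: is_cvgD => //; exact: is_cvg_cst.
by congr (cvgn _); apply/funext => n /=; rewrite [LHS]subrK.
Qed.

(** The upper limit supplies a measurable function defined everywhere, which is the limit at almost
    every point; [fine] sends infinite values to 0. Fatou's lemma carries the Cauchy estimate to the
    limit with the same constant. *)
Lemma L2_complete (f_ : nat -> R * R -> R) : (forall n, L2 Om (f_ n)) ->
  (forall n m, (n <= m)%N -> ip Om (f_ m \- f_ n) (f_ m \- f_ n) <= 4^-1 ^+ n) ->
  exists2 f, L2 Om f & forall n, ip Om (f \- f_ n) (f \- f_ n) <= 4^-1 ^+ n.
Proof.
move=> f2 fC.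
have aec : {ae @mu2 R, forall p, Om p -> cvgn (f_ ^~ p)}.
  by apply: fast_cauchy_ae_cvg => // n; exact: fC.
pose f p := fine (limn_esup (fun n => (f_ n p)%:E)).
have mf : measurable_fun (Om : set (mR * mR)) f.
  apply: measurableT_comp => //; apply: measurable_fun_limn_esup => n.
  by apply/measurable_EFinP; exact: (f2 n).1.
have flim p : cvgn (f_ ^~ p) -> f_ ^~ p @ \oo --> f p.
  move=> cp; have /cvg_limn_einf_sup[_] : (fun n => (f_ n p)%:E) @ \oo --> (limn (f_ ^~ p))%:E.
    by apply/cvg_EFin => //; exact: nearW.
  by rewrite /f => ->.
have fat n : (\int[@mu2 R]_(p in Om) ((f p - f_ n p) ^+ 2)%:E <= (4^-1 ^+ n)%:E)%E.
  pose g m p := ((f_ m p - f_ n p) ^+ 2)%:E.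
  have mg m : measurable_fun (Om : set (mR * mR)) (g m).
    by apply/measurable_EFinP; apply: measurable_funX; apply: measurable_funB;
      [exact: (f2 m).1|exact: (f2 n).1].
  have g0 m p : Om p -> (0 <= g m p)%E by move=> _; rewrite lee_fin sqr_ge0.
  have -> : (\int[@mu2 R]_(p in Om) ((f p - f_ n p) ^+ 2)%:E =
      \int[@mu2 R]_(p in Om) limn_einf (g ^~ p))%E; last first.
    apply: (le_trans (fatou (@mu2 R) mOm mg g0)).
    apply: (@limn_einf_le _ _ n) => m nm.
    have /L2_sqr ig := L2B mOm (f2 m) (f2 n).
    rewrite -[leLHS]fineK; last exact: (integrable_fin_num mOm ig).
    rewrite lee_fin; apply: le_trans (fC n m nm).
    by rewrite -[leLHS]/(L2sq Om (f_ m \- f_ n)) L2sqE.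
  apply: ae_eq_integral => //.
  - apply/measurable_EFinP; apply: measurable_funX; apply: measurable_funB => //.
    exact: (f2 n).1.
  - rewrite (_ : (fun p => _) = (fun p => - limn_esup (fun m => - g m p))%E)//.
    apply: measurableT_comp => //; apply: measurable_fun_limn_esup => m.
    exact: measurableT_comp.
  - suff : {ae @mu2 R, forall p, Om p ->
        ((f p - f_ n p) ^+ 2)%:E = limn_einf (g ^~ p)} by [].
    move: aec; apply: (@filterS _ _ (ae_filter_ringOfSetsType (@mu2 R))) => p cp Op.
    have := flim p (cp Op) => fp.
    have : g ^~ p @ \oo --> ((f p - f_ n p) ^+ 2)%:E.
      apply/cvg_EFin; first exact: nearW.
      rewrite !expr2; apply: cvgM; (apply: cvgB; [exact: fp|exact: cvg_cst]).
    by move/cvg_limn_einf_sup => [->].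
have f0 : L2 Om (f \- f_ 0%N).
  split; first by apply: measurable_funB => //; exact: (f2 0%N).1.
  apply/integrableP; split.
    by apply/measurable_EFinP; apply: measurable_funX; apply: measurable_funB => //; exact: (f2 0%N).1.
  under eq_integral do rewrite gee0_abs ?lee_fin ?sqr_ge0//.
  by apply: le_lt_trans (fat 0%N) _; rewrite ltry.
have L2f : L2 Om f.
  by apply: (eq_L2 mOm _ (L2D mOm f0 (f2 0%N))) => p _ /=; rewrite subrK.
exists f => // n; have fn2 := L2B mOm L2f (f2 n).
rewrite -lee_fin -EFin_ip; last exact: (L2_intgM mOm fn2 fn2).
by have := fat n; under eq_integral do rewrite expr2.
Qed.

End L2completeness.

(** * Compactness *)

Section Variance.
Context d (T : measurableType d) (R : realType) (mu : {measure set T -> \bar R}).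
Variables (D : set T) (h : R).
Hypotheses (mD : measurable D) (muD : mu D = h%:E) (h0 : 0 < h).
Implicit Types (g : T -> R).

Lemma bounded_integrable g M : measurable_fun D g ->
  (forall x, D x -> `|g x| <= M) -> mu.-integrable D (EFin \o g).
Proof.
move=> mg gM; apply: measurable_bounded_integrable => //; first by rewrite muD ltry.
exists M; split; first exact: num_real.
by move=> y My x /= Dx; rewrite (le_trans (gM x Dx))// ltW.
Qed.

Lemma integral_sqr_shift g M c : measurable_fun D g ->
  (forall x, D x -> `|g x| <= M) ->
  \int[mu]_(x in D) ((g x - c) ^+ 2) =
  \int[mu]_(x in D) (g x ^+ 2) - 2 * c * \int[mu]_(x in D) g x + c ^+ 2 * h.
Proof.
move=> mg gM.
have ig := bounded_integrable mg gM.
have ig2 : mu.-integrable D (EFin \o (fun x => g x ^+ 2)).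
  apply: (@bounded_integrable _ (M ^+ 2)); first exact: measurable_funX.
  by move=> x Dx; rewrite normrX lerXn2r ?nnegrE ?gM// (le_trans _ (gM x Dx)).
have igc : mu.-integrable D (EFin \o (fun x => 2 * c * g x)).
  by have := integrableZl mD (2 * c) ig; apply: eq_integrable.
have ic : mu.-integrable D (EFin \o cst (c ^+ 2)).
  by apply: (@bounded_integrable _ (`|c ^+ 2|)).
have igb : mu.-integrable D (EFin \o (fun x => g x ^+ 2 - 2 * c * g x)).
  by have := integrableB mD ig2 igc; apply: eq_integrable.
transitivity (\int[mu]_(x in D) ((g x ^+ 2 - 2 * c * g x) + cst (c ^+ 2) x)).
  by apply: eq_Rintegral => x _ /=; ring.
rewrite RintegralD// RintegralB// RintegralZl// Rintegral_cst// muD /=; ring.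
Qed.

(** Cauchy-Schwarz against the constant 1, obtained from the nonnegativity of the variance. *)
Lemma integral_sqr_ge g M : measurable_fun D g ->
  (forall x, D x -> `|g x| <= M) ->
  (\int[mu]_(x in D) g x) ^+ 2 <= h * \int[mu]_(x in D) (g x ^+ 2).
Proof.
move=> mg gM; have := integral_sqr_shift (\int[mu]_(x in D) g x / h) mg gM.
have : 0 <= \int[mu]_(x in D) ((g x - \int[mu]_(x in D) g x / h) ^+ 2).
  by apply: Rintegral_ge0 => x _; rewrite sqr_ge0.
move=> /[swap] ->; set a := Rintegral _ _ _; set b := Rintegral _ _ _.
have -> : a - 2 * (b / h) * b + (b / h) ^+ 2 * h = a - b ^+ 2 / h.
  by field; rewrite gt_eqF.
by rewrite subr_ge0 ler_pdivrMr// mulrC.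
Qed.

(** Averaging [g y - g x] over [y] shows that [g x] is as close to the mean as to the other values.
    The variance is therefore at most [h * K], and the remaining term is the square of the mean. *)
Lemma integral_sqr_le g M K : measurable_fun D g ->
  (forall x, D x -> `|g x| <= M) ->
  (forall x y, D x -> D y -> (g x - g y) ^+ 2 <= K) ->
  \int[mu]_(x in D) (g x ^+ 2) <= h * K + h^-1 * (\int[mu]_(x in D) g x) ^+ 2.
Proof.
move=> mg gM gK; have ig := bounded_integrable mg gM.
set m := \int[mu]_(x in D) g x / h.
have gmK x : D x -> (g x - m) ^+ 2 <= K.
  move=> Dx; have K0 : 0 <= K by apply: le_trans (gK x x Dx Dx); rewrite sqr_ge0.
  have mgx : measurable_fun D (fun y => g y - g x) by exact: measurable_funB.
  have gxM y : D y -> `|g y - g x| <= M + M.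
    by move=> Dy; rewrite (le_trans (ler_normB _ _))// lerD ?gM.
  have e : \int[mu]_(y in D) (g y - g x) = h * (m - g x).
    rewrite (RintegralB (f2 := cst (g x)))//; last by apply: (@bounded_integrable _ `|g x|).
    by rewrite Rintegral_cst// muD /= /m; field; rewrite gt_eqF.
  have := integral_sqr_ge mgx gxM; rewrite e => H.
  have H2 : \int[mu]_(y in D) ((g y - g x) ^+ 2) <= h * K.
    apply: (@le_trans _ _ (\int[mu]_(y in D) K)); last first.
      by rewrite Rintegral_cst// muD mulrC.
    apply: le_Rintegral => //; last by move=> y Dy; exact: gK.
      apply: (@bounded_integrable _ K); first exact: measurable_funX.
      by move=> y Dy; rewrite ger0_norm ?sqr_ge0// gK.
    by apply: (@bounded_integrable _ `|K|).
  rewrite -(@ler_pM2l _ (h * h)) ?mulr_gt0//.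
  have -> : (h * h) * (g x - m) ^+ 2 = (h * (m - g x)) ^+ 2 by ring.
  by rewrite (le_trans H)// -mulrA ler_pM2l.
have mgm : measurable_fun D (fun x => g x - m) by exact: measurable_funB.
have H : \int[mu]_(x in D) ((g x - m) ^+ 2) <= h * K.
  apply: (@le_trans _ _ (\int[mu]_(y in D) K)); last first.
    by rewrite Rintegral_cst// muD mulrC.
  apply: le_Rintegral => //.
    apply: (@bounded_integrable _ K); first exact: measurable_funX.
    by move=> y Dy; rewrite ger0_norm ?sqr_ge0// gmK.
  by apply: (@bounded_integrable _ `|K|).
move: H; rewrite (integral_sqr_shift m mg gM).
set a := Rintegral _ _ _; set b := Rintegral _ _ _.
have -> : h^-1 * b ^+ 2 = 2 * m * b - m ^+ 2 * h.
  by rewrite /m -/b; field; rewrite gt_eqF.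
by move=> H; rewrite addrA lerBrDr; move: H; rewrite addrAC lerBlDr.
Qed.

End Variance.

(** * Poincaré's inequality on a square *)

Section CellInequality.
Context {R : realType}.
Local Notation mR := (measurableTypeR R).
Local Notation leb := (@lebesgue_measure R).
Implicit Types (f phi : R * R -> R).

Lemma continuous_rect_bounded f (a b c d : R) : continuous f ->
  exists M : R, forall p, (`[a, b] `*` `[c, d]) p -> `|f p| <= M.
Proof.
move=> cf.
have cQ : compact (`[a, b] `*` `[c, d] : set (R * R)).
  by apply: compact_setX; exact: segment_compact.
have cfQ : {within (`[a, b] `*` `[c, d] : set (R * R)), continuous f}.
  exact/continuous_subspaceT/cf.
have /compact_bounded[M [_ hM]] := continuous_compact cfQ cQ.
exists (`|M| + 1) => p Qp; apply: hM; last by exists p.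
by rewrite (le_lt_trans (ler_norm M))// ltrDl.
Qed.

Lemma continuous_slice1 f y : continuous f -> continuous (fun x => f (x, y)).
Proof.
move=> cf x; apply: (@continuous_comp _ _ _ (fun x => (x, y)) f); last exact: cf.
exact: (cvg_pair cvg_id (cvg_cst y)).
Qed.

Lemma continuous_slice2 f x : continuous f -> continuous (fun y => f (x, y)).
Proof.
move=> cf y; apply: (@continuous_comp _ _ _ (fun y => (x, y)) f); last exact: cf.
exact: (cvg_pair (cvg_cst x) cvg_id).
Qed.

Lemma lebesgue_co (a h : R) : 0 < h -> leb `[a, a + h[ = h%:E.
Proof.
move=> h0; rewrite lebesgue_measure_itv /= lte_fin ltrDl h0 -EFinB.
by rewrite addrAC subrr add0r.
Qed.

Section Cell.
Variables (a c h : R).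
Hypothesis h0 : 0 < h.
Let I : set R := `[a, a + h[.
Let J : set R := `[c, c + h[.

Lemma cell_sub_cc x y : I x -> J y -> (`[a, a + h] `*` `[c, c + h]) (x, y).
Proof.
rewrite /I /J /= !in_itv/= => /andP[x1 x2] /andP[y1 y2].
by split => /=; rewrite ?in_itv/= ?x1 ?y1 ltW.
Qed.

Let mI : measurable (I : set mR). Proof. exact: measurable_itv. Qed.
Let mJ : measurable (J : set mR). Proof. exact: measurable_itv. Qed.
Let mQ : measurable (I `*` J : set (mR * mR)). Proof. exact: measurableX. Qed.

Lemma cell_integrable f : continuous f -> (@mu2 R).-integrable (I `*` J) (EFin \o f).
Proof.
move=> cf; have [M fM] := continuous_rect_bounded a (a + h) c (c + h) cf.
apply: measurable_bounded_integrable => //.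
- by rewrite [X in (X < _)%E](mu2_rect mI mJ) !lebesgue_co// -EFinM ltry.
- have mf : measurable_fun (setT : set (mR * mR)) f.
    by apply: continuous_measurable_plane => [|p _]; [exact: openT|exact: cf].
  exact: measurable_funTS mf.
- exists M; split; first exact: num_real.
  move=> x Mx [p1 p2] /= [Ip Jp]; rewrite (le_trans _ (ltW Mx))//.
  by apply: fM; exact: cell_sub_cc.
Qed.

Lemma slice1_bounded f : continuous f ->
  exists M : R, forall y, J y -> forall x, I x -> `|f (x, y)| <= M.
Proof.
move=> cf; have [M fM] := continuous_rect_bounded a (a + h) c (c + h) cf.
by exists M => y Jy x Ix; apply: fM; exact: cell_sub_cc.
Qed.

Lemma slice_measurable (f : R -> R) A : measurable (A : set mR) -> continuous f ->
  measurable_fun (A : set mR) f.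
Proof. by move=> mA cf; apply: measurable_funTS; exact: continuous_measurable_fun. Qed.

Lemma slice1_integrable f y : continuous f -> J y ->
  leb.-integrable I (EFin \o (fun x => f (x, y))).
Proof.
move=> cf Jy; have [M fM] := slice1_bounded cf.
apply: (bounded_integrable mI (lebesgue_co a h0) _ (fM y Jy)).
exact: (slice_measurable mI (continuous_slice1 cf)).
Qed.

Lemma slice2_integrable f x : continuous f -> I x ->
  leb.-integrable J (EFin \o (fun y => f (x, y))).
Proof.
move=> cf Ix; have [M fM] := slice1_bounded cf.
apply: (bounded_integrable mJ (lebesgue_co c h0) _ (fun y Jy => fM y Jy x Ix)).
exact: (slice_measurable mJ (continuous_slice2 cf)).
Qed.

Let cellT f : continuous f ->
  ((leb \x leb)%E).-integrable setT ((EFin \o f) \_ (I `*` J)).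
Proof. by move=> cf; have := cell_integrable cf; rewrite integrable_mkcond. Qed.

Let inner1 f : continuous f ->
  (fun y => \int[leb]_x ((EFin \o f) \_ (I `*` J)) (x, y))%E =
  (EFin \o (fun y => \int[leb]_(x in I) f (x, y))) \_ J.
Proof.
move=> cf; apply/funext => y; rewrite !patchE; case: ifPn => yJ.
  have Jy := set_mem yJ.
  rewrite /= /Rintegral fineK; last exact: (integrable_fin_num mI (slice1_integrable cf Jy)).
  rewrite [RHS]integral_mkcond; apply: eq_integral => x _.
  rewrite !patchE; congr (if _ then _ else _).
  by apply/idP/idP; rewrite !inE => // -[].
apply: integral0_eq => x _; rewrite patchE ifF//.
by apply/negbTE; apply: contra yJ; rewrite !inE => -[].
Qed.

Let inner2 f : continuous f ->
  (fun x => \int[leb]_y ((EFin \o f) \_ (I `*` J)) (x, y))%E =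
  (EFin \o (fun x => \int[leb]_(y in J) f (x, y))) \_ I.
Proof.
move=> cf; apply/funext => x; rewrite !patchE; case: ifPn => xI.
  have Ix := set_mem xI.
  rewrite /= /Rintegral fineK; last exact: (integrable_fin_num mJ (slice2_integrable cf Ix)).
  rewrite [RHS]integral_mkcond; apply: eq_integral => y _.
  rewrite !patchE; congr (if _ then _ else _).
  by apply/idP/idP; rewrite !inE => // -[].
apply: integral0_eq => y _; rewrite patchE ifF//.
by apply/negbTE; apply: contra xI; rewrite !inE => -[].
Qed.

Lemma cell_fubini1 f : continuous f ->
  \int[@mu2 R]_(p in I `*` J) f p = \int[leb]_(y in J) \int[leb]_(x in I) f (x, y).
Proof.
move=> cf; rewrite /Rintegral integral_mkcond; congr fine.
rewrite -[LHS](integral21_prod_meas1 (cellT cf)) /fubini_G inner1//.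
by rewrite [RHS]integral_mkcond.
Qed.

Lemma cell_fubini2 f : continuous f ->
  \int[@mu2 R]_(p in I `*` J) f p = \int[leb]_(x in I) \int[leb]_(y in J) f (x, y).
Proof.
move=> cf; rewrite /Rintegral integral_mkcond; congr fine.
rewrite -[LHS](integral12_prod_meas1 (cellT cf)) /fubini_F inner2//.
by rewrite [RHS]integral_mkcond.
Qed.

Lemma slice1_measurable f : continuous f ->
  measurable_fun (J : set mR) (fun y => \int[leb]_(x in I) f (x, y)).
Proof.
move=> cf; apply/measurable_EFinP.
have := measurable_fubini_G (cellT cf); rewrite /fubini_G inner1//.
move/(@measurable_funTS _ _ _ _ J); apply: eq_measurable_fun => y Jy.
by rewrite patchE Jy.
Qed.

Lemma slice2_measurable f : continuous f ->
  measurable_fun (I : set mR) (fun x => \int[leb]_(y in J) f (x, y)).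
Proof.
move=> cf; apply/measurable_EFinP.
have := measurable_fubini_F (cellT cf); rewrite /fubini_F inner2//.
move/(@measurable_funTS _ _ _ _ I); apply: eq_measurable_fun => x Ix.
by rewrite patchE Ix.
Qed.

Lemma Rintegral_bound (A : set R) (g : R -> R) M : measurable (A : set mR) -> leb A = h%:E ->
  measurable_fun (A : set mR) g ->
  (forall x, A x -> `|g x| <= M) -> `|\int[leb]_(x in A) g x| <= M * h.
Proof.
move=> mA hA mg gM; have ig := bounded_integrable mA hA mg gM.
apply: (le_trans (le_normr_Rintegral mA ig)).
have -> : M * h = \int[leb]_(x in A) cst M x.
  by rewrite Rintegral_cst//; congr (M * _); exact: (esym (congr1 fine hA)).
apply: le_Rintegral => //; first exact: integrable_norm.
by apply: (bounded_integrable mA hA (M := `|M|)).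
Qed.

Lemma slice1_int_bounded f : continuous f -> exists M : R, forall y, J y ->
  `|\int[leb]_(x in I) f (x, y)| <= M.
Proof.
move=> cf; have [M fM] := slice1_bounded cf; exists (M * h) => y Jy.
apply: Rintegral_bound => //; [exact: lebesgue_co| |exact: fM].
exact: (slice_measurable mI (continuous_slice1 cf)).
Qed.

Lemma slice2_int_bounded f : continuous f -> exists M : R, forall x, I x ->
  `|\int[leb]_(y in J) f (x, y)| <= M.
Proof.
move=> cf; have [M fM] := slice1_bounded cf; exists (M * h) => x Ix.
apply: Rintegral_bound => //; [exact: lebesgue_co| |by move=> y Jy; exact: fM].
exact: (slice_measurable mJ (continuous_slice2 cf)).
Qed.

Lemma slice1_int_integrable f : continuous f ->
  leb.-integrable J (EFin \o (fun y => \int[leb]_(x in I) f (x, y))).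
Proof.
move=> cf; have [M fM] := slice1_int_bounded cf.
exact: (bounded_integrable mJ (lebesgue_co c h0) (slice1_measurable cf) fM).
Qed.

Lemma slice2_int_integrable f : continuous f ->
  leb.-integrable I (EFin \o (fun x => \int[leb]_(y in J) f (x, y))).
Proof.
move=> cf; have [M fM] := slice2_int_bounded cf.
exact: (bounded_integrable mI (lebesgue_co a h0) (slice2_measurable cf) fM).
Qed.

End Cell.

End CellInequality.

Lemma continuous_sqr (R : realType) (T : topologicalType) (f : T -> R) :
  continuous f -> continuous (fun x => f x ^+ 2).
Proof.
move=> cf; rewrite (_ : (fun x => _) = f \* f); last by apply/funext => x; rewrite expr2.
by move=> x; apply: cvgM; exact: cf.
Qed.

Lemma cell_combine (R : realType) (h s ix iy im m2 : R) : 0 < h ->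
  s <= h * (h * ix) + h^-1 * m2 -> m2 <= h * (h * (h * iy)) + h^-1 * im ^+ 2 ->
  s <= h ^+ 2 * (ix + iy) + h^-1 ^+ 2 * im ^+ 2.
Proof.
move=> h0 H1 H2; apply: (le_trans H1).
have hi0 : 0 <= h^-1 by rewrite invr_ge0 ltW.
have := ler_wpM2l hi0 H2.
have -> : h^-1 * (h * (h * (h * iy)) + h^-1 * im ^+ 2) = h ^+ 2 * iy + h^-1 ^+ 2 * im ^+ 2.
  by field; rewrite gt_eqF.
lra.
Qed.

Section CellPoincare.
Context {R : realType}.
Local Notation mR := (measurableTypeR R).
Local Notation leb := (@lebesgue_measure R).
Implicit Types (f phi : R * R -> R).
Variable h : R.
Hypothesis h0 : 0 < h.

(** The difference is the integral of [f] between the two points; Cauchy-Schwarz costs the length of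
    that interval, at most [h], and the integral of the square grows with the interval. *)
Lemma oscillation_sqr_le (F f : R -> R) (a x y : R) : continuous f ->
  (forall x : R, is_derive x 1 F (f x)) ->
  `[a, a + h[%classic x -> `[a, a + h[%classic y ->
  (F x - F y) ^+ 2 <= h * \int[leb]_(s in `[a, a + h[) (f s ^+ 2).
Proof.
move=> cf dF; wlog yx : x y / y <= x => [H Ix Iy|].
  by have [/H|/ltW/H H'] := leP y x; [exact|rewrite -sqrrN opprB; exact: H'].
move=> Ix Iy; have cf2 := continuous_sqr cf.
have mI : measurable (`[a, a + h[%classic : set mR) by exact: measurable_itv.
have ge0I : 0 <= \int[leb]_(s in `[a, a + h[) (f s ^+ 2).
  by apply: Rintegral_ge0 => s _; rewrite sqr_ge0.
move: yx; rewrite le_eqVlt => /predU1P[->|yx].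
  by rewrite subrr expr0n/= mulr_ge0// ltW.
have mD : measurable (`[y, x]%classic : set mR) by exact: measurable_itv.
have xy0 : 0 < x - y by rewrite subr_gt0.
have hD : leb `[y, x]%classic = (x - y)%:E.
  by rewrite lebesgue_measure_itv /= lte_fin yx EFinB.
have /compact_bounded[M [_ hM]] := continuous_compact
  (continuous_subspaceT cf) (@segment_compact R a (a + h)).
have fM s : `[a, a + h]%classic s -> `|f s| <= `|M| + 1.
  move=> Is; apply: hM; last by exists s.
  by rewrite (le_lt_trans (ler_norm M))// ltrDl.
have sub : `[y, x]%classic `<=` `[a, a + h[%classic.
  move: Ix Iy => /=; rewrite !in_itv/= => /andP[? ?] /andP[? ?] s /=.
  by rewrite !in_itv/= => /andP[? ?]; apply/andP; split; lra.
have subcc : `[a, a + h[%classic `<=` `[a, a + h]%classic.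
  by move=> s /=; rewrite !in_itv/= => /andP[-> /ltW].
have i2 : leb.-integrable `[a, a + h[ (EFin \o (fun s => f s ^+ 2)).
  apply: (bounded_integrable mI (lebesgue_co a h0) (M := (`|M| + 1) ^+ 2)).
    exact: slice_measurable.
  move=> s /subcc/fM fs; rewrite normrX lerXn2r ?nnegrE// addr_ge0//.
have -> : F x - F y = \int[leb]_(s in `[y, x]) f s.
  by rewrite /Rintegral (FTC_segment (ltW yx) cf dF).
apply: (le_trans (integral_sqr_ge mD hD xy0 (slice_measurable mD cf)
   (fun s Ds => fM s (subcc _ (sub _ Ds))))).
apply: ler_pM.
- by rewrite ltW.
- by apply: Rintegral_ge0 => s _; rewrite sqr_ge0.
- move: Ix Iy => /=; rewrite !in_itv/= => /andP[? ?] /andP[? ?]; lra.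
- rewrite fine_le//.
  + by apply: (integrable_fin_num mD); exact: (integrableS mI mD sub i2).
  + exact: (integrable_fin_num mI i2).
  + apply: ge0_subset_integral => //; last by move=> s _; rewrite lee_fin sqr_ge0.
    exact: measurable_int i2.
Qed.

Variables a c : R.
Let I : set R := `[a, a + h[.
Let J : set R := `[c, c + h[.
Let mI : measurable (I : set mR). Proof. exact: measurable_itv. Qed.
Let mJ : measurable (J : set mR). Proof. exact: measurable_itv. Qed.
Let lI : leb I = h%:E. Proof. exact: lebesgue_co. Qed.
Let lJ : leb J = h%:E. Proof. exact: lebesgue_co. Qed.

(* The variance over a square is the sum of the mean variance along the columns and the
   variance of the means of the columns. *)
Lemma cell_poincare phi : smooth_on setT phi ->
  \int[@mu2 R]_(p in I `*` J) (phi p ^+ 2) <=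
  h ^+ 2 * (\int[@mu2 R]_(p in I `*` J) ('D_(axis false) phi p ^+ 2) +
            \int[@mu2 R]_(p in I `*` J) ('D_(axis true) phi p ^+ 2)) +
  h^-1 ^+ 2 * (\int[@mu2 R]_(p in I `*` J) phi p) ^+ 2.
Proof.
move=> sp; have cp := smooth_continuous sp.
pose px : R * R -> R := 'D_(axis false) phi; pose py : R * R -> R := 'D_(axis true) phi.
have cpx : continuous px by exact/smooth_continuous/smooth_partial.
have cpy : continuous py by exact/smooth_continuous/smooth_partial.
have cp2 := continuous_sqr cp.
have cpx2 := continuous_sqr cpx; have cpy2 := continuous_sqr cpy.
pose X y := \int[leb]_(x in I) (px (x, y) ^+ 2).
pose Y x := \int[leb]_(y in J) (py (x, y) ^+ 2).
pose m y := \int[leb]_(x in I) phi (x, y).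
have [Mp hMp] := slice1_bounded a c h cp.
have oscx y x x' : I x -> I x' -> (phi (x, y) - phi (x', y)) ^+ 2 <= h * X y.
  move=> Ix Ix'; apply: (@oscillation_sqr_le (fun s => phi (s, y)) (fun s => px (s, y)) a) => //.
    exact: continuous_slice1.
  by move=> s; apply/is_derive_slice1; exact: smooth_is_derive.
have oscy x y y' : J y -> J y' -> (phi (x, y) - phi (x, y')) ^+ 2 <= h * Y x.
  move=> Jy Jy'; apply: (@oscillation_sqr_le (fun s => phi (x, s)) (fun s => py (x, s)) c) => //.
    exact: continuous_slice2.
  by move=> s; apply/is_derive_slice2; exact: smooth_is_derive.
have S1 y : J y -> \int[leb]_(x in I) (phi (x, y) ^+ 2) <= h * (h * X y) + h^-1 * m y ^+ 2.
  move=> Jy; apply: (integral_sqr_le mI lI h0 _ (hMp y Jy)).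
    exact: (slice_measurable mI (continuous_slice1 cp)).
  by move=> x x' Ix Ix'; exact: oscx.
have [Mm hMm] := slice1_int_bounded a c h0 cp.
have mm : measurable_fun (J : set mR) m by exact: slice1_measurable.
have im2 : leb.-integrable J (EFin \o (fun y => m y ^+ 2)).
  apply: (bounded_integrable mJ lJ (M := Mm ^+ 2)); first exact: measurable_funX.
  by move=> y Jy; rewrite normrX lerXn2r ?nnegrE ?hMm// (le_trans _ (hMm y Jy)).
have iX : leb.-integrable J (EFin \o X) by exact: (slice1_int_integrable a c h0 cpx2).
have iY : leb.-integrable I (EFin \o Y) by exact: (slice2_int_integrable a c h0 cpy2).
have iXh : leb.-integrable J (EFin \o (fun y => h * (h * X y))).
  by have := integrableZl mJ h (integrableZl mJ h iX); apply: eq_integrable.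
have imh : leb.-integrable J (EFin \o (fun y => h^-1 * m y ^+ 2)).
  by have := integrableZl mJ h^-1 im2; apply: eq_integrable.
have iS : leb.-integrable J (EFin \o (fun y => h * (h * X y) + h^-1 * m y ^+ 2)).
  by have := integrableD mJ iXh imh; apply: eq_integrable.
have S2 : \int[@mu2 R]_(p in I `*` J) (phi p ^+ 2) <=
    h * (h * \int[leb]_(y in J) X y) + h^-1 * \int[leb]_(y in J) (m y ^+ 2).
  rewrite (cell_fubini1 a c h0 cp2).
  apply: (@le_trans _ _ (\int[leb]_(y in J) (h * (h * X y) + h^-1 * m y ^+ 2))).
    apply: le_Rintegral => //; exact: (slice1_int_integrable a c h0 cp2).
  have iX1 : leb.-integrable J (EFin \o (fun y => h * X y)).
    by have := integrableZl mJ h iX; apply: eq_integrable.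
  have e1 : \int[leb]_(y in J) (h * X y) = h * \int[leb]_(y in J) X y.
    exact: (RintegralZl _ mJ iX).
  have e2 : \int[leb]_(y in J) (h * (h * X y)) = h * \int[leb]_(y in J) (h * X y).
    exact: (RintegralZl _ mJ iX1).
  have e3 : \int[leb]_(y in J) (h^-1 * m y ^+ 2) = h^-1 * \int[leb]_(y in J) (m y ^+ 2).
    exact: (RintegralZl _ mJ im2).
  by rewrite (RintegralD mJ iXh imh) e2 e1 e3.
have S3 : \int[leb]_(y in J) (m y ^+ 2) <=
    h * (h * (h * \int[leb]_(x in I) Y x)) + h^-1 * (\int[leb]_(y in J) m y) ^+ 2.
  apply: (integral_sqr_le mJ lJ h0 mm hMm) => y y' Jy Jy'.
  have cd : continuous (fun x => phi (x, y) - phi (x, y')).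
    by move=> x; apply: cvgB; exact: continuous_slice1.
  have -> : m y - m y' = \int[leb]_(x in I) (phi (x, y) - phi (x, y')).
    by rewrite (RintegralB mI (slice1_integrable a h0 cp Jy) (slice1_integrable a h0 cp Jy')).
  have dM x : I x -> `|phi (x, y) - phi (x, y')| <= Mp + Mp.
    by move=> Ix; rewrite (le_trans (ler_normB _ _))// lerD ?hMp.
  apply: (le_trans (integral_sqr_ge mI lI h0 (slice_measurable mI cd) dM)).
  have -> : h * \int[leb]_(x in I) Y x = \int[leb]_(x in I) (h * Y x).
    by apply: esym; exact: (RintegralZl _ mI iY).
  rewrite ler_pM2l//; apply: le_Rintegral => //.
  - apply: (bounded_integrable mI lI (M := (Mp + Mp) ^+ 2)).
      by apply: measurable_funX; exact: slice_measurable.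
    by move=> x Ix; rewrite normrX lerXn2r ?nnegrE ?dM// (le_trans _ (dM x Ix)).
  - by have := integrableZl mI h iY; apply: eq_integrable.
  - by move=> x Ix; exact: oscy.
rewrite (cell_fubini1 a c h0 cpx2) (cell_fubini2 a c h0 cpy2) (cell_fubini1 a c h0 cp).
exact: (cell_combine h0 S2 S3).
Qed.

End CellPoincare.

(** * Grids, and compactness of families of test functions *)

Section Grid.
Context {R : realType}.
Local Notation mR := (measurableTypeR R).
Variable Om : set (R * R).
Hypotheses (oOm : open Om) (bOm : bounded_set Om).
Implicit Types (f g phi : R * R -> R).

Let mOm := measurable_open_plane oOm.
Let fOm := mu2_bounded_lty oOm bOm.

(** Half-open, so that the indicators of the cells add up to exactly 1 at every point and no overlap
    has to be discarded. *)
Definition grid_itv (L h : R) (i : nat) : set R :=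
  `[- L + h * i%:R, - L + h * i%:R + h[.

Lemma sum_indic_co (L h x : R) (N : nat) : 0 < h -> h * N%:R = L + L ->
  - L <= x < L ->
  \sum_(i < N) (\1_(grid_itv L h i) x : R) = 1.
Proof.
move=> h0 hN /andP[Lx xL]; pose s (i : nat) : R := (- L + h * i%:R <= x)%R%:R.
(* The indicator of a half-open interval is the difference of the step functions at its two ends, so
   the sum telescopes. *)
transitivity (\sum_(0 <= i < N) (s i - s i.+1)).
  rewrite big_mkord; apply: eq_bigr => i _; rewrite indicE /s.
  have -> : (x \in grid_itv L h i) =
      (- L + h * i%:R <= x) && ~~ (- L + h * i.+1%:R <= x).
    rewrite mem_setE in_itv/= -ltNge; congr (_ && (_ < _)).
    by rewrite -natr1 mulrDr mulr1 addrA.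
  have [h1|h1] := leP (- L + h * i.+1%:R) x; last by rewrite andbT subr0.
  rewrite andbF (_ : - L + h * i%:R <= x) ?subrr//.
  by rewrite (le_trans _ h1)// lerD2l ler_pM2l// ler_nat.
have -> : \sum_(0 <= i < N) (s i - s i.+1) = - \sum_(0 <= i < N) (s i.+1 - s i).
  by rewrite -sumrN; apply: eq_bigr => i _; rewrite opprB.
rewrite telescope_sumr// opprB /s mulr0 addr0 Lx hN addrA addNr add0r.
by rewrite leNgt xL subr0.
Qed.

Definition grid_cell (L h : R) (i j : nat) : set (R * R) :=
  grid_itv L h i `*` grid_itv L h j.

Lemma measurable_grid_cell L h i j : measurable (grid_cell L h i j : set (mR * mR)).
Proof. by apply: measurableX; exact: measurable_itv. Qed.

Lemma sum_indic_cell (L h : R) (N : nat) p : 0 < h -> h * N%:R = L + L ->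
  rect (- L) L (- L) L p ->
  \sum_(i < N) \sum_(j < N) (\1_(grid_cell L h i j) p : R) = 1.
Proof.
move=> h0 hN [/=]; rewrite !in_itv/= => /andP[/ltW x1 x2] /andP[/ltW y1 y2].
rewrite -[RHS](@sum_indic_co L h p.1 N h0 hN) ?x1//; apply: eq_bigr => i _.
rewrite -[RHS]mulr1 -[in RHS](@sum_indic_co L h p.2 N h0 hN) ?y1// mulr_sumr.
apply: eq_bigr => j _; rewrite !indicE -natrM mulnb; congr (_%:R); congr nat_of_bool.
by rewrite /grid_cell in_setX.
Qed.

Lemma intg_indic f Q : measurable (Q : set (mR * mR)) -> intg Om f ->
  intg Om (fun p => f p * \1_Q p).
Proof.
move=> mQ fi; apply: (le_intg mOm _ (integrable_norm fi)).
  by apply: measurable_funM; [exact: intg_measurable|exact: measurable_indic].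
by move=> p _; rewrite normrM indicE normr_nat ler_piMr// lern1; case: (_ \in _).
Qed.

Lemma Rint_indic f Q : (forall p, ~ Om p -> f p = 0) ->
  \int[@mu2 R]_(p in Om) (f p * \1_Q p) = \int[@mu2 R]_(p in Q) f p.
Proof.
move=> f0; rewrite Rintegral_mkcond [RHS]Rintegral_mkcond.
apply: eq_Rintegral => p _; rewrite !patchE indicE.
case: (boolP (p \in Om)) => [_|/negP]; first by case: ifP; rewrite ?mulr1 ?mulr0.
by rewrite inE => nOm; rewrite f0// if_same.
Qed.

Lemma Rint_grid f (L h : R) (N : nat) : 0 < h -> h * N%:R = L + L ->
  Om `<=` rect (- L) L (- L) L -> intg Om f -> (forall p, ~ Om p -> f p = 0) ->
  \int[@mu2 R]_(p in Om) f p =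
  \sum_(i < N) \sum_(j < N) \int[@mu2 R]_(p in grid_cell L h i j) f p.
Proof.
move=> h0 hN OmL fi f0.
have iF (i j : nat) : intg Om (fun p => f p * \1_(grid_cell L h i j) p).
  by apply: intg_indic => //; exact: measurable_grid_cell.
transitivity (\int[@mu2 R]_(p in Om)
    (\sum_(i < N) \sum_(j < N) f p * \1_(grid_cell L h i j) p)).
  apply: eq_Rint => p /OmL Lp; rewrite -[LHS]mulr1 -(sum_indic_cell h0 hN Lp).
  by rewrite mulr_sumr; apply: eq_bigr => i _; rewrite mulr_sumr.
rewrite (Rint_sum mOm); last by move=> i; apply: (intg_sum mOm) => j; exact: iF.
apply: eq_bigr => i _; rewrite (Rint_sum mOm); last by move=> j; exact: iF.
by apply: eq_bigr => j _; exact: Rint_indic.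
Qed.

(* A form of Rellich's theorem: the [chi i j] are the indicators of the cells of a fine grid. *)
Lemma test_compactness (e : R) : 0 < e ->
  exists (N : nat) (chi : nat -> nat -> R * R -> R) (C : R),
  [/\ 0 <= C, forall i j, L2 Om (chi i j) &
    forall phi, test_function Om phi ->
      ip Om phi phi <= e * gip Om (fun b => 'D_(axis b) phi) (fun b => 'D_(axis b) phi) +
        C * \sum_(i < N) \sum_(j < N) ip Om phi (chi i j) ^+ 2].
Proof.
move=> e0; have [L L0 OmL] := bounded_subsquare bOm.
have [N hN] : exists N : nat, 0 < N%:R :> R /\ (2 * L / N%:R) ^+ 2 <= e.
  (* The requirement is [N^2 >= (2 * L) ^+ 2 / e]. The maximum with 1 ensures [N^2 >= N], so it
     suffices that [N] exceeds the quotient. *)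
  exists (Num.truncn (Num.max 1 ((2 * L) ^+ 2 / e))).+1.
  set z := Num.max _ _; have z0 : 1 <= z by rewrite le_max lexx.
  have Nz : z < (Num.truncn z).+1%:R by exact: truncnS_gt.
  set n : R := _.+1%:R in Nz *.
  have n1 : 1 <= n by rewrite (le_trans z0)// ltW.
  have n0 : 0 < n by lra.
  split => //; rewrite expr_div_n ler_pdivrMr ?exprn_gt0// -ler_pdivrMl//.
  apply: (@le_trans _ _ z); first by rewrite mulrC /z le_max lexx orbT.
  by rewrite (le_trans (ltW Nz))// expr2 ler_peMr// ltW.
case: hN => N0 hNe; pose h := 2 * L / N%:R.
have h0 : 0 < h by rewrite divr_gt0// mulr_gt0.
have hN : h * N%:R = L + L by rewrite /h divfK ?gt_eqF//; ring.
exists N, (fun i j => \1_(grid_cell L h i j)), (h^-1 ^+ 2); split.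
- by rewrite exprn_ge0// invr_ge0 ltW.
- move=> i j; apply: (bounded_L2 mOm fOm (M := 1)).
    by apply: measurable_indic; exact: measurable_grid_cell.
  by move=> p _; rewrite indicE normr_nat lern1; case: (_ \in _).
move=> phi tphi; have p2 := test_L2 oOm bOm tphi.
have [K [cK clK KO phi0]] := test_support tphi.
have D2 b := test_partial_L2 oOm bOm b tphi.
have phiO p : ~ Om p -> phi p = 0 by move=> nO; apply: phi0 => /KO.
have DO b p : ~ Om p -> 'D_(axis b) phi p = 0.
  have [K' [_ _ KO' _ D0]] := test_partial_eq0 b tphi.
  by move=> nO; apply: D0 => /KO'.
have ipE (f : R * R -> R) : L2 Om f -> (forall p, ~ Om p -> f p = 0) ->
   ip Om f f = \sum_(i < N) \sum_(j < N) \int[@mu2 R]_(p in grid_cell L h i j) (f p ^+ 2).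
  move=> f2 f0; rewrite -L2sqE /L2sq (Rint_grid h0 hN OmL)//; first exact: f2.2.
  by move=> p /f0 ->; rewrite expr0n.
rewrite (ipE phi p2 phiO) /gip (ipE _ (D2 false) (DO false)) (ipE _ (D2 true) (DO true)).
rewrite -big_split/= mulr_sumr mulr_sumr -big_split/=.
apply: ler_sum => i _; rewrite -big_split/= mulr_sumr mulr_sumr -big_split/=.
apply: ler_sum => j _.
have -> : ip Om phi \1_(grid_cell L h i j) = \int[@mu2 R]_(p in grid_cell L h i j) phi p.
  exact: Rint_indic.
apply: (le_trans (cell_poincare h0 _ _ tphi.1)); rewrite lerD2r ler_wpM2r//.
by rewrite addr_ge0//; apply: Rintegral_ge0 => p _; rewrite sqr_ge0.
Qed.

End Grid.

(** A bounded real sequence converges along an ultrafilter: compactness gives a cluster point, and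
    the preimage of a ball around it belongs to [U], because its complement cannot. *)
Lemma ultra_cauchy (R : realType) (U : set_system nat) (f : nat -> R) (M e : R) :
  UltraFilter U -> (forall n, `|f n| <= M) -> 0 < e ->
  exists2 A, U A & forall n m, A n -> A m -> `|f n - f m| <= e.
Proof.
move=> uU fM e0; have pU := @ultra_proper _ _ uU.
have FI : (f @ U) `[- M, M]%classic.
  by apply: (@filterS _ U _ setT); [move=> n _; rewrite /= in_itv/= -ler_norml|exact: filterT].
have [l [_ cl]] := @segment_compact R (- M) M (f @ U) _ FI.
have e2 : 0 < e / 2 by rewrite divr_gt0.
have [UB|UB] := in_ultra_setVsetC (f @^-1` ball l (e / 2)) uU.
  exists (f @^-1` ball l (e / 2)) => // n m; rewrite /ball /= /ball_ => h1 h2.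
  have -> : f n - f m = (l - f m) - (l - f n) by ring.
  by rewrite (le_trans (ler_normB _ _))//; lra.
have [x [] ] := cl (~` ball l (e / 2)) (ball l (e / 2)) UB (nbhsx_ballx _ _ e2).
by [].
Qed.

(** The additive form of Cauchy-Schwarz; a small weight [s] makes the share of the fixed factor [a]
    as small as desired. *)
Lemma sqr_le_prod_norm (R : realType) (x a b s : R) : 0 < s -> 0 <= a -> 0 <= b ->
  x ^+ 2 <= a * b -> 2 * `|x| <= s * a + s^-1 * b.
Proof.
move=> s0 a0 b0 xab; have si0 : 0 < s^-1 by rewrite invr_gt0.
have r0 : 0 <= s * a + s^-1 * b by rewrite addr_ge0// mulr_ge0// ltW.
rewrite -(@ler_pXn2r _ 2%N)// ?nnegrE// ?mulr_ge0//.
rewrite exprMn (real_normK (num_real x)).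
apply: (@le_trans _ _ (4 * (a * b))); first by rewrite -natrX ler_wpM2l.
have -> : 4 * (a * b) = 4 * ((s * a) * (s^-1 * b)).
  by field; rewrite gt_eqF.
by have := sqr_ge0 (s * a - s^-1 * b); lra.
Qed.

(** * Continuity of the quadratic forms and density of test functions *)

Section Rayleigh.
Context {R : realType}.
Variable Om : set (R * R).
Hypotheses (oOm : open Om) (bOm : bounded_set Om).
Implicit Types (f g phi : R * R -> R) (F G : bool -> R * R -> R).

Let mOm := measurable_open_plane oOm.
Local Notation ipO := (ip Om).
Local Notation gipO := (gip Om).
Local Notation grad phi := (fun b : bool => 'D_(axis b) phi : R * R -> R).

Lemma ip_near f (e : R) : L2 Om f -> 0 < e ->
  exists2 d : R, 0 < d & forall g, L2 Om g -> ipO (f \- g) (f \- g) < d ->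
    `|ipO g g - ipO f f| < e.
Proof.
move=> f2 e0; have F0 := ip_ge0 Om f.
have D0 : 0 < 2 * (ipO f f + 1) by rewrite mulr_gt0// ltr_wpDl.
(* With this weight the norm of [f] contributes at most [e / 2]. The radius chosen below leaves the
   other [e / 2] to [s^-1 + 1] times the squared distance. *)
pose s := e / (2 * (ipO f f + 1)); have s0 : 0 < s by rewrite divr_gt0.
have si0 : 0 < s^-1 by rewrite invr_gt0.
have sf : s * ipO f f <= e / 2.
  rewrite /s -mulrA [_^-1 * _]mulrC ler_pM2l// ler_pdivrMr//.
  rewrite mulrA mulVf// mul1r; lra.
exists (e / 2 / (s^-1 + 1)); first by rewrite !divr_gt0// addr_gt0.
move=> g g2; have h2 := L2B mOm f2 g2.
rewrite ltr_pdivlMr ?addr_gt0// mulrDr mulr1 => hd.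
have E : ipO g g - ipO f f = ipO (f \- g) (f \- g) - 2 * ipO f (f \- g).
  by rewrite ip_sqrB// ipBr//; ring.
have := sqr_le_prod_norm s0 F0 (ip_ge0 Om (f \- g)) (ip_CS mOm f2 h2).
have := ip_ge0 Om (f \- g); rewrite E; move: hd sf.
move: (ipO (f \- g) (f \- g)) (ipO f f) (ipO f (f \- g)) => x a y hd sf x0 hy.
rewrite (le_lt_trans (ler_normB _ _))// (ger0_norm x0) normrM normr_nat.
move: hd hy; rewrite (mulrC x) => hd hy; lra.
Qed.

Lemma gip_near F (e : R) : (forall b, L2 Om (F b)) -> 0 < e ->
  exists2 d : R, 0 < d & forall G, (forall b, L2 Om (G b)) ->
    gipO (fun b => F b \- G b) (fun b => F b \- G b) < d ->
    `|gipO G G - gipO F F| < e.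
Proof.
move=> F2 e0; have e2 : 0 < e / 2 by rewrite divr_gt0.
have [d1 d10 H1] := ip_near (F2 false) e2.
have [d2 d20 H2] := ip_near (F2 true) e2.
exists (Num.min d1 d2); first by rewrite lt_min d10.
move=> G G2; rewrite /gip lt_min => /andP[h1 h2].
have p1 := ip_ge0 Om (F false \- G false); have p2 := ip_ge0 Om (F true \- G true).
have k1 : `|ipO (G false) (G false) - ipO (F false) (F false)| < e / 2.
  by apply: H1 => //; apply: le_lt_trans h1; rewrite lerDl.
have k2 : `|ipO (G true) (G true) - ipO (F true) (F true)| < e / 2.
  by apply: H2 => //; apply: le_lt_trans h2; rewrite lerDr.
by rewrite opprD addrACA (splitr e) (le_lt_trans (ler_normD _ _))// ltrD.
Qed.

Lemma H10_density_le (m : R) :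
  (forall phi, test_function Om phi -> m * ipO phi phi <= gipO (grad phi) (grad phi)) ->
  forall f F, H10 Om f -> gradient Om f F -> m * ipO f f <= gipO F F.
Proof.
move=> H f F Hf HF; have f2 := H10_L2 Hf; have F2 b := gradient_L2 b HF.
rewrite -subr_le0; apply: (@le0_mul_eps _ _ (`|m| + 1)) => e e0.
have [d1 d10 H1] := ip_near f2 e0; have [d2 d20 H2] := gip_near F2 e0.
have d0 : 0 < Num.min d1 d2 by rewrite lt_min d10.
have [phi tphi] := (H10P oOm bOm f2 HF).1 Hf _ d0.
rewrite /H1sq lt_min => /andP[h1 h2].
have p0 := ip_ge0 Om (f \- phi).
have q0 := gip_ge0 Om (fun b => F b \- 'D_(axis b) phi).
have k1 : `|ipO phi phi - ipO f f| < e.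
  by apply: H1; [exact: test_L2|apply: le_lt_trans h1; rewrite lerDl].
have k2 : `|gipO (grad phi) (grad phi) - gipO F F| < e.
  by apply: H2; [move=> b; exact: test_partial_L2|apply: le_lt_trans h2; rewrite lerDr].
have := H _ tphi; move: k1 k2.
move: (ipO phi phi) (ipO f f) (gipO (grad phi) (grad phi)) (gipO F F) => a b c d.
move=> k1 k2 h3.
have k3 : m * (b - a) <= `|m| * e.
  by rewrite (le_trans (ler_norm _))// normrM ler_wpM2l// distrC ltW.
have k4 : c - d <= e by rewrite (le_trans (ler_norm _))// ltW.
by rewrite mulrDl mul1r; move: k3; rewrite mulrBr; lra.
Qed.

End Rayleigh.

Lemma le_4_of_parts (R : realType) (g a b M : R) :
  g <= 2 * a + 2 * b -> a <= M -> b <= M -> g <= 4 * M.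
Proof. lra. Qed.

Lemma le_of_double (R : realType) (x a b M : R) : 0 <= x ->
  a <= M -> 0 <= b -> 2 * x <= a + b -> x <= M + b.
Proof. lra. Qed.

Lemma small_coeff (R : realType) (e M : R) : 0 < e -> 0 <= M ->
  e / (8 * (M + 1)) * (4 * M) <= e / 2.
Proof.
by move=> e0 M0; rewrite mulrAC ler_pdivrMr ?mulr_gt0 ?ltr_wpDl//; nra.
Qed.

Lemma half_coeff (R : realType) (e S : R) : 0 < e -> 0 <= S ->
  S * (e / (2 * (S + 1))) <= e / 2.
Proof.
by move=> e0 S0; rewrite mulrA ler_pdivrMr ?mulr_gt0 ?ltr_wpDl//; nra.
Qed.

(** * Extraction of limits in the closure of the test functions *)

Section Minimizer.
Context {R : realType}.
Variable Om : set (R * R).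
Hypotheses (oOm : open Om) (bOm : bounded_set Om).
Implicit Types (f g phi psi : R * R -> R) (F G : bool -> R * R -> R).

Let mOm := measurable_open_plane oOm.
Local Notation ipO := (ip Om).
Local Notation gipO := (gip Om).
Local Notation grad phi := (fun b : bool => 'D_(axis b) phi : R * R -> R).

Lemma grad_testB phi psi : test_function Om phi -> test_function Om psi ->
  grad (fun p => phi p - psi p) = (fun b => 'D_(axis b) phi \- 'D_(axis b) psi).
Proof.
move=> tp ts; apply/funext => b; apply/funext => p.
by have [_ ->] := is_deriveBf (smooth_is_derive b p tp.1) (smooth_is_derive b p ts.1).
Qed.

Lemma grad_testD phi psi : test_function Om phi -> test_function Om psi ->
  grad (fun p => phi p + psi p) = (fun b => 'D_(axis b) phi \+ 'D_(axis b) psi).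
Proof.
move=> tp ts; apply/funext => b; apply/funext => p.
by have [_ ->] := is_deriveDf (smooth_is_derive b p tp.1) (smooth_is_derive b p ts.1).
Qed.

Lemma grad_testZ a phi : test_function Om phi ->
  grad (fun p => a * phi p) = (fun b p => a * 'D_(axis b) phi p).
Proof.
move=> tp; apply/funext => b; apply/funext => p.
by have [_ ->] := is_deriveZf a (smooth_is_derive b p tp.1).
Qed.

Lemma gip_sqrB_le F G : (forall b, L2 Om (F b)) -> (forall b, L2 Om (G b)) ->
  gipO (fun b => F b \- G b) (fun b => F b \- G b) <= 2 * gipO F F + 2 * gipO G G.
Proof.
move=> F2 G2; have h1 := ip_sqrB_le mOm (F2 false) (G2 false).
have h2 := ip_sqrB_le mOm (F2 true) (G2 true).
rewrite /gip !mulrDr addrACA; exact: lerD.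
Qed.

(* An ultrafilter on the indices replaces the extraction of subsequences. *)
Lemma bounded_test_ultra (v : nat -> R * R -> R) (M e : R) U :
  UltraFilter U -> (forall n, test_function Om (v n)) ->
  (forall n, ipO (v n) (v n) <= M) ->
  (forall n, gipO (grad (v n)) (grad (v n)) <= M) -> 0 < e ->
  exists2 A, U A & forall n m, A n -> A m -> ipO (v n \- v m) (v n \- v m) <= e.
Proof.
move=> uU tv vM gM e0; have pU := @ultra_proper _ _ uU.
have M0 : 0 <= M := le_trans (ip_ge0 Om (v 0%N)) (vM 0%N).
(* The squared gradient of a difference is at most [4 * M], so this coefficient keeps its
   contribution below [e / 2]. *)
have e1 : 0 < e / (8 * (M + 1)) by rewrite divr_gt0// mulr_gt0// ltr_wpDl.
have [N [chi [C [C0 chi2 H]]]] := test_compactness oOm bOm e1.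
have v2 n := test_L2 oOm bOm (tv n).
have Dv2 n b := test_partial_L2 oOm bOm b (tv n).
pose S : R := C * (N%:R * N%:R).
have S0 : 0 <= S by rewrite !mulr_ge0.
(* Each of the [N * N] cell averages contributes at most [d ^+ 2], and the minimum with 1 gives
   [d ^+ 2 <= d]; hence a total of at most [S * d <= e / 2]. *)
pose d := Num.min 1 (e / (2 * (S + 1))).
have d0 : 0 < d by rewrite lt_min ltr01/= divr_gt0// mulr_gt0// ltr_wpDl.
have /choice[A HA] : forall ij : nat * nat, exists A : set nat, U A /\
    forall n m, A n -> A m -> `|ipO (v n) (chi ij.1 ij.2) - ipO (v m) (chi ij.1 ij.2)| <= d.
  move=> [i j] /=.
  have [|A UA hA] := @ultra_cauchy R U (fun n => ipO (v n) (chi i j))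
      (M + ipO (chi i j) (chi i j)) d uU _ d0; last by exists A.
  move=> n; have := sqr_le_prod_norm (@ltr01 R) (ip_ge0 Om (v n)) (ip_ge0 Om (chi i j))
    (ip_CS mOm (v2 n) (chi2 i j)).
  rewrite invr1 !mul1r => h; apply: le_of_double (vM n) (ip_ge0 Om (chi i j)) h.
  exact: normr_ge0.
exists [set n | forall ij : 'I_N * 'I_N, A (val ij.1, val ij.2) n].
  by apply: filter_forall => ij; case: (HA (val ij.1, val ij.2)).
move=> n m An Am.
have := H _ (testB (tv n) (tv m)); rewrite (grad_testB (tv n) (tv m)).
have hg := gip_sqrB_le (Dv2 n) (Dv2 m).
have hs : \sum_(i < N) \sum_(j < N) ipO (fun p => v n p - v m p) (chi i j) ^+ 2
    <= N%:R * N%:R * d.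
  apply: (@le_trans _ _ (\sum_(i < N) \sum_(j < N) d)); last first.
    by rewrite !sumr_const card_ord -[X in X *+ N]mulr_natr -[leLHS]mulr_natr -mulrA mulrC.
  apply: ler_sum => i _; apply: ler_sum => j _.
  have [_ /(_ n m (An (i, j)) (Am (i, j)))] := HA (val i, val j).
  rewrite -ipBl// => hd; rewrite -(real_normK (num_real _)).
  have dd : d ^+ 2 <= d by rewrite expr2 ler_piMl// ?(ltW d0)// /d ge_min lexx.
  by apply: le_trans dd; rewrite lerXn2r ?nnegrE// ltW.
move=> h; apply: (le_trans h).
have k1 : e / (8 * (M + 1)) * gipO (fun b => 'D_(axis b) (v n) \- 'D_(axis b) (v m))
    (fun b => 'D_(axis b) (v n) \- 'D_(axis b) (v m)) <= e / 2.
  apply: (@le_trans _ _ (e / (8 * (M + 1)) * (4 * M))).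
    apply: ler_wpM2l; first exact: ltW.
    exact: (le_4_of_parts hg (gM n) (gM m)).
  exact: small_coeff.
have k2 : C * (\sum_(i < N) \sum_(j < N) ipO (fun p => v n p - v m p) (chi i j) ^+ 2) <= e / 2.
  apply: (@le_trans _ _ (S * d)); first by rewrite /S -mulrA ler_wpM2l.
  apply: (@le_trans _ _ (S * (e / (2 * (S + 1))))).
    by rewrite ler_wpM2l// /d ge_min lexx orbT.
  exact: half_coeff.
by rewrite [leRHS]splitr; exact: lerD k1 k2.
Qed.

(** The functions and both partials converge separately in L^2, and the weak derivative identity is
    continuous under such limits. The factor 3 counts these three L^2 errors. *)
Lemma H10_complete (w : nat -> R * R -> R) : (forall n, test_function Om (w n)) ->
  (forall k l, (k <= l)%N -> H1sq Om (w l \- w k)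
     (fun b => 'D_(axis b) (w l) \- 'D_(axis b) (w k)) <= 4^-1 ^+ k) ->
  exists f F, [/\ H10 Om f, gradient Om f F & forall k,
    H1sq Om (f \- w k) (fun b => F b \- 'D_(axis b) (w k)) <= 3 * 4^-1 ^+ k].
Proof.
move=> tw wC; have w2 n := test_L2 oOm bOm (tw n).
have Dw2 b n := test_partial_L2 oOm bOm b (tw n).
have [f f2 fC] : exists2 f, L2 Om f & forall n, ipO (f \- w n) (f \- w n) <= 4^-1 ^+ n.
  apply: (L2_complete oOm bOm w2) => n m nm; apply: le_trans (wC n m nm).
  by rewrite lerDl gip_ge0.
have /choice[F HF] : forall b : bool, exists F : R * R -> R, L2 Om F /\
    forall n, ipO (F \- 'D_(axis b) (w n)) (F \- 'D_(axis b) (w n)) <= 4^-1 ^+ n.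
  move=> b; have [|F F2 HF] := L2_complete oOm bOm (Dw2 b); last by exists F.
  move=> n m nm; apply: le_trans (wC n m nm); rewrite /H1sq /gip.
  case: b; first by rewrite addrA lerDr addr_ge0// ip_ge0.
  by rewrite addrCA lerDl addr_ge0// ip_ge0.
have hsq k : H1sq Om (f \- w k) (fun b => F b \- 'D_(axis b) (w k)) <= 3 * 4^-1 ^+ k.
  have -> : 3 * 4^-1 ^+ k = 4^-1 ^+ k + (4^-1 ^+ k + 4^-1 ^+ k) :> R by ring.
  by rewrite /H1sq /gip lerD ?lerD ?fC// ?(HF _).2.
have small (e : R) : 0 < e -> exists k, 4^-1 ^+ k <= e.
  move=> e0; have : (4^-1 : R) ^+ k @[k --> \oo] --> (0 : R).
    by apply: cvg_expr; rewrite ger0_norm ?invr_ge0// invf_lt1// ltr1n.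
  move=> /cvgrPdist_le/(_ e e0)[k _ /(_ k (leqnn _))]; rewrite sub0r normrN => h.
  by exists k; rewrite (le_trans _ h)// ler_norm.
have gF : gradient Om f F.
  move=> b; have [F2 _] := HF b; split => // psi tpsi.
  have p2 := test_L2 oOm bOm tpsi; have dp2 := test_partial_L2 oOm bOm b tpsi.
  rewrite -[LHS]/(ipO f ('D_(axis b) psi)) -[X in - X]/(ipO (F b) psi).
  apply/eqP; rewrite -addr_eq0 -sqrf_eq0 eq_le sqr_ge0 andbT.
  apply: (@le0_mul_eps _ _ (2 * ipO ('D_(axis b) psi) ('D_(axis b) psi) + 2 * ipO psi psi)) => e e0.
  have [k ke] := small e e0.
  have [_ wp] := test_weak_partial oOm bOm b (tw k).
  have -> : ipO f ('D_(axis b) psi) + ipO (F b) psi =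
      ipO (f \- w k) ('D_(axis b) psi) + ipO (F b \- 'D_(axis b) (w k)) psi.
    rewrite (ipBl mOm f2 (w2 k) dp2) (ipBl mOm F2 (Dw2 b k) p2).
    have -> : ipO (w k) ('D_(axis b) psi) = - ipO ('D_(axis b) (w k)) psi by exact: wp.
    by rewrite opprK addrACA subrr addr0.
  have C1 := ip_CS mOm (L2B mOm f2 (w2 k)) dp2.
  have C2 := ip_CS mOm (L2B mOm F2 (Dw2 b k)) p2.
  have k1 := ler_wpM2r (ip_ge0 Om ('D_(axis b) psi)) (le_trans (fC k) ke).
  have k2 := ler_wpM2r (ip_ge0 Om psi) (le_trans ((HF b).2 k) ke).
  move: (le_trans C1 k1) (le_trans C2 k2).
  move: (ipO (f \- w k) ('D_(axis b) psi)) (ipO (F b \- 'D_(axis b) (w k)) psi) => x y.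
  move: (ipO _ _) (ipO _ _) => X Y h1 h2.
  by have := sqr_ge0 (x - y); rewrite sqrrB sqrrD; lra.
exists f, F; split => //.
apply: (H10_closed oOm bOm f2 gF) => e e0.
have [k ke] := small (e / 4) (divr_gt0 e0 (ltr0n _ 4)).
exists (w k), (grad (w k)); split; [exact: test_H10|exact: gradient_test|].
apply: (le_lt_trans (hsq k)); move: ke; lra.
Qed.

End Minimizer.

(** * Poincaré's inequality with the first eigenvalue *)

Lemma parallelogram_le (R : realType) (m s t gs gt gn gm e : R) :
  m * s <= gs -> s + t = 4 -> gs + gt = 2 * gn + 2 * gm ->
  gn < m + e -> gm < m + e -> gt <= 4 * e + m * t.
Proof.
move=> h1 h2 h3 h4 h5; have -> : t = 4 - s by lra.
rewrite mulrBr; lra.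
Qed.

Lemma inv_succ_small (R : realType) (e : R) : 0 < e -> exists n : nat, n.+1%:R^-1 <= e.
Proof.
move=> e0; exists (Num.truncn e^-1).
have h : e^-1 < (Num.truncn e^-1).+1%:R by exact: truncnS_gt.
by rewrite -[leRHS]invrK lef_pV2 ?posrE ?ltr0n ?invr_gt0// ltW.
Qed.

Lemma quad_combine (R : realType) (m a b c d x y t : R) : a <= m * b ->
  m * (b + 2 * t * d + t ^+ 2 * y) <= a + 2 * t * c + t ^+ 2 * x ->
  0 <= 2 * t * (c - m * d) + t ^+ 2 * (x - m * y).
Proof. lra. Qed.

Lemma three_quarters (R : realType) (d x : R) : 0 < d -> x <= d / 4 -> 3 * x < d.
Proof. lra. Qed.

Lemma near_bound (R : realType) (g gf m k e : R) :
  g < m + k -> k <= e -> `|g - gf| < e -> gf < m + 2 * e.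
Proof. by move=> h1 h2; rewrite ltr_distl => /andP[h3 _]; lra. Qed.

Lemma near_min (R : realType) (a b m e : R) : 0 <= m ->
  `|1 - b| < e -> a < m + 2 * e -> a - m * b <= (2 + m) * e.
Proof.
move=> m0; rewrite ltr_distl => /andP[_ h1] h2.
by have : m * (b + e) >= m * 1; [apply: ler_wpM2l => //; lra|lra].
Qed.

Section Poincare.
Context {R : realType}.
Variable Om : set (R * R).
Hypotheses (oOm : open Om) (bOm : bounded_set Om).
Implicit Types (f g phi psi : R * R -> R) (F G : bool -> R * R -> R).

Let mOm := measurable_open_plane oOm.
Local Notation ipO := (ip Om).
Local Notation gipO := (gip Om).
Local Notation grad phi := (fun b : bool => 'D_(axis b) phi : R * R -> R).

Lemma ip_parallelogram f g : L2 Om f -> L2 Om g ->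
  ipO (f \+ g) (f \+ g) + ipO (f \- g) (f \- g) = 2 * ipO f f + 2 * ipO g g.
Proof. by move=> f2 g2; rewrite ip_sqrD// ip_sqrB//; ring. Qed.

Lemma gip_parallelogram F G : (forall b, L2 Om (F b)) -> (forall b, L2 Om (G b)) ->
  gipO (fun b => F b \+ G b) (fun b => F b \+ G b) +
  gipO (fun b => F b \- G b) (fun b => F b \- G b) = 2 * gipO F F + 2 * gipO G G.
Proof.
move=> F2 G2; rewrite /gip !mulrDr.
by rewrite addrACA (ip_parallelogram (F2 _) (G2 _)) (ip_parallelogram (F2 _) (G2 _)) addrACA.
Qed.

Lemma gipZ a F : (forall b, L2 Om (F b)) ->
  gipO (fun b p => a * F b p) (fun b p => a * F b p) = a ^+ 2 * gipO F F.
Proof.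
by move=> F2; rewrite /gip !ipZl ?ipZr//; try exact: L2Z; ring.
Qed.

Lemma gipDZ a F G : (forall b, L2 Om (F b)) -> (forall b, L2 Om (G b)) ->
  gipO (fun b => F b \+ (fun p => a * G b p)) (fun b => F b \+ (fun p => a * G b p)) =
  gipO F F + 2 * a * gipO F G + a ^+ 2 * gipO G G.
Proof.
move=> F2 G2; have aG2 b := L2Z mOm a (G2 b).
by rewrite /gip !ip_sqrD// !ipZl// !ipZr//; ring.
Qed.

Lemma ipDZ a f g : L2 Om f -> L2 Om g ->
  ipO (f \+ (fun p => a * g p)) (f \+ (fun p => a * g p)) =
  ipO f f + 2 * a * ipO f g + a ^+ 2 * ipO g g.
Proof.
move=> f2 g2; have ag2 := L2Z mOm a g2.
by rewrite ip_sqrD// ipZl// !ipZr//; ring.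
Qed.

Definition rayleigh : set R :=
  [set x | exists2 phi, test_function Om phi &
    ipO phi phi = 1 /\ x = gipO (grad phi) (grad phi)].

Lemma rayleigh_lbound : has_lbound rayleigh.
Proof. by exists 0 => _ [phi _ [_ ->]]; exact: gip_ge0. Qed.

Lemma rayleigh_le phi : test_function Om phi ->
  inf rayleigh * ipO phi phi <= gipO (grad phi) (grad phi).
Proof.
move=> tphi; have p2 := test_L2 oOm bOm tphi.
have [->|n0] := eqVneq (ipO phi phi) 0; first by rewrite mulr0 gip_ge0.
have p0 : 0 < ipO phi phi by rewrite lt_def n0 ip_ge0.
have s0 : 0 < Num.sqrt (ipO phi phi) by rewrite sqrtr_gt0.
rewrite -ler_pdivlMr//.
have -> : gipO (grad phi) (grad phi) / ipO phi phi =
    (Num.sqrt (ipO phi phi))^-1 ^+ 2 * gipO (grad phi) (grad phi).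
  by rewrite exprVn sqr_sqrtr ?ip_ge0// mulrC.
apply: ge_inf; first exact: rayleigh_lbound.
exists (fun p => (Num.sqrt (ipO phi phi))^-1 * phi p); first exact: testZ.
split.
  by rewrite ipZl// ?ipZr//; [|exact: L2Z]; rewrite mulrA -expr2 exprVn sqr_sqrtr ?mulVf// ltW.
by rewrite (grad_testZ _ tphi) gipZ// => b; exact: test_partial_L2.
Qed.

Lemma inf_rayleigh_ge0 : rayleigh !=set0 -> 0 <= inf rayleigh.
Proof. by move=> r0; apply: lb_le_inf => // _ [phi _ [_ ->]]; exact: gip_ge0. Qed.

(** For two normalized near-minimizers the squared norms of sum and difference add up to 4. Bounding
    the gradient of the sum from below by the Rayleigh infimum, the parallelogram law bounds the
    gradient of the difference by the L^2 norm of the difference and the defects. Closeness in L^2,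
    which compactness provides, thus implies closeness in H^1. *)
Lemma minimizing_subsequence : rayleigh !=set0 ->
  exists w : nat -> R * R -> R,
  [/\ forall n, test_function Om (w n), forall n, ipO (w n) (w n) = 1,
      forall n, gipO (grad (w n)) (grad (w n)) < inf rayleigh + n.+1%:R^-1 &
      forall k l, (k <= l)%N -> H1sq Om (w l \- w k)
        (fun b => 'D_(axis b) (w l) \- 'D_(axis b) (w k)) <= 4^-1 ^+ k].
Proof.
move=> r0; set mu := inf rayleigh; have mu0 : 0 <= mu by exact: inf_rayleigh_ge0.
have /choice[v Hv] : forall n : nat, exists phi, [/\ test_function Om phi,
    ipO phi phi = 1 & gipO (grad phi) (grad phi) < mu + n.+1%:R^-1].
  move=> n; have n0 : 0 < n.+1%:R^-1 :> R by rewrite invr_gt0 ltr0n.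
  have [_ [phi tphi [p1 ->]] h] := inf_adherent n0 (conj r0 rayleigh_lbound).
  by exists phi.
have tv n : test_function Om (v n) by case: (Hv n).
have v1 n : ipO (v n) (v n) = 1 by case: (Hv n).
have gv n : gipO (grad (v n)) (grad (v n)) < mu + n.+1%:R^-1 by case: (Hv n).
have v2 n := test_L2 oOm bOm (tv n).
have Dv2 n b := test_partial_L2 oOm bOm b (tv n).
have [U [uU oU]] := @ultraFilterLemma _ (@eventually) eventually_filter.
have pU := @ultra_proper _ _ uU.
have cau (e : R) (K : nat) : 0 < e -> exists A : set nat, [/\ U A,
    forall n, A n -> (K <= n)%N & forall n m, A n -> A m ->
    H1sq Om (v n \- v m) (fun b => 'D_(axis b) (v n) \- 'D_(axis b) (v m)) <= e].
  (* The four defects use up [e / 2]. The L^2 distance enters with the total weight [mu + 1], so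
     [e / (2 * (mu + 1))] below uses up the other half. *)
  move=> e0; have e8 : 0 < e / 8 by rewrite divr_gt0.
  have [k ke] := inv_succ_small e8.
  have e2 : 0 < e / (2 * (mu + 1)) by rewrite divr_gt0// mulr_gt0// ltr_wpDl.
  have vM n : ipO (v n) (v n) <= mu + 1 by rewrite v1 lerDr.
  have gM n : gipO (grad (v n)) (grad (v n)) <= mu + 1.
    by rewrite (le_trans (ltW (gv n)))// lerD2l invf_le1// ler1n.
  have [A UA HA] := bounded_test_ultra oOm bOm uU tv vM gM e2.
  exists (A `&` [set n | (maxn K k <= n)%N]); split.
  - by apply: filterI => //; apply: oU; exact: nbhs_infty_ge.
  - by move=> n [_ /=]; rewrite geq_max => /andP[].
  move=> n m [An /=]; rewrite geq_max => /andP[_ kn] [Am /=].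
  rewrite geq_max => /andP[_ km].
  have small j : (k <= j)%N -> mu + j.+1%:R^-1 <= mu + e / 8.
    move=> kj; rewrite lerD2l (le_trans _ ke)// lef_pV2 ?posrE ?ltr0n//.
    by rewrite ler_nat.
  have h1 := rayleigh_le (testD (tv n) (tv m)).
  rewrite (grad_testD (tv n) (tv m)) in h1.
  have h2 := ip_parallelogram (v2 n) (v2 m); rewrite !v1 mulr1 in h2.
  have h2' : ipO (v n \+ v m) (v n \+ v m) + ipO (v n \- v m) (v n \- v m) = 4.
    by rewrite h2; ring.
  have h3 := gip_parallelogram (Dv2 n) (Dv2 m).
  have h4 := parallelogram_le h1 h2' h3 (lt_le_trans (gv n) (small _ kn))
    (lt_le_trans (gv m) (small _ km)).
  have h5 := HA n m An Am.
  rewrite /H1sq; apply: (le_trans (lerD h5 h4)).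
  have h6 : mu * ipO (v n \- v m) (v n \- v m) <= mu * (e / (2 * (mu + 1))).
    exact: ler_wpM2l.
  apply: (@le_trans _ _ (e / (2 * (mu + 1)) + (4 * (e / 8) + mu * (e / (2 * (mu + 1)))))).
    by rewrite lerD2l lerD2l.
  rewrite le_eqVlt; apply/orP; left; apply/eqP; field.
  by rewrite gt_eqF// ltr_wpDl.
have /choice[A HA] : forall k : nat, exists A : set nat, [/\ U A,
    forall n, A n -> (k <= n)%N & forall n m, A n -> A m ->
    H1sq Om (v n \- v m) (fun b => 'D_(axis b) (v n) \- 'D_(axis b) (v m)) <= 4^-1 ^+ k].
  by move=> k; apply: cau; rewrite exprn_gt0.
(* Finite intersections of members of [U] are nonempty. This yields a diagonal sequence whose terms
   from the index [k] on all belong to [A k]. *)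
have /choice[s Hs] : forall k : nat, exists n : nat, forall j : 'I_k.+1, A j n.
  move=> k; have : U [set n | forall j : 'I_k.+1, A j n].
    by apply: filter_forall => j; case: (HA j).
  by move/filter_ex.
have AS j k : (j <= k)%N -> A j (s k).
  by move=> jk; have jk1 : (j < k.+1)%N by []; exact: (Hs k (Ordinal jk1)).
exists (v \o s); split => [n|n|n|k l kl] /=; first exact: tv.
- exact: v1.
- apply: (lt_le_trans (gv (s n))); rewrite lerD2l lef_pV2 ?posrE ?ltr0n// ler_nat ltnS.
  by have [_ h _] := HA n; apply: h; exact: AS.
- by have [_ _ h] := HA k; apply: h; exact: AS.
Qed.

(* Perturbing a minimizer of the Rayleigh quotient gives the weak eigenvalue equation. *)
Lemma rayleigh_min_eigenvalue : rayleigh !=set0 -> eigenvalue_dirichlet Om (inf rayleigh).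
Proof.
move=> r0; set mu := inf rayleigh; have mu0 : 0 <= mu by exact: inf_rayleigh_ge0.
have [w [tw w1 gw wC]] := minimizing_subsequence r0.
have w2 n := test_L2 oOm bOm (tw n).
have Dw2 n b := test_partial_L2 oOm bOm b (tw n).
have [f [F [Hf gF hF]]] := H10_complete oOm bOm tw wC.
have f2 := H10_L2 Hf; have F2 b := gradient_L2 b gF.
have q_ge0 g G : H10 Om g -> gradient Om g G -> mu * ipO g g <= gipO G G.
  by apply: H10_density_le => // phi; exact: rayleigh_le.
have near (e : R) : 0 < e -> `|1 - ipO f f| < e /\ gipO F F < mu + 2 * e.
  move=> e0; have [d1 d10 H1] := ip_near oOm f2 e0.
  have [d2 d20 H2] := gip_near oOm F2 e0.
  have m0 : 0 < Num.min e (Num.min d1 d2 / 4) by rewrite lt_min e0 divr_gt0// lt_min d10.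
  have [k] := inv_succ_small m0; rewrite le_min => /andP[ke kd].
  have h : H1sq Om (f \- w k) (fun b => F b \- 'D_(axis b) (w k)) < Num.min d1 d2.
    apply: (le_lt_trans (hF k)).
    have k4 : 4^-1 ^+ k <= k.+1%:R^-1 :> R.
      rewrite exprVn lef_pV2 ?posrE ?exprn_gt0 ?ltr0n// -natrX ler_nat.
      by rewrite ltn_expl.
    apply: three_quarters (le_trans k4 kd); by rewrite lt_min d10.
  move: h; rewrite lt_min => /andP[h1 h2].
  have k1 : `|ipO (w k) (w k) - ipO f f| < e.
    by apply: H1 => //; apply: le_lt_trans h1; rewrite lerDl gip_ge0.
  have k2 : `|gipO (grad (w k)) (grad (w k)) - gipO F F| < e.
    by apply: H2 => //; apply: le_lt_trans h2; rewrite lerDr ip_ge0.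
  split; first by rewrite -(w1 k).
  exact: near_bound (gw k) ke k2.
have qf : gipO F F <= mu * ipO f f.
  rewrite -subr_le0; apply: (@le0_mul_eps _ _ (2 + mu)) => e e0.
  have [h1 h2] := near e e0; exact: near_min.
have fn0 : ipO f f != 0.
  apply/eqP => f0; have [+ _] := near 1 ltr01.
  by rewrite f0 subr0 normr1 ltxx.
exists f; split; [by []|by rewrite L2sqE|].
move=> psi Hpsi; have p2 := H10_L2 Hpsi; have gP := H10_gradient Hpsi.
have P2 b := gradient_L2 b gP.
rewrite (grad_innerE oOm bOm gF gP) -[X in mu * X]/(ipO f psi).
set G := (fun b => wD Om b psi).
apply/eqP; rewrite -subr_eq0 -sqrf_eq0 eq_le sqr_ge0 andbT.
have q2 := q_ge0 _ _ Hpsi gP.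
(* The form [gip - mu * ip] is nonnegative on H^1_0 and vanishes at the minimizer [f]. A nonnegative
   quadratic polynomial with zero constant term has zero linear coefficient, which is the weak
   equation tested with [psi]. *)
have := @discriminant_le0 R 0 (gipO F G - mu * ipO f psi) (gipO G G - mu * ipO psi psi).
rewrite mul0r; apply; first by rewrite subr_ge0.
move=> t; rewrite add0r.
have := q_ge0 _ _ (H10D oOm bOm Hf (H10Z oOm bOm t Hpsi))
  (gradientD oOm bOm f2 (L2Z mOm t p2) gF (gradientZ oOm bOm t p2 gP)).
rewrite (ipDZ t f2 p2) (gipDZ t F2 P2) -/G.
exact: quad_combine.
Qed.

(** The infimum of the Rayleigh quotients is attained, hence an eigenvalue, and the minimality of
    [lam] puts it above [lam]. The set of quotients is nonempty because [phi] itself can be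
    normalized. *)
Theorem poincare lam f F : first_eigenvalue Om lam -> H10 Om f -> gradient Om f F ->
  lam * ipO f f <= gipO F F.
Proof.
move=> [[phi0 [Hphi0 n0 _]] lam_min]; apply: H10_density_le => // phi tphi.
have [->|p0] := eqVneq (ipO phi phi) 0; first by rewrite mulr0 gip_ge0.
apply: le_trans (rayleigh_le tphi); rewrite ler_wpM2r ?ip_ge0//.
apply/lam_min/rayleigh_min_eigenvalue.
have p2 := test_L2 oOm bOm tphi.
exists (gipO (grad (fun p => (Num.sqrt (ipO phi phi))^-1 * phi p))
  (grad (fun p => (Num.sqrt (ipO phi phi))^-1 * phi p))).
exists (fun p => (Num.sqrt (ipO phi phi))^-1 * phi p); first exact: testZ.
split => //; rewrite ipZl// ?ipZr//; last exact: L2Z.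
by rewrite mulrA -expr2 exprVn sqr_sqrtr ?ip_ge0// mulVf.
Qed.

End Poincare.

(** * The volume functional on classical fields *)

Section MeanValue.
Context {R : realType}.
Implicit Types (f df : R -> R).

Lemma mean_value f df (x y : R) :
  (forall z, Num.min x y <= z <= Num.max x y -> is_derive z 1 f (df z)) ->
  exists2 c, Num.min x y <= c <= Num.max x y & f x - f y = df c * (x - y).
Proof.
wlog yx : x y / y <= x => [H D|].
  have [yx|] := boolP (y <= x); first exact: (H x y yx D).
  rewrite -ltNge => /ltW xy.
  have [|c hc e] := H y x xy; first by move=> z; rewrite minC maxC; exact: D.
  by exists c; [rewrite minC maxC|rewrite -opprB e -mulrN opprB].
rewrite (min_idPr yx) (max_idPl yx) => D.
have cf : {within `[y, x], continuous f}.
  apply: continuous_in_subspaceT => z; rewrite inE /= in_itv/= => /D[dz _].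
  exact/differentiable_continuous/derivable1_diffP.
have D' z : z \in `]y, x[ -> is_derive z 1 f (df z).
  by rewrite in_itv/= => /andP[/ltW yz /ltW zx]; apply: D; rewrite yz.
have [c] := MVT_segment yx D' cf.
by rewrite in_itv/= => hc e; exists c.
Qed.

Lemma lipschitz_derive f df (L : R) : (forall x : R, is_derive x 1 f (df x)) ->
  (forall x, `|df x| <= L) -> forall x y, `|f x - f y| <= L * `|x - y|.
Proof.
move=> D dL x y; have [c _ ->] := @mean_value f df x y (fun z _ => D z).
by rewrite normrM ler_wpM2r.
Qed.

Lemma sin_lip (x y : R) : `|sin x - sin y| <= `|x - y|.
Proof.
rewrite -[leRHS]mul1r; apply: lipschitz_derive => z.
by rewrite ler_norml cos_geN1 cos_le1.
Qed.

Lemma cos_lip (x y : R) : `|cos x - cos y| <= `|x - y|.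
Proof.
rewrite -[leRHS]mul1r; apply: (lipschitz_derive (df := fun z => - sin z)) => z.
by rewrite normrN sin_max.
Qed.

Lemma one_sub_cos_le (x : R) : `|1 - cos x| <= x ^+ 2.
Proof.
have -> : 1 - cos x = 2 * sin (x / 2) ^+ 2.
  have {1}-> : x = (x / 2) *+ 2 by rewrite -mulr_natr; field.
  by rewrite cos_mulr2n cos2sin2 -mulr_natr; ring.
have h : `|sin (x / 2)| <= `|x / 2| by have := sin_lip (x / 2) 0; rewrite sin0 !subr0.
rewrite normrM normr_nat normrX.
apply: (@le_trans _ _ (2 * `|x / 2| ^+ 2)); first by rewrite ler_wpM2l// lerXn2r ?nnegrE.
by rewrite -normrX ger0_norm ?sqr_ge0// expr_div_n; have := sqr_ge0 x; lra.
Qed.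

Lemma sin_sub_le (x : R) : `|sin x - x| <= `|x| ^+ 3.
Proof.
have D (z : R) : is_derive z 1 (fun x => sin x - x) (cos z - 1).
  exact: (is_deriveBf (is_derive_sin z) (is_derive_id z (1 : R))).
have [c hc] := @mean_value _ _ x 0 (fun z _ => D z).
rewrite sin0 !subr0 => ->; rewrite normrM exprSr ler_wpM2r//.
rewrite distrC (le_trans (one_sub_cos_le c))// -(real_normK (num_real c)).
rewrite lerXn2r ?nnegrE//; move: hc; have [x0|] := boolP (0 <= x).
  rewrite (min_idPr x0) (max_idPl x0) (ger0_norm x0) => /andP[c0 cx].
  by rewrite ger0_norm.
rewrite -ltNge => x0; rewrite (min_idPl (ltW x0)) (max_idPr (ltW x0)) (ltr0_norm x0).
by move=> /andP[xc c0]; rewrite ler0_norm// lerN2.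
Qed.

End MeanValue.

(** * The scalar triple product and its perturbation *)

Section Triple.
Context {R : realType}.

Definition o0 : 'I_3 := ord0.
Definition o1 : 'I_3 := inord 1.
Definition o2 : 'I_3 := inord 2.

Definition triple (a b c : 'I_3 -> R) : R :=
  a o0 * (b o1 * c o2 - b o2 * c o1) + a o1 * (b o2 * c o0 - b o0 * c o2) +
  a o2 * (b o0 * c o1 - b o1 * c o0).

Lemma sum3 (F : 'I_3 -> R) : \sum_(i < 3) F i = F o0 + F o1 + F o2.
Proof.
rewrite !big_ord_recl big_ord0 addr0 addrA; congr (_ + _ + _); congr F; apply/val_inj => /=.
  by rewrite inordK.
by rewrite inordK.
Qed.

Lemma ord3_add : [/\ o0 + 1 = o1, o0 + 2 = o2, o1 + 1 = o2 & o1 + 2 = o0] /\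
  (o2 + 1 = o0 /\ o2 + 2 = o1).
Proof. by split; [split|split]; apply/val_inj; rewrite /= ?inordK. Qed.

Lemma wedgeE (b c : 'rV[R]_3) : [/\ wedge b c 0 o0 = b 0 o1 * c 0 o2 - b 0 o2 * c 0 o1,
  wedge b c 0 o1 = b 0 o2 * c 0 o0 - b 0 o0 * c 0 o2 &
  wedge b c 0 o2 = b 0 o0 * c 0 o1 - b 0 o1 * c 0 o0].
Proof.
have [[e1 e2 e3 e4] [e5 e6]] := ord3_add.
by split; rewrite /wedge mxE ?e1 ?e2 ?e3 ?e4 ?e5 ?e6.
Qed.

Lemma dot_wedge (a b c : 'rV[R]_3) :
  dot a (wedge b c) = triple (a 0) (b 0) (c 0).
Proof.
rewrite /dot sum3; have [-> -> ->] := wedgeE b c.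
by [].
Qed.

(** Two bounds on [x] are kept: [m] will be small only in L^2, [B] holds uniformly. Spending [B]
    once on [x * y * z] makes the estimate quadratic instead of cubic in [m], hence integrable. *)
Lemma prod3_perturb (a b c x y z M B m : R) : 0 <= M -> 0 <= m -> 0 <= B ->
  `|a| <= M -> `|b| <= M -> `|c| <= M -> `|x| <= B -> `|x| <= m -> `|y| <= m -> `|z| <= m ->
  `|(a + x) * (b + y) * (c + z) - a * b * c| <= 3 * M ^+ 2 * m + (3 * M + B) * m ^+ 2.
Proof.
move=> M0 m0 B0 ha hb hc hxB hx hy hz.
have P (p q r P Q S : R) : `|p| <= P -> `|q| <= Q -> `|r| <= S -> 0 <= P -> 0 <= Q ->
    `|p * q * r| <= P * Q * S.
  by move=> hp hq hr P0 Q0; rewrite !normrM ler_pM ?mulr_ge0// ler_pM.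
have -> : (a + x) * (b + y) * (c + z) - a * b * c =
  x * b * c + (a * y * c + (a * b * z + (a * y * z + (x * y * c + (x * b * z + x * y * z))))).
  by ring.
have t1 := P _ _ _ _ _ _ hx hb hc m0 M0.
have t2 := P _ _ _ _ _ _ ha hy hc M0 m0.
have t3 := P _ _ _ _ _ _ ha hb hz M0 M0.
have t4 := P _ _ _ _ _ _ ha hy hz M0 m0.
have t5 := P _ _ _ _ _ _ hx hy hc m0 m0.
have t6 := P _ _ _ _ _ _ hx hb hz m0 M0.
have t7 := P _ _ _ _ _ _ hxB hy hz B0 m0.
have -> : 3 * M ^+ 2 * m + (3 * M + B) * m ^+ 2 = m * M * M + (M * m * M + (M * M * m +
  (M * m * m + (m * m * M + (m * M * m + B * m * m))))) by ring.
by do 6!(apply: (le_trans (ler_normD _ _)); apply: lerD => //).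
Qed.

Lemma triple_perturb (a b c x y z : 'I_3 -> R) (M B m : R) :
  0 <= M -> 0 <= m -> 0 <= B ->
  (forall i, [/\ `|a i| <= M, `|b i| <= M & `|c i| <= M]) ->
  (forall i, [/\ `|x i| <= B, `|x i| <= m, `|y i| <= m & `|z i| <= m]) ->
  `|triple (fun i => a i + x i) (fun i => b i + y i) (fun i => c i + z i) - triple a b c| <=
  6 * (3 * M ^+ 2 * m + (3 * M + B) * m ^+ 2).
Proof.
move=> M0 m0 B0 h1 h2.
have P i j k : `|(a i + x i) * (b j + y j) * (c k + z k) - a i * b j * c k| <=
    3 * M ^+ 2 * m + (3 * M + B) * m ^+ 2.
  have [? _ _] := h1 i; have [_ ? _] := h1 j; have [_ _ ?] := h1 k.
  have [? ? _ _] := h2 i; have [_ _ ? _] := h2 j; have [_ _ _ ?] := h2 k.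
  exact: prod3_perturb.
set K := 3 * M ^+ 2 * m + _.
have -> : triple (fun i => a i + x i) (fun i => b i + y i) (fun i => c i + z i) - triple a b c =
  ((a o0 + x o0) * (b o1 + y o1) * (c o2 + z o2) - a o0 * b o1 * c o2)
  - ((a o0 + x o0) * (b o2 + y o2) * (c o1 + z o1) - a o0 * b o2 * c o1)
  + (((a o1 + x o1) * (b o2 + y o2) * (c o0 + z o0) - a o1 * b o2 * c o0)
  - ((a o1 + x o1) * (b o0 + y o0) * (c o2 + z o2) - a o1 * b o0 * c o2))
  + (((a o2 + x o2) * (b o0 + y o0) * (c o1 + z o1) - a o2 * b o0 * c o1)
  - ((a o2 + x o2) * (b o1 + y o1) * (c o0 + z o0) - a o2 * b o1 * c o0)).
  by rewrite /triple; ring.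
have -> : 6 * K = K + K + (K + K) + (K + K) by ring.
have N1 (p q : R) : `|p| <= K -> `|q| <= K -> `|p - q| <= K + K.
  by move=> hp hq; rewrite (le_trans (ler_normB _ _))// lerD.
have N2 (p q s t : R) : `|p| <= s -> `|q| <= t -> `|p + q| <= s + t.
  by move=> hp hq; rewrite (le_trans (ler_normD _ _))// lerD.
by apply: (N2 _ _ _ _); [apply: (N2 _ _ _ _)|]; apply: N1; exact: P.
Qed.

End Triple.

Lemma sqr_sum2_le (R : realType) (d a b : R) :
  `|d| <= a + b -> 0 <= a -> 0 <= b -> d ^+ 2 <= 2 * a ^+ 2 + 2 * b ^+ 2.
Proof.
move=> h a0 b0; rewrite -(real_normK (num_real d)).
apply: (@le_trans _ _ ((a + b) ^+ 2)); first by rewrite lerXn2r ?nnegrE// addr_ge0.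
by have := sqr_ge0 (a - b); rewrite sqrrB sqrrD; lra.
Qed.

(* [K sin (x / K)] truncates [x] at height [K], keeps test functions smooth, and is close
   to the bounded value [y] as soon as [x] is. *)
Lemma sin_approx_sqr (R : realType) (M K x y : R) : 1 <= M -> 1 <= K -> `|y| <= M ->
  (K * sin (x / K) - y) ^+ 2 <= 6 * M ^+ 6 * ((y - x) ^+ 2 + K^-1 ^+ 4).
Proof.
move=> M1 K1 yM; have K0 : 0 < K by lra.
have M0 : 0 <= M by lra.
have Ki0 : 0 <= K^-1 by rewrite invr_ge0 ltW.
have e0 : 0 <= K^-1 ^+ 2 by rewrite exprn_ge0.
have s1 : `|K * sin (x / K) - K * sin (y / K)| <= `|y - x|.
  rewrite -mulrBr normrM (gtr0_norm K0).
  apply: (@le_trans _ _ (K * `|x / K - y / K|)); first by rewrite ler_pM2l// sin_lip.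
  rewrite -mulrBl normrM (ger0_norm Ki0) distrC.
  by rewrite mulrCA mulfV ?gt_eqF// mulr1.
have s2 : `|K * sin (y / K) - y| <= M ^+ 3 * K^-1 ^+ 2.
  have -> : K * sin (y / K) - y = K * (sin (y / K) - y / K).
    by rewrite mulrBr mulrCA mulfV ?gt_eqF// mulr1.
  rewrite normrM (gtr0_norm K0).
  apply: (@le_trans _ _ (K * `|y / K| ^+ 3)); first by rewrite ler_pM2l// sin_sub_le.
  rewrite normrM (ger0_norm Ki0) exprMn.
  have -> : K * (`|y| ^+ 3 * K^-1 ^+ 3) = `|y| ^+ 3 * K^-1 ^+ 2.
    by rewrite mulrCA [K^-1 ^+ 3]exprS mulVKf ?gt_eqF.
  by rewrite ler_wpM2r// lerXn2r ?nnegrE.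
have h : `|K * sin (x / K) - y| <= `|y - x| + M ^+ 3 * K^-1 ^+ 2.
  have -> : K * sin (x / K) - y =
    (K * sin (x / K) - K * sin (y / K)) + (K * sin (y / K) - y) by ring.
  by rewrite (le_trans (ler_normD _ _))// lerD.
have := sqr_sum2_le h (normr_ge0 _) (mulr_ge0 (exprn_ge0 3 M0) e0).
rewrite (real_normK (num_real _)) exprMn -!exprM !mulnE /=.
have M6 : 1 <= M ^+ 6 by rewrite exprn_ege1.
have E4 : 0 <= K^-1 ^+ 4 by rewrite exprn_ge0// invr_ge0 ltW.
by have := sqr_ge0 (y - x); move: ((y - x) ^+ 2) (K^-1 ^+ 4) (M ^+ 6) E4 M6 => a b c; nra.
Qed.

(** The counterpart of [sin_approx_sqr] for derivatives, since the derivative of [K sin (x / K)]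
    carries the factor [cos (x / K)]. The increment of this factor multiplies the bounded value [Y]
    and not [X], for which no bound is available. *)
Lemma cos_approx_sqr (R : realType) (M K x y X Y : R) : 1 <= M -> 1 <= K ->
  `|y| <= M -> `|Y| <= M ->
  (cos (x / K) * X - Y) ^+ 2 <=
  6 * M ^+ 6 * ((y - x) ^+ 2 + (Y - X) ^+ 2 + K^-1 ^+ 4).
Proof.
move=> M1 K1 yM YM; have K0 : 0 < K by lra.
have M0 : 0 <= M by lra.
have Ki0 : 0 <= K^-1 by rewrite invr_ge0 ltW.
have Ki1 : K^-1 <= 1 by rewrite invf_le1.
have e0 : 0 <= K^-1 ^+ 2 by rewrite exprn_ge0.
have c1 : `|cos (x / K)| <= 1 by rewrite ler_norml cos_geN1 cos_le1.
have s1 : `|cos (x / K) - cos (y / K)| <= `|y - x|.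
  rewrite (le_trans (cos_lip _ _))// -mulrBl normrM (ger0_norm Ki0) distrC.
  by rewrite ler_piMr.
have s2 : `|1 - cos (y / K)| <= M ^+ 2 * K^-1 ^+ 2.
  rewrite (le_trans (one_sub_cos_le _))// exprMn ler_wpM2r//.
  by rewrite -(real_normK (num_real y)) lerXn2r ?nnegrE.
have h : `|cos (x / K) * X - Y| <= `|Y - X| + (M * `|y - x| + M ^+ 3 * K^-1 ^+ 2).
  have -> : cos (x / K) * X - Y = - (cos (x / K) * (Y - X)) +
    ((cos (x / K) - cos (y / K)) * Y - (1 - cos (y / K)) * Y) by ring.
  rewrite (le_trans (ler_normD _ _))// normrN; apply: lerD.
    by rewrite normrM ler_piMl.
  rewrite (le_trans (ler_normB _ _))//; apply: lerD.
    by rewrite normrM mulrC ler_pM.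
  by rewrite normrM mulrC exprS -mulrA ler_pM.
have := sqr_sum2_le h (normr_ge0 _) (addr_ge0 (mulr_ge0 M0 (normr_ge0 _)) (mulr_ge0 (exprn_ge0 3 M0) e0)).
have := @sqr_sum2_le _ (M * `|y - x| + M ^+ 3 * K^-1 ^+ 2) (M * `|y - x|) (M ^+ 3 * K^-1 ^+ 2).
rewrite ger0_norm ?addr_ge0 ?mulr_ge0 ?exprn_ge0// lexx => /(_ isT isT isT).
have -> : (M ^+ 3 * K^-1 ^+ 2) ^+ 2 = M ^+ 6 * K^-1 ^+ 4 by ring.
rewrite (exprMn 2 M) (real_normK (num_real (y - x))) (real_normK (num_real (Y - X))).
have M2 : 1 <= M ^+ 2 by rewrite exprn_ege1.
have M26 : M ^+ 2 <= M ^+ 6 by rewrite ler_weXn2l.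
have E4 : 0 <= K^-1 ^+ 4 by rewrite exprn_ge0.
have := sqr_ge0 (y - x); have := sqr_ge0 (Y - X).
move: ((_ + _) ^+ 2) => z.
move: ((y - x) ^+ 2) ((Y - X) ^+ 2) (K^-1 ^+ 4) (M ^+ 6) (M ^+ 2) E4 M26 M2.
by move=> a b d m6 m2; nra.
Qed.

(** * Approximation of classical functions by bounded test functions *)

Section ClassicalFields.
Context {R : realType}.
Variable Om : set (R * R).
Hypotheses (oOm : open Om) (bOm : bounded_set Om).
Implicit Types (f g phi : R * R -> R) (F G : bool -> R * R -> R).

Let mOm := measurable_open_plane oOm.
Let fOm := mu2_bounded_lty oOm bOm.

Definition cont_bounded (M : R) f := forall p, Om p ->
  {for p, continuous f} /\ `|f p| <= M.

Definition c1_bounded (M : R) f F := [/\ cont_bounded M f,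
  forall b, cont_bounded M (F b) &
  forall b p, Om p -> is_derive p (axis b) f (F b p)].

Lemma cont_bounded_L2 M f : cont_bounded M f -> L2 Om f.
Proof. by move=> H; apply: (continuous_bounded_L2 oOm bOm (M := M)) => p /H[]. Qed.

Lemma c1_gradient M f F : c1_bounded M f F -> gradient Om f F.
Proof.
move=> [Hf HF D] b.
exact: (classical_weak_partial oOm bOm (cont_bounded_L2 Hf) (cont_bounded_L2 (HF b))
  (fun p Op => (Hf p Op).1) (fun p Op => (HF b p Op).1) (D b)).
Qed.

(** A single [T] dominates pointwise the squared errors of the function and of both derivatives,
    which is the form a trilinear density needs. Its integral collects the squared H^1 distance,
    below [K^-1 ^+ 4], and the truncation error, of size [K^-1 ^+ 4] at every point. *)
Lemma bounded_test_approx M K f F : 1 <= M -> 1 <= K -> H10 Om f -> c1_bounded M f F ->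
  exists Phi T, [/\ test_function Om Phi, forall p, `|Phi p| <= K,
    intg Om T, \int[@mu2 R]_(p in Om) T p <= 6 * M ^+ 6 * (1 + fine (@mu2 R Om)) * K^-1 ^+ 4 &
    forall p, Om p -> (Phi p - f p) ^+ 2 <= T p /\
      forall b, ('D_(axis b) Phi p - F b p) ^+ 2 <= T p].
Proof.
move=> M1 K1 Hf c1; have K0 : 0 < K by lra.
have gF := c1_gradient c1; have [cf cF DF] := c1.
have f2 := H10_L2 Hf; have F2 b := gradient_L2 b gF.
have e0 : 0 < K^-1 ^+ 4 by rewrite exprn_gt0// invr_gt0.
have M60 : 0 <= 6 * M ^+ 6 by rewrite mulr_ge0// exprn_ge0//; lra.
have [phi tphi pe] := (H10P oOm bOm f2 gF).1 Hf _ e0.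
have p2 := test_L2 oOm bOm tphi; have Dp2 b := test_partial_L2 oOm bOm b tphi.
have tPhi : test_function Om (fun p => K * sin (K^-1 * phi p)).
  by apply: testZ; apply: test_sin; exact: testZ.
pose S p := (f p - phi p) ^+ 2 + ((F false p - 'D_(axis false) phi p) ^+ 2 +
  (F true p - 'D_(axis true) phi p) ^+ 2).
have iSf : intg Om (fun p => (f p - phi p) ^+ 2) by exact: (L2_sqr (L2B mOm f2 p2)).
have iSF b : intg Om (fun p => (F b p - 'D_(axis b) phi p) ^+ 2).
  exact: (L2_sqr (L2B mOm (F2 b) (Dp2 b))).
have iS : intg Om S by apply: (intgD mOm iSf); exact: (intgD mOm (iSF _)).
have ic : intg Om (cst (K^-1 ^+ 4)) by apply: (L2_intg mOm fOm); exact: L2_cst.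
have iSc : intg Om (fun p => S p + cst (K^-1 ^+ 4) p) by exact: (intgD mOm iS ic).
exists (fun p => K * sin (K^-1 * phi p)), (fun p => 6 * M ^+ 6 * (S p + cst (K^-1 ^+ 4) p)).
split.
- by [].
- by move=> p; rewrite normrM (gtr0_norm K0) ler_piMr ?sin_max// ltW.
- exact: (intgZ mOm).
- rewrite (RintZ mOm _ iSc) -mulrA ler_wpM2l// (RintD mOm iS ic) Rintegral_cst//.
  rewrite mulrDl mul1r [K^-1 ^+ 4 * _]mulrC lerD2r; apply: le_trans (ltW pe).
  rewrite /S (RintD mOm iSf (intgD mOm (iSF false) (iSF true))).
  by rewrite (RintD mOm (iSF false) (iSF true)) /H1sq /gip -!L2sqE lexx.
- move=> p Op; have [_ fM] := cf p Op; split.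
    rewrite [K^-1 * _]mulrC; apply: (le_trans (sin_approx_sqr _ M1 K1 fM)).
    by rewrite ler_wpM2l// lerD2r /S lerDl addr_ge0// sqr_ge0.
  move=> b; have [_ FM] := cF b p Op.
  have D1 := is_deriveZf K^-1 (smooth_is_derive b p tphi.1).
  have [_ ->] := is_deriveZf K (is_derive_chain D1 (is_derive_sin (K^-1 * phi p))).
  have -> : K * (cos (K^-1 * phi p) * (K^-1 * 'D_(axis b) phi p)) =
      cos (phi p / K) * 'D_(axis b) phi p.
    by rewrite [K^-1 * phi p]mulrC; field; rewrite gt_eqF.
  apply: (le_trans (cos_approx_sqr _ _ M1 K1 fM FM)).
  rewrite ler_wpM2l// lerD2r /S lerD2l.
  by case: b {FM D1}; [rewrite lerDr sqr_ge0|rewrite lerDl sqr_ge0].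
Qed.

End ClassicalFields.

Lemma derive_coord (R : realType) (U : normedModType R) (v : U -> 'rV[R]_3) p d (i : 'I_3) :
  derivable v p d -> is_derive p d (fun q => v q 0 i) ('D_d v p 0 i).
Proof.
move=> dv; apply: DeriveDef; first exact: (derivable_mxP v p d).1 dv 0 i.
by rewrite (derive_mx dv) mxE.
Qed.

(** Only the integral of [T] is under control, so the term linear in its square root is split by
    Young's inequality [2 * Num.sqrt T <= e + e^-1 * T]. *)
Lemma voldens_bound (R : realType) (M K T e x : R) : 0 <= M -> 0 <= K -> 0 < e -> 0 <= T ->
  x <= 6 * (3 * M ^+ 2 * Num.sqrt T + (3 * M + (K + M)) * Num.sqrt T ^+ 2) ->
  x <= 9 * M ^+ 2 * e + (9 * M ^+ 2 * e^-1 + 6 * (4 * M + K)) * T.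
Proof.
move=> M0 K0 e0 T0 h; apply: (le_trans h); rewrite sqr_sqrtr//.
set m := Num.sqrt T; have mT : m ^+ 2 = T by rewrite sqr_sqrtr.
have h2 : 2 * m <= e + e^-1 * T.
  rewrite -(ler_pM2l e0) mulrDr mulVKf ?gt_eqF// -mT.
  by have := sqr_ge0 (e - m); rewrite sqrrB; lra.
have := ler_wpM2l (sqr_ge0 M) h2; rewrite !mulrDr; lra.
Qed.

(** With [J] of order [e ^+ 2], the errors are of order [e], [e^-1 * e ^+ 2] and [K * e ^+ 2]; for
    [e = K^-1 ^+ 2] each is at most of order [K^-1]. *)
Lemma volume_error (R : realType) (M C m0 K e J : R) : 0 <= M -> 0 <= C -> 0 <= m0 -> 1 <= K ->
  e = K^-1 ^+ 2 -> J <= C * e ^+ 2 ->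
  9 * M ^+ 2 * e * m0 + (9 * M ^+ 2 * e^-1 + 6 * (4 * M + K)) * J <=
  (9 * M ^+ 2 * m0 + 9 * M ^+ 2 * C + 6 * (4 * M + 1) * C) * K^-1.
Proof.
move=> M0 C0 m00 K1 eE hJ; have K0 : 0 < K by lra.
have Ki0 : 0 < K^-1 by rewrite invr_gt0.
have Ki1 : K^-1 <= 1 by rewrite invf_le1.
have e0 : 0 < e by rewrite eE exprn_gt0.
have eK : e <= K^-1 by rewrite eE expr2 ler_piMr// ltW.
have e1 : e <= 1 by lra.
have e2 : e ^+ 2 <= K^-1 by rewrite expr2 (le_trans _ eK)// ler_piMr// ltW.
have Ke : K * e ^+ 2 <= K^-1.
  rewrite expr2 {1}eE [K^-1 ^+ 2]expr2 -!mulrA mulVKf ?gt_eqF//.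
  by rewrite ler_piMr// ltW.
have q0 : 0 <= 9 * M ^+ 2 * e^-1 + 6 * (4 * M + K).
  by rewrite addr_ge0 ?mulr_ge0 ?exprn_ge0 ?invr_ge0 ?(ltW e0)// addr_ge0 ?mulr_ge0// ltW.
have h := ler_wpM2l q0 hJ.
have E : (9 * M ^+ 2 * e^-1 + 6 * (4 * M + K)) * (C * e ^+ 2) =
  (9 * M ^+ 2 * C) * e + 24 * M * C * e ^+ 2 + 6 * C * (K * e ^+ 2).
  by field; rewrite gt_eqF.
have a1 := ler_wpM2l (mulr_ge0 (mulr_ge0 (ler0n _ 9) (sqr_ge0 M)) m00) eK.
have a2 := ler_wpM2l (mulr_ge0 (mulr_ge0 (ler0n _ 9) (sqr_ge0 M)) C0) eK.
have a3 := ler_wpM2l (mulr_ge0 (mulr_ge0 (ler0n _ 24) M0) C0) e2.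
have a4 := ler_wpM2l (mulr_ge0 (ler0n _ 6) C0) Ke.
rewrite E in h; lra.
Qed.

Section Volume.
Context {R : realType}.
Local Notation mR := (measurableTypeR R).
Variable Om : set (R * R).
Hypotheses (oOm : open Om) (bOm : bounded_set Om).
Implicit Types (f g phi : R * R -> R) (v : R * R -> 'rV[R]_3).

Let mOm := measurable_open_plane oOm.
Let fOm := mu2_bounded_lty oOm bOm.
Local Notation grad phi := (fun b : bool => 'D_(axis b) phi : R * R -> R).

Definition voldens (f : 'I_3 -> R * R -> R) (F : 'I_3 -> bool -> R * R -> R) (p : R * R) : R :=
  triple (fun i => f i p) (fun i => F i false p) (fun i => F i true p).

Definition vol (f : 'I_3 -> R * R -> R) (F : 'I_3 -> bool -> R * R -> R) : R :=
  \int[@mu2 R]_(p in Om) voldens f F p.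

Lemma intg_voldens B (f : 'I_3 -> R * R -> R) (F : 'I_3 -> bool -> R * R -> R) :
  (forall i, measurable_fun (Om : set (mR * mR)) (f i)) ->
  (forall i p, Om p -> `|f i p| <= B) -> (forall i b, L2 Om (F i b)) ->
  intg Om (voldens f F).
Proof.
move=> mf fB F2.
have P i j k : intg Om (fun p => f i p * (F j false p * F k true p)).
  have ifg := L2_intgM mOm (F2 j false) (F2 k true).
  apply: (le_intg mOm _ (intgZ mOm B (integrable_norm ifg))).
    by apply: measurable_funM; [exact: mf|exact: intg_measurable ifg].
  by move=> p Op; rewrite normrM ler_wpM2r// fB.
have Q i j k : intg Om (fun p => f i p * (F j false p * F k true p - F k false p * F j true p)).
  apply: (eq_intg mOm _ (intgB mOm (P i j k) (P i k j))) => p _ /=.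
  by rewrite mulrBr.
by apply: (intgD mOm); [apply: (intgD mOm)|]; exact: Q.
Qed.

Lemma vH1norm_sqr v (W : 'I_3 -> bool -> R * R -> R) :
  (forall i, gradient Om (coord v i) (W i)) ->
  vH1norm Om v ^+ 2 = \sum_(i < 3) H1sq Om (coord v i) (W i).
Proof.
move=> gW.
have L0 : 0 <= \sum_(i < 3) L2sq Om (coord v i).
  by apply: sumr_ge0 => i _; rewrite L2sqE ip_ge0.
have E : vL2norm Om v ^+ 2 + dirichlet Om v = \sum_(i < 3) H1sq Om (coord v i) (W i).
  rewrite /vL2norm sqr_sqrtr// /dirichlet -big_split/=.
  by apply: eq_bigr => i _; rewrite L2sqE (grad_innerE oOm bOm (gW i) (gW i)).
rewrite /vH1norm sqr_sqrtr// E.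
by apply: sumr_ge0 => i _; exact: H1sq_ge0.
Qed.

Lemma volume_test V (phi : R * R -> 'rV[R]_3) : volume_extension Om V -> test_field Om phi ->
  V phi = vol (coord phi) (fun i => grad (coord phi i)).
Proof.
move=> [HV _] tphi; rewrite HV//; apply: eq_Rint => p _.
have dphi b : derivable phi p (axis b).
  by apply/derivable_mxP => i j; rewrite ord1; exact/smooth_derivable/(tphi j).1.
rewrite dot_wedge /voldens.
have E b : (fun i : 'I_3 => 'D_(axis b) phi p 0 i) = (fun i => 'D_(axis b) (coord phi i) p).
  by apply/funext => i; have [_ <-] := derive_coord i (dphi b).
by rewrite -!E.
Qed.

(* Convergence in H^1 does not control the cubic integral; uniformly bounded approximants
   [w] do, with [`|w| <= K] and an H^1 error of order [K^-2] against a loss of order [K]. *)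
Lemma volume_classical_approx M V v (F : 'I_3 -> bool -> R * R -> R) : 1 <= M ->
  volume_extension Om V -> vH10 Om v -> (forall i, c1_bounded Om M (coord v i) (F i)) ->
  exists D : R, 0 < D /\ forall K : R, 1 <= K -> exists2 w, vH10 Om w /\
    vH1norm Om (w \- v) ^+ 2 <= D * K^-1 & `|V w - vol (coord v) F| <= D * K^-1.
Proof.
move=> M1 HV Hv c1; have M0 : 0 <= M by lra.
pose m0 : R := fine (@mu2 R Om); have m00 : 0 <= m0 by rewrite fine_ge0.
pose C1 := 6 * M ^+ 6 * (1 + m0); pose C := 3 * C1.
have C10 : 0 <= C1 by apply: mulr_ge0; [apply: mulr_ge0 => //; exact: exprn_ge0|exact: addr_ge0].
have C0 : 0 <= C by rewrite mulr_ge0.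
pose D1 := 9 * M ^+ 2 * m0 + 9 * M ^+ 2 * C + 6 * (4 * M + 1) * C.
have M20 : 0 <= 9 * M ^+ 2 by rewrite mulr_ge0// exprn_ge0.
have M10 : 0 <= 6 * (4 * M + 1) by lra.
have D10 : 0 <= D1 by apply: addr_ge0; [apply: addr_ge0|]; exact: mulr_ge0.
have D00 : 0 < D1 + 9 * C + 1 by rewrite ltr_wpDl// addr_ge0// mulr_ge0.
exists (D1 + 9 * C + 1); split=> //.
move=> K K1; have K0 : 0 < K by lra.
have Ki0 : 0 < K^-1 by rewrite invr_gt0.
pose e := K^-1 ^+ 2; have e0 : 0 < e by rewrite exprn_gt0.
have /choice[Phi /choice[T HPT]] := fun i => bounded_test_approx oOm bOm M1 K1 (Hv i) (c1 i).
have tPhi i : test_function Om (Phi i) by case: (HPT i).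
have iT i : intg Om (T i) by case: (HPT i).
pose S p := \sum_(i < 3) T i p.
have iS : intg Om S by exact: intg_sum.
have T0 i p : Om p -> 0 <= T i p.
  by case: (HPT i) => _ _ _ _ H Op; case: (H p Op) => h _; rewrite (le_trans _ h)// sqr_ge0.
have TS i p : Om p -> T i p <= S p.
  move=> Op; rewrite /S (bigD1 i)//= lerDl sumr_ge0// => j _; exact: T0.
have intS : \int[@mu2 R]_(p in Om) S p <= C * e ^+ 2.
  rewrite (Rint_sum mOm)//; apply: (@le_trans _ _ (\sum_(i < 3) C1 * e ^+ 2)).
    apply: ler_sum => i _; case: (HPT i) => _ _ _ h _.
    by apply: (le_trans h); rewrite /e -exprM.
  rewrite sumr_const card_ord -[leLHS]mulr_natl /C mulrA; exact: lexx.
pose w p : 'rV[R]_3 := \row_i Phi i p.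
have wE i : coord w i = Phi i by apply/funext => p; rewrite /coord mxE.
have tw : test_field Om w by move=> i; rewrite wE.
have Hw : vH10 Om w by move=> i; exact: test_H10.
have cF i : cont_bounded Om M (coord v i) by case: (c1 i).
have f2 i : L2 Om (coord v i) := H10_L2 (Hv i).
have gF i := c1_gradient oOm bOm (c1 i).
have F2 i b : L2 Om (F i b) := gradient_L2 b (gF i).
have P2 i := test_L2 oOm bOm (tPhi i).
have DP2 i b := test_partial_L2 oOm bOm b (tPhi i).
exists w.
  split => //.
  have gW i : gradient Om (coord (w \- v) i) (fun b => 'D_(axis b) (Phi i) \- F i b).
    have -> : coord (w \- v) i = Phi i \- coord v i.
      by apply/funext => p; rewrite /coord /= !mxE.
    by apply: gradientB => //; exact: gradient_test.
  rewrite (vH1norm_sqr gW).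
  apply: (@le_trans _ _ (\sum_(i < 3) 3 * (C1 * e ^+ 2))); last first.
    rewrite sumr_const card_ord -[leLHS]mulr_natl.
    have e2 : e ^+ 2 <= K^-1.
      rewrite /e -exprM -[leRHS]expr1 ler_wiXn2l ?invf_le1// ltW//.
    have h1 : 3%:R * (3 * (C1 * e ^+ 2)) = 3 * C * e ^+ 2 by rewrite /C; ring.
    rewrite h1; apply: (@le_trans _ _ (3 * C * K^-1)).
      by rewrite ler_wpM2l// mulr_ge0.
    by rewrite ler_pM2r//; lra.
  apply: ler_sum => i _ /=.
  have -> : coord (w \- v) i = Phi i \- coord v i.
    by apply/funext => p; rewrite /coord /= !mxE.
  case: (HPT i) => _ _ _ hT hp.
  have hT' : \int[@mu2 R]_(p in Om) T i p <= C1 * e ^+ 2.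
    by apply: (le_trans hT); rewrite /e -exprM.
  have G (g : R * R -> R) : L2 Om g -> (forall p, Om p -> g p ^+ 2 <= T i p) ->
      ip Om g g <= C1 * e ^+ 2.
    move=> g2 gT; apply: le_trans hT'; rewrite -L2sqE; apply: le_Rintegral => //.
    by case: g2.
    exact: iT.
  have h3 : C1 * e ^+ 2 + (C1 * e ^+ 2 + C1 * e ^+ 2) <= 3 * (C1 * e ^+ 2) by lra.
  apply: le_trans h3.
  rewrite /H1sq /gip; apply: lerD; [|apply: lerD]; apply: G.
  - exact: (L2B mOm (P2 i) (f2 i)).
  - by move=> p /hp[].
  - exact: (L2B mOm (DP2 i _) (F2 i _)).
  - by move=> p /hp[_ /(_ false)].
  - exact: (L2B mOm (DP2 i _) (F2 i _)).
  - by move=> p /hp[_ /(_ true)].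
rewrite (volume_test HV tw).
have iv : intg Om (voldens (coord v) F).
  apply: (@intg_voldens M) => //; first by move=> i; exact: (f2 i).1.
  by move=> i p /(cF i)[].
have iw : intg Om (voldens (coord w) (fun i => grad (coord w i))).
  apply: (@intg_voldens K) => [i|i p Op|i b]; rewrite wE//; first exact: (P2 i).1.
  by case: (HPT i).
rewrite /vol -(RintB mOm iw iv).
apply: (le_trans (le_normr_Rintegral mOm (intgB mOm iw iv))).
pose c1' := 9 * M ^+ 2 * e; pose c2 := 9 * M ^+ 2 * e^-1 + 6 * (4 * M + K).
have icst : intg Om (cst c1') by apply: (L2_intg mOm fOm); exact: L2_cst.
have iS2 := intgZ mOm c2 iS.
apply: (@le_trans _ _ (\int[@mu2 R]_(p in Om) (cst c1' p + c2 * S p))).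
  apply: le_Rintegral => //.
  - exact: (integrable_norm (intgB mOm iw iv)).
  - exact: (intgD mOm icst iS2).
  move=> p Op; apply: voldens_bound => //; [exact: ltW|exact: le_trans (T0 o0 p Op) (TS _ _ Op)|rewrite /=].
  have S0 : 0 <= S p := le_trans (T0 o0 p Op) (TS o0 p Op).
  have -> : voldens (coord w) (fun i => grad (coord w i)) p =
     triple (fun i => coord v i p + (Phi i p - coord v i p))
       (fun i => F i false p + ('D_(axis false) (Phi i) p - F i false p))
       (fun i => F i true p + ('D_(axis true) (Phi i) p - F i true p)).
    by rewrite /voldens; congr triple; apply/funext => i; rewrite wE addrC subrK.
  have sq (x : R) (i : 'I_3) : x ^+ 2 <= T i p -> `|x| <= Num.sqrt (S p).
    move=> h; rewrite -sqrtr_sqr ler_wsqrtr// (le_trans h)//; exact: TS.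
  (* The uniform bound on the error of the field is [K + M], from the truncation and from the field;
     its derivatives are only controlled through [Num.sqrt (S p)]. *)
  apply: triple_perturb => //; [exact: addr_ge0 (ltW K0) M0| |].
    by move=> i; have [cf cF' _] := c1 i; split; [case: (cf p Op)|case: (cF' false p Op)|case: (cF' true p Op)].
  move=> i; case: (HPT i) => _ PK _ _ /(_ p Op)[h1 h2]; split.
  - by rewrite (le_trans (ler_normB _ _))// lerD// ?PK//; case: (cF i p Op).
  - exact: sq h1.
  - exact: sq (h2 false).
  - exact: sq (h2 true).
rewrite (RintD mOm icst iS2) (RintZ mOm _ iS) Rintegral_cst//.
have := volume_error M0 C0 m00 K1 (erefl e) intS => h.
have hD : D1 <= D1 + 9 * C + 1 by rewrite -[leRHS]addrA lerDl addr_ge0// mulr_ge0.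
by apply: (le_trans h); rewrite ler_pM2r.
Qed.

(** Along the approximants [w], [V w] tends to [V v] by the continuity of [V] and to the classical
    integral by the previous estimate. *)
Lemma volume_classical M V v (F : 'I_3 -> bool -> R * R -> R) : 1 <= M ->
  volume_extension Om V -> vH10 Om v -> (forall i, c1_bounded Om M (coord v i) (F i)) ->
  V v = vol (coord v) F.
Proof.
move=> M1 HV Hv c1; have [D [D0 H]] := volume_classical_approx M1 HV Hv c1.
apply/eqP; rewrite -subr_eq0 -normr_le0; apply: (@le0_mul_eps _ _ 2) => e e0.
have [d d0 Hd] := HV.2 v Hv e e0.
have d20 : 0 < d ^+ 2 / 2 / D by rewrite !divr_gt0// exprn_gt0.
have eD0 : 0 < e / D by rewrite divr_gt0.
have [n] : exists n : nat, n.+1%:R^-1 <= Num.min (d ^+ 2 / 2 / D) (e / D).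
  by apply: inv_succ_small; rewrite lt_min d20.
rewrite le_min => /andP[nd ne].
have [|w [Hw wv] Vw] := H n.+1%:R; first by rewrite ler1n.
have wd : vH1norm Om (w \- v) < d.
  rewrite -(@ltr_pXn2r _ 2%N)// ?nnegrE ?sqrtr_ge0 ?(ltW d0)//.
  apply: (le_lt_trans wv); rewrite mulrC -ltr_pdivlMr//.
  apply: (le_lt_trans nd); rewrite ltr_pM2r ?invr_gt0//.
  have d2 : 0 < d ^+ 2 by rewrite exprn_gt0.
  by rewrite ltr_pdivrMr// ltr_pMr// ltr1n.
have := Hd w Hw wd => h1.
have h2 : `|V w - vol (coord v) F| <= e.
  by apply: (le_trans Vw); rewrite mulrC -ler_pdivlMr.
have -> : V v - vol (coord v) F = (V w - vol (coord v) F) - (V w - V v) by ring.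
have -> : 2 * e = e + e by ring.
by rewrite (le_trans (ler_normB _ _))// lerD// ltW.
Qed.

End Volume.

(** * Evolution of the mass and of the energy *)

Lemma mean_value_step (R : realType) (k dk : R -> R) (x h : R) : 0 <= h ->
  (forall z, x <= z <= x + h -> is_derive z 1 k (dk z)) ->
  exists2 c, x <= c <= x + h & k (x + h) - k x = dk c * h.
Proof.
move=> h0 D; have [|c] := @mean_value R k dk (x + h) x.
  by move=> z; rewrite (min_idPr _) ?lerDl// (max_idPl _) ?lerDl//; exact: D.
rewrite (min_idPr _) ?lerDl// (max_idPl _) ?lerDl// => hc ->.
by exists c; rewrite // addrAC subrr add0r.
Qed.

(** The second difference of [f] over a small square of side [h] is [h * h] times a value of either
    mixed derivative at some point of the square, by two mean value theorems in each order;
    continuity at [p] concludes. *)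
Lemma mixed_partials (R : realType) (U : set (R * R)) (f Fx Fy Gxy Gyx : R * R -> R) p :
  open U -> U p ->
  (forall q, U q -> is_derive q (axis false) f (Fx q)) ->
  (forall q, U q -> is_derive q (axis true) f (Fy q)) ->
  (forall q, U q -> is_derive q (axis true) Fx (Gxy q)) ->
  (forall q, U q -> is_derive q (axis false) Fy (Gyx q)) ->
  {for p, continuous Gxy} -> {for p, continuous Gyx} -> Gxy p = Gyx p.
Proof.
case: p => x y oU Up Dx Dy Dxy Dyx cxy cyx.
apply/eqP; rewrite -subr_eq0 -normr_le0; apply: (@le0_mul_eps _ _ 2) => e e0.
have : \forall q \near (x, y), [/\ U q, `|Gxy (x, y) - Gxy q| < e & `|Gyx (x, y) - Gyx q| < e].
  have h1 : \forall q \near (x, y), `|Gxy (x, y) - Gxy q| < e by move/cvgrPdist_lt: cxy; apply.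
  have h2 : \forall q \near (x, y), `|Gyx (x, y) - Gyx q| < e by move/cvgrPdist_lt: cyx; apply.
  near=> q; split; near: q => //; exact: open_nbhs_nbhs.
move=> /nbhs_ballP[r /= r0 B]; pose h := r / 2; have h0 : 0 < h by rewrite divr_gt0.
have hr : h < r by rewrite /h; lra.
have N z w : x <= z <= x + h -> y <= w <= y + h ->
    [/\ U (z, w), `|Gxy (x, y) - Gxy (z, w)| < e & `|Gyx (x, y) - Gyx (z, w)| < e].
  move=> /andP[z1 z2] /andP[w1 w2]; apply: B; split; rewrite /ball/= ltr_distl; lra.
have xx : x <= x <= x + h by lra.
have xh : x <= x + h <= x + h by lra.
have yy : y <= y <= y + h by lra.
have yh : y <= y + h <= y + h by lra.
have [|c hc E1] := @mean_value_step R (fun s => f (s, y + h) - f (s, y))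
    (fun s => Fx (s, y + h) - Fx (s, y)) x h (ltW h0).
  move=> z hz; apply: is_deriveBf; apply/is_derive_slice1; apply: Dx.
    by case: (N z (y + h) hz yh).
  by case: (N z y hz yy).
have [|d hd E2] := @mean_value_step R (fun s => Fx (c, s)) (fun s => Gxy (c, s)) y h (ltW h0).
  by move=> z hz; apply/is_derive_slice2; apply: Dxy; case: (N c z hc hz).
have [|d' hd' E3] := @mean_value_step R (fun s => f (x + h, s) - f (x, s))
    (fun s => Fy (x + h, s) - Fy (x, s)) y h (ltW h0).
  move=> z hz; apply: is_deriveBf; apply/is_derive_slice2; apply: Dy.
    by case: (N (x + h) z xh hz).
  by case: (N x z xx hz).
have [|c' hc' E4] := @mean_value_step R (fun s => Fy (s, d')) (fun s => Gyx (s, d')) x h (ltW h0).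
  by move=> z hz; apply/is_derive_slice1; apply: Dyx; case: (N z d' hz hd').
have E : Gxy (c, d) = Gyx (c', d').
  have h20 : h * h != 0 by rewrite mulf_neq0 ?gt_eqF.
  rewrite /= in E1 E2 E3 E4; apply: (mulIf h20).
  rewrite (mulrA (Gxy _)) (mulrA (Gyx _)) -E2 -E4 -E1 -E3; ring.
have [_ + _] := N c d hc hd; have [_ _ +] := N c' d' hc' hd'.
rewrite E => a b; have -> : Gxy (x, y) - Gyx (x, y) =
  (Gxy (x, y) - Gyx (c', d')) - (Gyx (x, y) - Gyx (c', d')) by ring.
have -> : 2 * e = e + e by ring.
by rewrite (le_trans (ler_normB _ _))// lerD// ltW.
Unshelve. all: by end_near.
Qed.

Lemma is_derive_littleo (R : realType) (Y : R -> R) (s y' C : R) :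
  (forall e, 0 < e -> exists2 d, 0 < d & forall r, `|r - s| < d ->
     `|Y r - Y s - (r - s) * y'| <= C * e * `|r - s|) -> is_derive s 1 Y y'.
Proof.
move=> H; have C0 : 0 < `|C| + 1 by rewrite ltr_wpDl.
suff L : h^-1 *: ((Y \o shift s) (h *: (1 : R)) - Y s) @[h --> 0^'] --> y'.
  by apply: DeriveDef; [apply/cvg_ex; exists y'|apply/cvg_lim].
apply/cvgrPdist_le => e e0.
have [|d d0 Hd] := H (e / (`|C| + 1)); first by rewrite divr_gt0.
have e10 : 0 < e / (`|C| + 1) by rewrite divr_gt0.
near=> h => /=; have hn0 : h != 0 by near: h; exact: nbhs_dnbhs_neq.
have hd : `|h| < d.
  near: h; apply: dnbhs0_lt; exact: d0.
have := Hd (s + h); rewrite addrAC subrr add0r => /(_ hd) K.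
have -> : y' - h^-1 * (Y (h * 1 + s) - Y s) = - (h^-1 * (Y (s + h) - Y s - h * y')).
  by rewrite mulr1 (addrC h); field.
rewrite normrN normrM normfV ler_pdivrMl ?normr_gt0//.
apply: (le_trans K); rewrite [leRHS]mulrC ler_wpM2r// mulrA ler_pdivrMr// mulrC ler_wpM2l ?(ltW e0)//.
by rewrite (le_trans (ler_norm _))// lerDl.
Unshelve. all: by end_near.
Qed.

(** * Increments of the triple product *)

Section TripleBounds.
Context {R : realType}.
Implicit Types (a b c : 'I_3 -> R).

Lemma triple_rot a b c : triple a b c = triple b c a.
Proof. by rewrite /triple; ring. Qed.

Lemma triple_bound a b c A B C : (forall i, `|a i| <= A) -> (forall i, `|b i| <= B) ->
  (forall i, `|c i| <= C) -> `|triple a b c| <= 6 * (A * B * C).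
Proof.
move=> ha hb hc; have A0 : 0 <= A := le_trans (normr_ge0 _) (ha o0).
have B0 : 0 <= B := le_trans (normr_ge0 _) (hb o0).
have P i j k : `|a i * (b j * c k)| <= A * B * C.
  by rewrite !normrM -mulrA ler_pM ?mulr_ge0// ler_pM.
have Q i j k l : `|a i * (b j * c k - b k * c l)| <= A * B * C + A * B * C.
  by rewrite mulrBr (le_trans (ler_normB _ _))// lerD.
have -> : 6 * (A * B * C) = (A * B * C + A * B * C) + (A * B * C + A * B * C) +
  (A * B * C + A * B * C) by ring.
by do 2!(apply: (le_trans (ler_normD _ _)); apply: lerD => //).
Qed.

(** Squares are kept on the right because the integral of the squared gradient of a small variation
    is much smaller than its pointwise bound suggests; see [gip_diff]. *)
Lemma triple_bound_sqr a b c A : (forall i, `|a i| <= A) ->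
  `|triple a b c| <= A * \sum_(i < 3) (b i ^+ 2 + c i ^+ 2).
Proof.
move=> ha; have A0 : 0 <= A := le_trans (normr_ge0 _) (ha o0).
have amgm (x y : R) : `|x * y| <= (x ^+ 2 + y ^+ 2) / 2.
  rewrite ler_norml; have := sqr_ge0 (x - y); have := sqr_ge0 (x + y).
  by rewrite sqrrB sqrrD; lra.
have P i (x y z t : R) : `|a i * (x * y - z * t)| <=
    A * ((x ^+ 2 + y ^+ 2) / 2 + (z ^+ 2 + t ^+ 2) / 2).
  rewrite normrM ler_pM// (le_trans (ler_normB _ _))//; exact: lerD.
rewrite sum3; apply: le_trans (_ : A * ((b o1 ^+ 2 + c o2 ^+ 2) / 2 + (b o2 ^+ 2 + c o1 ^+ 2) / 2) +
  A * ((b o2 ^+ 2 + c o0 ^+ 2) / 2 + (b o0 ^+ 2 + c o2 ^+ 2) / 2) +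
  A * ((b o0 ^+ 2 + c o1 ^+ 2) / 2 + (b o1 ^+ 2 + c o0 ^+ 2) / 2) <= _).
  by do 2!(apply: (le_trans (ler_normD _ _)); apply: lerD => //).
by rewrite -!mulrDr ler_wpM2l//; lra.
Qed.

(* The part of the increment of the triple product that is at least quadratic. *)
Lemma triple_remainder (v v' X X' Y Y' : 'I_3 -> R) (M d e : R) :
  (forall i, `|v' i| <= M) -> (forall i, `|X i| <= M) -> (forall i, `|Y i| <= M) ->
  (forall i, `|v' i - v i| <= d) -> (forall i, `|X' i - X i| <= e) ->
  (forall i, `|Y' i - Y i| <= e) ->
  `|triple v' X' Y' - triple v X Y -
    (triple (fun i => v' i - v i) X Y + triple v (fun i => X' i - X i) Y +
     triple v X (fun i => Y' i - Y i))| <=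
  12 * M * d * e + M * \sum_(i < 3) ((X' i - X i) ^+ 2 + (Y' i - Y i) ^+ 2).
Proof.
move=> hv hX hY hd hX' hY'.
have -> : triple v' X' Y' - triple v X Y -
    (triple (fun i => v' i - v i) X Y + triple v (fun i => X' i - X i) Y +
     triple v X (fun i => Y' i - Y i)) =
  triple (fun i => v' i - v i) (fun i => X' i - X i) Y +
  triple (fun i => v' i - v i) X (fun i => Y' i - Y i) +
  triple v' (fun i => X' i - X i) (fun i => Y' i - Y i).
  by rewrite /triple; ring.
have -> : 12 * M * d * e = 6 * (d * e * M) + 6 * (d * M * e) by ring.
apply: (le_trans (ler_normD _ _)); apply: lerD; last exact: triple_bound_sqr.
by apply: (le_trans (ler_normD _ _)); apply: lerD; apply: triple_bound.
Qed.

End TripleBounds.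

(** * Integration by parts in the triple product *)

Section Evolution.
Context {R : realType}.
Variable Om : set (R * R).
Hypotheses (oOm : open Om) (bOm : bounded_set Om).
Implicit Types (h k : R * R -> R) (f w B C : 'I_3 -> R * R -> R)
  (F W : 'I_3 -> bool -> R * R -> R) (G : 'I_3 -> bool -> bool -> R * R -> R).

Let mOm := measurable_open_plane oOm.
Let fOm := mu2_bounded_lty oOm bOm.
Let m0 : R := fine (@mu2 R Om).
Let m00 : 0 <= m0. Proof. by rewrite fine_ge0. Qed.

Lemma cont_boundedM M N h k : 0 <= M -> cont_bounded Om M h -> cont_bounded Om N k ->
  cont_bounded Om (M * N) (fun p => h p * k p).
Proof.
move=> M0 H K p Op; have [ch hM] := H p Op; have [ck kM] := K p Op.
by split; [exact: continuousM|rewrite normrM ler_pM].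
Qed.

Lemma cont_boundedB M N h k : cont_bounded Om M h -> cont_bounded Om N k ->
  cont_bounded Om (M + N) (fun p => h p - k p).
Proof.
move=> H K p Op; have [ch hM] := H p Op; have [ck kM] := K p Op.
by split; [exact: continuousB|rewrite (le_trans (ler_normB _ _))// lerD].
Qed.

Lemma cont_boundedD M N h k : cont_bounded Om M h -> cont_bounded Om N k ->
  cont_bounded Om (M + N) (fun p => h p + k p).
Proof.
move=> H K p Op; have [ch hM] := H p Op; have [ck kM] := K p Op.
by split; [exact: continuousD|rewrite (le_trans (ler_normD _ _))// lerD].
Qed.

Lemma Rint_norm_le h k : intg Om h -> intg Om k -> (forall p, Om p -> `|h p| <= k p) ->
  `|\int[@mu2 R]_(p in Om) h p| <= \int[@mu2 R]_(p in Om) k p.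
Proof.
move=> ih ik hk; apply: (le_trans (le_normr_Rintegral mOm ih)).
by apply: le_Rintegral => //; exact: (integrable_norm ih).
Qed.

Lemma ip_bound h k a b : L2 Om h -> L2 Om k -> (forall p, Om p -> `|h p| <= a) ->
  (forall p, Om p -> `|k p| <= b) -> `|ip Om h k| <= a * b * m0.
Proof.
move=> h2 k2 ha kb.
have ic : intg Om (cst (a * b)) by apply: (L2_intg mOm fOm); exact: L2_cst.
have := Rint_norm_le (L2_intgM mOm h2 k2) ic; rewrite Rintegral_cst//; apply.
by move=> p Op /=; rewrite normrM ler_pM// ?ha ?kb.
Qed.

Definition cross B C (i : 'I_3) (p : R * R) : R :=
  B (i + 1) p * C (i + 2) p - B (i + 2) p * C (i + 1) p.

Definition tint B C w : R :=
  \int[@mu2 R]_(p in Om) triple (fun i => B i p) (fun i => C i p) (fun i => w i p).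

Lemma triple_cross (w B C : 'I_3 -> R * R -> R) p :
  triple (fun i => w i p) (fun i => B i p) (fun i => C i p) =
  \sum_(i < 3) w i p * cross B C i p.
Proof.
have [[e1 e2 e3 e4] [e5 e6]] := ord3_add.
by rewrite sum3 /cross e1 e2 e3 e4 e5 e6.
Qed.

Lemma intg_triple w B C : (forall i, L2 Om (w i)) -> (forall i, L2 Om (cross B C i)) ->
  intg Om (fun p => triple (fun i => w i p) (fun i => B i p) (fun i => C i p)).
Proof.
move=> w2 c2; apply: (@eq_intg _ _ mOm (fun p => \sum_(i < 3) w i p * cross B C i p)).
  by move=> p _; rewrite triple_cross.
by apply: intg_sum => // i; exact: L2_intgM.
Qed.

Lemma tintE w B C : (forall i, L2 Om (w i)) -> (forall i, L2 Om (cross B C i)) ->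
  tint w B C = \sum_(i < 3) ip Om (w i) (cross B C i).
Proof.
move=> w2 c2; rewrite /ip -(Rint_sum mOm); last by move=> i; exact: L2_intgM.
by apply: eq_Rint => p _; rewrite triple_cross.
Qed.

Lemma tint_rot w B C : tint w B C = tint B C w.
Proof. by apply: eq_Rint => p _; rewrite triple_rot. Qed.

Lemma cross_cont M B C i : 0 <= M -> (forall j, cont_bounded Om M (B j)) ->
  (forall j, cont_bounded Om M (C j)) ->
  cont_bounded Om (M * M + M * M) (cross B C i).
Proof. by move=> M0 cB cC; apply: cont_boundedB; exact: cont_boundedM. Qed.

Lemma cross_L2 M B C i : 0 <= M -> (forall j, cont_bounded Om M (B j)) ->
  (forall j, cont_bounded Om M (C j)) -> L2 Om (cross B C i).
Proof. by move=> M0 cB cC; exact: (cont_bounded_L2 oOm bOm (cross_cont i M0 cB cC)). Qed.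

Lemma tint_ibp M d B C B' C' w (W : 'I_3 -> R * R -> R) : 0 <= M ->
  (forall i, H10 Om (w i)) -> (forall i, weak_partial Om d (w i) (W i)) ->
  (forall i, cont_bounded Om M (B i)) -> (forall i, cont_bounded Om M (C i)) ->
  (forall i, cont_bounded Om M (B' i)) -> (forall i, cont_bounded Om M (C' i)) ->
  (forall i p, Om p -> is_derive p (axis d) (B i) (B' i p)) ->
  (forall i p, Om p -> is_derive p (axis d) (C i) (C' i p)) ->
  tint W B C = - (tint w B' C + tint w B C').
Proof.
move=> M0 Hw wW cB cC cB' cC' DB DC.
have w2 i : L2 Om (w i) := H10_L2 (Hw i).
have W2 i : L2 Om (W i) by case: (wW i).
have x0 i := cross_L2 i M0 cB cC.
have x1 i := cross_L2 i M0 cB' cC.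
have x2 i := cross_L2 i M0 cB cC'.
rewrite !tintE// -big_split -sumrN/=; apply: eq_bigr => i _.
rewrite -(ipDr mOm (x1 i) (x2 i) (w2 i)).
apply: (H10_ibp oOm bOm (Hw i) (wW i) (x0 i)).
apply: (classical_weak_partial oOm bOm (x0 i) (L2D mOm (x1 i) (x2 i))).
- by move=> p Op; case: (cross_cont i M0 cB cC Op).
- by move=> p Op; case: (cont_boundedD (cross_cont i M0 cB' cC) (cross_cont i M0 cB cC') Op).
- move=> p Op; have := is_deriveBf (is_deriveMf (DB (i + 1) p Op) (DC (i + 2) p Op))
    (is_deriveMf (DB (i + 2) p Op) (DC (i + 1) p Op)).
  by rewrite /cross /= => H; apply: is_derive_eq H _; ring.
Qed.

End Evolution.

(** * First variation of the Dirichlet and volume integrals *)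

Section States.
Context {R : realType}.
Variable Om : set (R * R).
Hypotheses (oOm : open Om) (bOm : bounded_set Om).
Implicit Types (f g w : 'I_3 -> R * R -> R)
  (F W : 'I_3 -> bool -> R * R -> R) (G : 'I_3 -> bool -> bool -> R * R -> R).

Let mOm := measurable_open_plane oOm.
Let fOm := mu2_bounded_lty oOm bOm.
Let m0 : R := fine (@mu2 R Om).
Let m00 : 0 <= m0. Proof. by rewrite fine_ge0. Qed.

Definition c2_state (M : R) f F G := forall i, [/\ H10 Om (f i), c1_bounded Om M (f i) (F i) &
  forall b, c1_bounded Om M (F i b) (G i b)].

Definition lap G i (p : R * R) : R := G i false false p + G i true true p.

Definition partial_field (b : bool) F i : R * R -> R := F i b.

Lemma c2_state_gradients M f F G : c2_state M f F G ->
  [/\ forall i, L2 Om (f i), forall i b, L2 Om (F i b), forall i b c, L2 Om (G i b c),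
      forall i, gradient Om (f i) (F i) & forall i b, gradient Om (F i b) (G i b)].
Proof.
move=> S; split => [i|i b|i b c|i|i b]; have [Hf c1 c2] := S i.
- exact: H10_L2.
- by have [_ cF _] := c1; exact: (cont_bounded_L2 oOm bOm (cF b)).
- by have [_ cG _] := c2 b; exact: (cont_bounded_L2 oOm bOm (cG c)).
- exact: (c1_gradient oOm bOm c1).
- exact: (c1_gradient oOm bOm (c2 b)).
Qed.

Lemma green M f F G (w : R * R -> R) (W : bool -> R * R -> R) i : c2_state M f F G ->
  H10 Om w -> gradient Om w W -> gip Om W (F i) = - ip Om w (lap G i).
Proof.
move=> S Hw gW; have [_ F2 G2 _ gF] := c2_state_gradients S.
rewrite /gip (H10_ibp oOm bOm Hw (gW false) (F2 i false) (gF i false false)).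
rewrite (H10_ibp oOm bOm Hw (gW true) (F2 i true) (gF i true true)).
by rewrite -opprD -(ipDr mOm (G2 i false false) (G2 i true true) (H10_L2 Hw)).
Qed.

Lemma c2_schwarz M f F G i p : c2_state M f F G -> Om p -> G i true false p = G i false true p.
Proof.
move=> S Op; have [_ [cf cF DF] c2] := S i.
have [_ cGf DGf] := c2 false; have [_ cGt DGt] := c2 true.
apply/esym; apply: (@mixed_partials _ Om (f i) (F i false) (F i true)) => //.
- by case: (cGf true p Op).
- by case: (cGt false p Op).
Qed.

(* Integrating by parts, the mixed derivatives cancel: the volume is a null Lagrangian, so
   its first variation involves no derivative of the variation [w]. *)
Lemma null_lagrangian M f F G w W : 0 <= M -> c2_state M f F G ->
  (forall i, H10 Om (w i)) -> (forall i, gradient Om (w i) (W i)) ->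
  tint Om f (partial_field false W) (partial_field true F) + tint Om f (partial_field false F) (partial_field true W) =
  2 * tint Om w (partial_field false F) (partial_field true F).
Proof.
move=> M0 S Hw gW.
have cf i : cont_bounded Om M (f i) by have [_ [] ] := S i.
have cF b i : cont_bounded Om M (partial_field b F i) by have [_ [_ cF _] _] := S i; exact: cF.
have cG b c i : cont_bounded Om M (G i b c) by have [_ _ /(_ b)[_ cG _]] := S i; exact: cG.
have Df b i p : Om p -> is_derive p (axis b) (f i) (partial_field b F i p).
  by have [_ [_ _ DF] _] := S i; exact: DF.
have DF b c i p : Om p -> is_derive p (axis c) (partial_field b F i) (G i b c p).
  by have [_ _ /(_ b)[_ _ DG]] := S i; exact: DG.
have w2 i : L2 Om (w i) := H10_L2 (Hw i).
have iT (B C : 'I_3 -> R * R -> R) : (forall i, cont_bounded Om M (B i)) ->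
    (forall i, cont_bounded Om M (C i)) ->
    intg Om (fun p => triple (fun i => w i p) (fun i => B i p) (fun i => C i p)).
  by move=> cB cC; apply: intg_triple => // i; exact: (cross_L2 oOm bOm i M0).
have gWb b i : weak_partial Om b (w i) (partial_field b W i) := gW i b.
rewrite [X in X + _](tint_rot _ f) -[X in _ + X](tint_rot _ (partial_field true W)).
rewrite (tint_ibp oOm bOm M0 Hw (gWb false) (cF true) cf (cG true false) (cF false)
  (DF true false) (Df false)).
rewrite (tint_ibp oOm bOm M0 Hw (gWb true) cf (cF false) (cF true) (cG false true)
  (Df true) (DF false true)).
have E1 : tint Om w (partial_field true F) (partial_field false F) = - tint Om w (partial_field false F) (partial_field true F).
  rewrite -mulN1r /tint -(RintZ mOm _ (iT _ _ (cF false) (cF true))).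
  by apply: eq_Rint => p _; rewrite /triple; ring.
have E2 : tint Om w f (fun i => G i false true) = - tint Om w (fun i => G i true false) f.
  rewrite -mulN1r /tint -(RintZ mOm _ (iT _ _ (cG true false) cf)).
  apply: eq_Rint => p Op; rewrite /triple -!(c2_schwarz _ S Op); ring.
rewrite E1 E2; ring.
Qed.

Lemma vol_tint f F : vol Om f F = tint Om f (partial_field false F) (partial_field true F).
Proof. by []. Qed.

Variables (M : R) (f f' : 'I_3 -> R * R -> R) (F F' : 'I_3 -> bool -> R * R -> R)
  (G G' : 'I_3 -> bool -> bool -> R * R -> R) (d e : R).
Hypotheses (M0 : 0 <= M) (d0 : 0 <= d) (S : c2_state M f F G) (S' : c2_state M f' F' G').
Let w i := f' i \- f i.
Let W i b := F' i b \- F i b.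
Hypothesis hw : forall i p, Om p -> `|w i p| <= M * d.
Hypothesis hW : forall i b p, Om p -> `|W i b p| <= e.
Hypothesis hG : forall i b c p, Om p -> `|G' i b c p - G i b c p| <= e.

(** The difference [w] is in H^1_0, so Green's formula applies to it against both states. The second
    identity gains over the pointwise bound on [W]: its right-hand side has size [d * e], where [d]
    will be the time increment. *)
Lemma gip_diff i : gip Om (F' i) (F' i) - gip Om (F i) (F i) =
  - 2 * ip Om (w i) (lap G i) - ip Om (w i) (lap G' i \- lap G i) /\
  gip Om (W i) (W i) = - ip Om (w i) (lap G' i \- lap G i).
Proof.
have [f2 F2 G2 gF _] := c2_state_gradients S; have [f2' F2' G2' gF' _] := c2_state_gradients S'.
have w2 : L2 Om (w i) by exact: L2B.
have l2 : L2 Om (lap G i) by exact: L2D.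
have l2' : L2 Om (lap G' i) by exact: L2D.
have Hw : H10 Om (w i) by apply: H10B => //; [case: (S' i)|case: (S i)].
have gW : gradient Om (w i) (W i) by exact: gradientB.
have g1 := green i S Hw gW; have g2 := green i S' Hw gW.
have W2 b : L2 Om (W i b) by exact: L2B.
rewrite ipBr//; split.
  have E b : ip Om (F' i b) (F' i b) - ip Om (F i b) (F i b) =
      ip Om (W i b) (F' i b) + ip Om (W i b) (F i b).
    by rewrite !(ipBl mOm (F2' i b) (F2 i b))// (ipC _ (F i b) (F' i b)); ring.
  have -> : gip Om (F' i) (F' i) - gip Om (F i) (F i) = gip Om (W i) (F' i) + gip Om (W i) (F i).
    by rewrite /gip addrACA -!E; ring.
  by rewrite g1 g2; ring.
have -> : gip Om (W i) (W i) = gip Om (W i) (F' i) - gip Om (W i) (F i).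
  by rewrite /gip !ipBr//; ring.
by rewrite g1 g2; ring.
Qed.

Lemma ip_lap_diff i : `|ip Om (w i) (lap G' i \- lap G i)| <= M * d * (2 * e) * m0.
Proof.
have [f2 F2 G2 gF _] := c2_state_gradients S; have [f2' F2' G2' gF' _] := c2_state_gradients S'.
apply: (ip_bound oOm bOm) => //.
- exact: L2B.
- by apply: L2B => //; exact: L2D.
- exact: hw.
move=> p Op; have -> : (lap G' i \- lap G i) p =
    (G' i false false p - G i false false p) + (G' i true true p - G i true true p).
  by rewrite /lap /=; ring.
by rewrite mulrDl mul1r (le_trans (ler_normD _ _))// lerD// hG.
Qed.

(** The first variation has three terms; by [null_lagrangian] the two containing derivatives of [w]
    equal twice the third, whence the factor 3. The quadratic remainder is integrated through
    [gip_diff]. *)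
Lemma vol_diff : `|vol Om f' F' - vol Om f F - 3 * tint Om w (partial_field false F) (partial_field true F)| <=
  18 * M ^+ 2 * m0 * d * e.
Proof.
have [f2 F2 G2 gF _] := c2_state_gradients S; have [f2' F2' G2' gF' _] := c2_state_gradients S'.
have Hw i : H10 Om (w i) by apply: H10B => //; [case: (S' i)|case: (S i)].
have w2 i : L2 Om (w i) := H10_L2 (Hw i).
have gW i : gradient Om (w i) (W i) by exact: gradientB.
have W2 i b : L2 Om (W i b) by exact: L2B.
have fM i p : Om p -> `|f i p| <= M by have [_ [cf _ _] _] := S i => /cf[].
have fM' i p : Om p -> `|f' i p| <= M by have [_ [cf _ _] _] := S' i => /cf[].
have FM i b p : Om p -> `|F i b p| <= M by have [_ [_ cF _] _] := S i => /(cF b)[].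
have iv := intg_voldens oOm (fun i => (f2 i).1) fM F2.
have iv' := intg_voldens oOm (fun i => (f2' i).1) fM' F2'.
have cF b i : cont_bounded Om M (partial_field b F i) by have [_ [_ cF _] _] := S i; exact: cF.
have cf i : cont_bounded Om M (f i) by have [_ [] ] := S i.
have i1 : intg Om (fun p => triple (fun i => w i p) (fun i => F i false p) (fun i => F i true p)).
  exact: (intg_triple oOm w2 (fun i => cross_L2 oOm bOm i M0 (cF false) (cF true))).
have i2 : intg Om (fun p => triple (fun i => f i p) (fun i => W i false p) (fun i => F i true p)).
  apply: (@eq_intg _ _ mOm (fun p => triple (fun i => W i false p) (fun i => F i true p) (fun i => f i p))).
    by move=> p _; rewrite -triple_rot.
  exact: (intg_triple oOm (fun i => W2 i false) (fun i => cross_L2 oOm bOm i M0 (cF true) cf)).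
have i3 : intg Om (fun p => triple (fun i => f i p) (fun i => F i false p) (fun i => W i true p)).
  apply: (@eq_intg _ _ mOm (fun p => triple (fun i => W i true p) (fun i => f i p) (fun i => F i false p))).
    by move=> p _; rewrite triple_rot.
  exact: (intg_triple oOm (fun i => W2 i true) (fun i => cross_L2 oOm bOm i M0 cf (cF false))).
have E : 3 * tint Om w (partial_field false F) (partial_field true F) = \int[@mu2 R]_(p in Om)
   (triple (fun i => w i p) (fun i => F i false p) (fun i => F i true p) +
    triple (fun i => f i p) (fun i => W i false p) (fun i => F i true p) +
    triple (fun i => f i p) (fun i => F i false p) (fun i => W i true p)).
  rewrite (RintD mOm (intgD mOm i1 i2) i3) (RintD mOm i1 i2) -addrA.
  have -> : 3 * tint Om w (partial_field false F) (partial_field true F) =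
    tint Om w (partial_field false F) (partial_field true F) + 2 * tint Om w (partial_field false F) (partial_field true F) by ring.
  by rewrite -(null_lagrangian M0 S Hw gW).
rewrite E /vol -(RintB mOm iv' iv) -(RintB mOm (intgB mOm iv' iv) (intgD mOm (intgD mOm i1 i2) i3)).
pose q i p := W i false p ^+ 2 + W i true p ^+ 2.
have iq i : intg Om (q i) by apply: intgD => //; exact: L2_sqr.
have iQ : intg Om (fun p => \sum_(i < 3) q i p) by exact: intg_sum.
have ic : intg Om (cst (12 * M * (M * d) * e)) by apply: (L2_intg mOm fOm); exact: L2_cst.
have iMQ := intgZ mOm M iQ.
apply: (le_trans (Rint_norm_le oOm (intgB mOm (intgB mOm iv' iv) (intgD mOm (intgD mOm i1 i2) i3))
   (intgD mOm ic iMQ) _)).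
  move=> p Op /=; apply: triple_remainder => i; [exact: fM'|exact: FM|exact: FM|exact: hw|exact: hW|exact: hW].
rewrite (RintD mOm ic iMQ) (RintZ mOm _ iQ) (Rint_sum mOm _ iq) Rintegral_cst//.
have Hq i : \int[@mu2 R]_(p in Om) q i p <= M * d * (2 * e) * m0.
  rewrite (RintD mOm (L2_sqr (W2 i false)) (L2_sqr (W2 i true))).
  rewrite -[X in X + _]/(L2sq Om (W i false)) -[X in _ + X]/(L2sq Om (W i true)) !L2sqE.
  rewrite -[leLHS]/(gip Om (W i) (W i)) (gip_diff i).2.
  by rewrite (le_trans _ (ip_lap_diff i))// -normrN ler_norm.
(* The constant 18 is 12 from the remainder containing [w] plus 2 for each of the three
   coordinates. *)
apply: (@le_trans _ _ (12 * M * (M * d) * e * m0 + M * (\sum_(i < 3) M * d * (2 * e) * m0))).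
  by rewrite lerD2l ler_wpM2l//; apply: ler_sum => i _; exact: Hq.
rewrite sumr_const card_ord -mulr_natr; rewrite le_eqVlt; apply/orP; left; apply/eqP; ring.
Qed.

End States.

(** The weight [2 * H0 / 3] of the volume times the factor 3 of its first variation is [2 * H0],
    which cancels the wedge term brought in by the equation for the Laplacian. *)
Lemma energy_increment (R : realType) (A B S t H0 k V V' D r h Dg : R) : k = 2 * H0 / 3 ->
  A - B = - 2 * (S + 2 * H0 * t) - r -> S = D + h * Dg ->
  2^-1 * A + k * V' - (2^-1 * B + k * V) - h * - Dg =
  - D - 2^-1 * r + k * (V' - V - 3 * t).
Proof.
move=> -> h1 h2; have -> : A = B + - 2 * (S + 2 * H0 * t) - r by rewrite -[RHS]addrA -h1; ring.
by rewrite h2; field.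
Qed.

Lemma norm_sum3_le (R : realType) (x : 'I_3 -> R) (c : R) : (forall i, `|x i| <= c) ->
  `|\sum_(i < 3) x i| <= 3 * c.
Proof.
move=> H; apply: (le_trans (ler_norm_sum _ _ _)); apply: (@le_trans _ _ (\sum_(i < 3) c)).
  exact: ler_sum.
by rewrite sumr_const card_ord -[leLHS]mulr_natl.
Qed.

(** * Increments of mass and energy for solutions of the equation *)

Section Increments.
Context {R : realType}.
Variable Om : set (R * R).
Hypotheses (oOm : open Om) (bOm : bounded_set Om).

Let mOm := measurable_open_plane oOm.
Let fOm := mu2_bounded_lty oOm bOm.
Let m0 : R := fine (@mu2 R Om).
Let m00 : 0 <= m0. Proof. by rewrite fine_ge0. Qed.

Definition field_energy (H0 : R) (f : 'I_3 -> R * R -> R) (F : 'I_3 -> bool -> R * R -> R) : R :=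
  2^-1 * \sum_(i < 3) gip Om (F i) (F i) + 2 * H0 / 3 * vol Om f F.

Definition heat_rhs (H0 : R) (F : 'I_3 -> bool -> R * R -> R)
    (G : 'I_3 -> bool -> bool -> R * R -> R) i p : R :=
  lap G i p - 2 * H0 * cross (partial_field false F) (partial_field true F) i p.

Variables (H0 M : R) (f : 'I_3 -> R * R -> R) (F : 'I_3 -> bool -> R * R -> R)
  (G : 'I_3 -> bool -> bool -> R * R -> R) (g : 'I_3 -> R * R -> R).
Hypotheses (M0 : 0 <= M) (S : c2_state Om M f F G).
Hypothesis cg : forall i, cont_bounded Om M (g i).
Hypothesis gE : forall i p, Om p -> g i p = heat_rhs H0 F G i p.

Let crossF i := cross (partial_field false F) (partial_field true F) i.

Let cross2 i : L2 Om (crossF i).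
Proof.
have cF b i' : cont_bounded Om M (partial_field b F i') by have [_ [_ cF _] _] := S i'; exact: cF.
exact: (cross_L2 oOm bOm i M0 (cF false) (cF true)).
Qed.

Let g2 i : L2 Om (g i). Proof. exact: (cont_bounded_L2 oOm bOm (cg i)). Qed.

Lemma ip_lapE (w : R * R -> R) i : L2 Om w ->
  ip Om w (lap G i) = ip Om w (g i) + 2 * H0 * ip Om w (crossF i).
Proof.
move=> w2; rewrite -(ipZr mOm _ w2 (cross2 i)) -(ipDr mOm (g2 i) (L2Z mOm _ (cross2 i)) w2).
by apply: eq_ip => // p Op; rewrite /= gE// /heat_rhs subrK.
Qed.

(** Testing with [f] gives the volume the coefficient [- 4 * H0], which is -6 times its weight in
    the energy; this is the origin of the 6. *)
Lemma mass_eq : 2 * \sum_(i < 3) ip Om (f i) (g i) =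
  - 6 * field_energy H0 f F + \sum_(i < 3) gip Om (F i) (F i).
Proof.
have [f2 F2 G2 gF _] := c2_state_gradients oOm bOm S.
have E i : ip Om (f i) (g i) = - gip Om (F i) (F i) - 2 * H0 * ip Om (f i) (crossF i).
  have Hf : H10 Om (f i) by case: (S i).
  by rewrite (green oOm bOm i S Hf (gF i)) ip_lapE//; ring.
rewrite /field_energy (eq_bigr _ (fun i _ => E i)) sumrB -mulr_sumr sumrN.
rewrite vol_tint (tintE oOm f2 cross2).
by move: (\sum_(i < 3) gip _ _ _) (\sum_(i < 3) ip _ _ _) => x y; field.
Qed.

Variables (f' : 'I_3 -> R * R -> R) (F' : 'I_3 -> bool -> R * R -> R)
  (G' : 'I_3 -> bool -> bool -> R * R -> R) (h e : R).
Hypotheses (e0 : 0 <= e) (S' : c2_state Om M f' F' G').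
Hypothesis hw : forall i p, Om p -> `|(f' i \- f i) p| <= M * `|h|.
Hypothesis hW : forall i b p, Om p -> `|(F' i b \- F i b) p| <= e.
Hypothesis hG : forall i b c p, Om p -> `|G' i b c p - G i b c p| <= e.
Hypothesis hg : forall i p, Om p -> `|f' i p - f i p - h * g i p| <= e * `|h|.

Let w i := f' i \- f i.
Let f2 i : L2 Om (f i). Proof. by have [+ _ _ _ _] := c2_state_gradients oOm bOm S; exact. Qed.
Let f2' i : L2 Om (f' i). Proof. by have [+ _ _ _ _] := c2_state_gradients oOm bOm S'; exact. Qed.
Let w2 i : L2 Om (w i). Proof. exact: L2B. Qed.

Let ip_increment k c i : L2 Om k -> (forall p, Om p -> `|k p| <= c) ->
  `|ip Om (w i) k - h * ip Om (g i) k| <= e * `|h| * c * m0.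
Proof.
move=> k2 kc; have hg2 := L2Z mOm h (g2 i).
rewrite -(ipZl mOm h (g2 i) k2) -(ipBl mOm (w2 i) hg2 k2).
by apply: (ip_bound oOm bOm) => //; [exact: L2B|move=> p; exact: hg].
Qed.

(** The first variation of the energy in the direction [w] is minus the inner product of [w] with
    [g], and [w] is [h * g] up to [e * h]. All other terms are products of [h] and [e], so dividing
    by [h] gives the derivative. *)
Lemma energy_diff : `|field_energy H0 f' F' - field_energy H0 f F - h * - \sum_(i < 3) ip Om (g i) (g i)| <=
  (6 * M + 12 * `|H0| * M ^+ 2) * m0 * e * `|h|.
Proof.
pose r := \sum_(i < 3) ip Om (w i) (lap G' i \- lap G i).
pose D := \sum_(i < 3) (ip Om (w i) (g i) - h * ip Om (g i) (g i)).
pose t := tint Om w (partial_field false F) (partial_field true F).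
have E1 : \sum_(i < 3) gip Om (F' i) (F' i) - \sum_(i < 3) gip Om (F i) (F i) =
    - 2 * (\sum_(i < 3) ip Om (w i) (g i) + 2 * H0 * t) - r.
  rewrite /t (tintE oOm w2 cross2) /r mulr_sumr -big_split mulr_sumr -!sumrB/=.
  apply: eq_bigr => i _.
  by rewrite (gip_diff oOm bOm S S' i).1 (ip_lapE i (w2 i)).
have E2 : \sum_(i < 3) ip Om (w i) (g i) = D + h * \sum_(i < 3) ip Om (g i) (g i).
  by rewrite /D sumrB -mulr_sumr subrK.
rewrite /field_energy (energy_increment (vol Om f F) (vol Om f' F') erefl E1 E2).
have gM i p : Om p -> `|g i p| <= M by move=> /(cg i)[].
have b1 : `|D| <= 3 * (e * `|h| * M * m0).
  by apply: norm_sum3_le => i; apply: ip_increment => // p; exact: gM.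
have b2 : `|r| <= 3 * (M * `|h| * (2 * e) * m0).
  by apply: norm_sum3_le => i; exact: (ip_lap_diff oOm bOm S S' hw hG).
have b3 : `|vol Om f' F' - vol Om f F - 3 * t| <= 18 * M ^+ 2 * m0 * `|h| * e.
  exact: (vol_diff oOm bOm M0 S S' hw hW hG).
move: (_ - _ - 3 * t) b3 => v b3.
have -> : (6 * M + 12 * `|H0| * M ^+ 2) * m0 * e * `|h| = 3 * (e * `|h| * M * m0) +
   2^-1 * (3 * (M * `|h| * (2 * e) * m0)) + 2 * `|H0| / 3 * (18 * M ^+ 2 * m0 * `|h| * e) by field.
apply: (le_trans (ler_normD _ _)); apply: lerD.
  apply: (le_trans (ler_normB _ _)); apply: lerD; first by rewrite normrN.
  by rewrite normrM ger0_norm// ler_wpM2l.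
by rewrite !normrM normfV !normr_nat ler_wpM2l// mulr_ge0// mulr_ge0.
Qed.

Lemma mass_diff : `|h| <= e ->
  `|\sum_(i < 3) ip Om (f' i) (f' i) - \sum_(i < 3) ip Om (f i) (f i) -
    h * (2 * \sum_(i < 3) ip Om (f i) (g i))| <= (6 * M + 3 * M ^+ 2) * m0 * e * `|h|.
Proof.
move=> he.
have E i : ip Om (f' i) (f' i) - ip Om (f i) (f i) - h * (2 * ip Om (f i) (g i)) =
    2 * (ip Om (w i) (f i) - h * ip Om (g i) (f i)) + ip Om (w i) (w i).
  have E' : ip Om (f' i) (f' i) = ip Om (f i) (f i) + 2 * ip Om (w i) (f i) + ip Om (w i) (w i).
    rewrite (ipC _ (w i) (f i)) -(ip_sqrD mOm (f2 i) (w2 i)).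
    by apply: eq_ip => p _ /=; rewrite addrC subrK.
  by rewrite E' (ipC _ (f i) (g i)); ring.
rewrite !mulr_sumr -!sumrB (eq_bigr _ (fun i _ => E i)).
have -> : (6 * M + 3 * M ^+ 2) * m0 * e * `|h| =
  3 * (2 * (e * `|h| * M * m0) + M ^+ 2 * m0 * e * `|h|) by ring.
apply: norm_sum3_le => i; apply: (le_trans (ler_normD _ _)); apply: lerD.
  rewrite normrM normr_nat ler_wpM2l//; apply: ip_increment => // p.
  by have [_ [cf _ _] _] := S i => /cf[].
apply: (le_trans (ip_bound oOm bOm (w2 i) (w2 i) (hw i) (hw i))).
(* The square of the increment is quadratic in [h]; the hypothesis [|h| <= e] trades one factor for
   [e]. *)
have -> : M * `|h| * (M * `|h|) * m0 = M ^+ 2 * m0 * `|h| * `|h| by ring.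
have -> : M ^+ 2 * m0 * e * `|h| = M ^+ 2 * m0 * `|h| * e by ring.
by rewrite ler_wpM2l// !mulr_ge0// exprn_ge0.
Qed.

End Increments.

(** * Differential inequalities at a fixed time *)

Section LocalEvolution.
Context {R : realType}.
Variable Om : set (R * R).
Hypotheses (oOm : open Om) (bOm : bounded_set Om).

Let mOm := measurable_open_plane oOm.

Variables (H0 lam M d0 s : R) (f : R -> 'I_3 -> R * R -> R)
  (F : R -> 'I_3 -> bool -> R * R -> R) (G : R -> 'I_3 -> bool -> bool -> R * R -> R)
  (g : 'I_3 -> R * R -> R) (Y En : R -> R).
Hypotheses (M0 : 0 <= M) (d00 : 0 < d0) (hlam : first_eigenvalue Om lam).
Hypothesis state : forall r, `|r - s| < d0 -> c2_state Om M (f r) (F r) (G r).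
Hypothesis cg : forall i, cont_bounded Om M (g i).
Hypothesis gE : forall i p, Om p -> g i p = heat_rhs H0 (F s) (G s) i p.
Hypothesis lip : forall r i p, `|r - s| < d0 -> Om p ->
  `|f r i p - f s i p| <= M * `|r - s|.
Hypothesis equi : forall e, 0 < e -> exists2 d, 0 < d & forall r i p, `|r - s| < d -> Om p ->
  [/\ forall b, `|F r i b p - F s i b p| <= e,
      forall b c, `|G r i b c p - G s i b c p| <= e &
      `|f r i p - f s i p - (r - s) * g i p| <= e * `|r - s|].
Hypothesis YE : forall r, `|r - s| < d0 -> Y r = \sum_(i < 3) ip Om (f r i) (f r i).
Hypothesis EnE : forall r, `|r - s| < d0 -> En r = field_energy Om H0 (f r) (F r).

Lemma sum_ip_CS (h k : 'I_3 -> R * R -> R) : (forall i, L2 Om (h i)) -> (forall i, L2 Om (k i)) ->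
  (\sum_(i < 3) ip Om (h i) (k i)) ^+ 2 <=
  (\sum_(i < 3) ip Om (h i) (h i)) * \sum_(i < 3) ip Om (k i) (k i).
Proof.
move=> h2 k2; apply: discriminant_le0; first by apply: sumr_ge0 => i _; exact: ip_ge0.
move=> t; rewrite !mulr_sumr -!big_split/=; apply: sumr_ge0 => i _.
by rewrite -(ipDZ oOm t (h2 i) (k2 i)) ip_ge0.
Qed.

Lemma local_evolution : exists D y' : R,
  [/\ is_derive s 1 Y y', is_derive s 1 En (- D), 0 <= D, lam * Y s - 6 * En s <= y' &
      y' ^+ 2 <= 4 * Y s * D].
Proof.
have ss : `|s - s| < d0 by rewrite subrr normr0.
have Ss := state ss; have [f2 F2 G2 gF _] := c2_state_gradients oOm bOm Ss.
have g2 i : L2 Om (g i) := cont_bounded_L2 oOm bOm (cg i).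
have small e : 0 < e -> exists2 d, 0 < d & forall r, `|r - s| < d ->
    [/\ `|r - s| < d0, `|r - s| <= e, forall i p, Om p -> `|(f r i \- f s i) p| <= M * `|r - s|,
      forall i b p, Om p -> `|(F r i b \- F s i b) p| <= e &
      (forall i b c p, Om p -> `|G r i b c p - G s i b c p| <= e) /\
      forall i p, Om p -> `|f r i p - f s i p - (r - s) * g i p| <= e * `|r - s|].
  move=> e0; have [d dp Hd] := equi e0.
  exists (Num.min (Num.min d d0) e); first by rewrite !lt_min dp d00.
  move=> r; rewrite !lt_min => /andP[/andP[rd rd0] re].
  split => [//||i p Op|i b p Op|]; last split=> [i b c p Op|i p Op].
  - exact: ltW.
  - exact: lip.
  - by have [H1 _ H3] := Hd r i p rd Op; (exact: H1 || exact: H3).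
  - by have [_ H _] := Hd r i p rd Op; exact: H.
  - by have [H1 _ H3] := Hd r i p rd Op; (exact: H1 || exact: H3).
exists (\sum_(i < 3) ip Om (g i) (g i)), (2 * \sum_(i < 3) ip Om (f s i) (g i)); split.
- apply: (@is_derive_littleo _ _ _ _ ((6 * M + 3 * M ^+ 2) * fine (@mu2 R Om))) => e e0.
  have [d dp Hd] := small e e0; exists d => // r /Hd[rd0 re hw hW [hG hg]].
  rewrite !YE//; exact: (mass_diff oOm bOm M0 Ss cg (state rd0) hw hg re).
- apply: (@is_derive_littleo _ _ _ _ ((6 * M + 12 * `|H0| * M ^+ 2) * fine (@mu2 R Om))) => e e0.
  have [d dp Hd] := small e e0; exists d => // r /Hd[rd0 re hw hW [hG hg]].
  rewrite !EnE//; exact: (energy_diff oOm bOm M0 Ss cg gE (state rd0) hw hW hG hg).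
- by apply: sumr_ge0 => i _; exact: ip_ge0.
- rewrite (mass_eq oOm bOm M0 Ss cg gE) -EnE// YE// mulNr [leRHS]addrC lerD2r mulr_sumr.
  apply: ler_sum => i _; apply: (poincare oOm bOm hlam) => //.
  by case: (Ss i).
- rewrite exprMn YE// -[2 ^+ 2]/(2 * 2 : R) -natrM -mulrA ler_wpM2l//; exact: sum_ip_CS.
Qed.

End LocalEvolution.

(** * Regular solutions *)

Lemma entry_le_norm (R : realType) n (v : 'rV[R]_n) i : `|v 0 i| <= `|v|.
Proof.
rewrite -[leRHS]/(mx_norm v) mx_normrE.
exact: (le_bigmax_cond _ (fun ij : 'I_1 * 'I_n => `|v ij.1 ij.2|) (j := (0, i)) (P := xpredT)).
Qed.
Lemma powR_small (R : realType) (a e : R) : 0 < a -> 0 < e -> exists2 d, 0 < d &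
  forall h : R, `|h| < d -> `|h| `^ a <= e.
Proof.
move=> a0 e0; exists (e `^ a^-1); first exact: powR_gt0.
move=> h hd; have E : (e `^ a^-1) `^ a = e by rewrite -powRrM mulVf ?gt_eqF// powRr1// ltW.
by rewrite -[leRHS]E ge0_ler_powR ?nnegrE ?powR_ge0// ltW.
Qed.
Lemma holder_continuous (R : realType) (U : set (R * R)) (k : R * R -> R) (M a : R) p :
  open U -> U p -> 0 < a ->
  (forall q, U q -> `|k p - k q| <= M * `|p - q| `^ a) -> {for p, continuous k}.
Proof.
move=> oU Up a0 H; apply/cvgrPdist_le => e e0.
have C0 : 0 < `|M| + 1 by rewrite ltr_wpDl.
have [|d d0 Hd] := @powR_small R a (e / (`|M| + 1)) a0; first by rewrite divr_gt0.
have NU : nbhs p U by apply: open_nbhs_nbhs; split.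
have Nd : nbhs p (ball p d) by exact: nbhsx_ballx.
near=> q; have Uq : U q by near: q; exact: NU.
have pq : `|p - q| < d.
  have : ball p d q by near: q; exact: Nd.
  by rewrite -ball_normE.
have := Hd `|p - q|; rewrite normr_id => /(_ pq) h.
apply: (le_trans (H q Uq)); apply: (@le_trans _ _ ((`|M| + 1) * `|p - q| `^ a)).
  by rewrite ler_wpM2r ?powR_ge0// (le_trans (ler_norm _))// lerDl.
by rewrite mulrC -ler_pdivlMr.
Unshelve. all: by end_near.
Qed.

Section Regularity.
Context {R : realType}.
Variable Om : set (R * R).
Hypotheses (oOm : open Om) (bOm : bounded_set Om).
Implicit Types (u U : R -> R * R -> 'rV[R]_3).

Definition entry_holder (a : R) (I : set R) (M : R) U :=
  forall t s p q i, I t -> I s -> Om p -> Om q ->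
  `|U t p 0 i| <= M /\
  `|U t p 0 i - U s q 0 i| <= M * (`|p - q| `^ a + `|t - s| `^ (a / 2)).

Lemma entry_holder_le a I M N U : M <= N -> entry_holder a I M U -> entry_holder a I N U.
Proof.
move=> MN H t s p q i It Is Op Oq; have [h1 h2] := H t s p q i It Is Op Oq.
by split; [exact: le_trans MN|rewrite (le_trans h2)// ler_wpM2r// addr_ge0 ?powR_ge0].
Qed.

Lemma holder_entry a A I U : Om `<=` A -> parabolic_holder a A I U ->
  exists2 M, 0 <= M & entry_holder a I M U.
Proof.
move=> OA [M H]; exists `|M|; first exact: normr_ge0.
apply: (@entry_holder_le _ _ M); first exact: ler_norm.
move=> t s p q i It Is /OA Ap /OA Aq; have [h1 h2] := H t s p q It Is Ap Aq.
split; first exact: le_trans (entry_le_norm _ _) h1.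
by apply: le_trans h2; have := entry_le_norm (U t p - U s q) i; rewrite !mxE.
Qed.

Lemma entry_cont_bounded a I M U t i : 0 < a -> I t -> entry_holder a I M U ->
  cont_bounded Om M (fun p => U t p 0 i).
Proof.
move=> a0 It H p Op; split; last by case: (H t t p p i It It Op Op).
apply: (@holder_continuous _ _ _ M a _ oOm Op a0) => q Oq.
have [_] := H t t p q i It It Op Oq.
have a20 : a / 2 != 0 by rewrite gt_eqF// divr_gt0.
by rewrite subrr normr0 (powR0 a20) addr0 => h; exact: h.
Qed.

Lemma entry_time_small a (I : set R) M U e : 0 < a -> 0 <= M -> entry_holder a I M U -> 0 < e ->
  exists d, 0 < d /\ forall t s p i, I t -> I s -> Om p -> `|t - s| < d ->
    `|U t p 0 i - U s p 0 i| <= e.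
Proof.
move=> a0 M0 H e0; have a20 : 0 < a / 2 by rewrite divr_gt0.
have M1 : 0 < M + 1 by rewrite ltr_wpDl.
have [|d d0 Hd] := @powR_small R (a / 2) (e / (M + 1)) a20; first by rewrite divr_gt0.
exists d; split=> // t s p i It Is Op /Hd h; have [_] := H t s p p i It Is Op Op.
rewrite subrr normr0 powR0 ?gt_eqF// add0r => /le_trans; apply.
apply: (@le_trans _ _ ((M + 1) * `|t - s| `^ (a / 2))).
  by rewrite ler_wpM2r ?powR_ge0// lerDl.
by rewrite mulrC -ler_pdivlMr.
Qed.

Lemma solution_evolution (H0 lam : R) V (u0 : R * R -> 'rV[R]_3) T u :
  first_eigenvalue Om lam -> volume_extension Om V ->
  regular_solution Om H0 u0 T u -> forall s : R, 0 < s -> (s%:E < T)%E -> exists D y' : R,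
  [/\ is_derive s 1 (fun r => vL2norm Om (u r) ^+ 2) y',
      is_derive s 1 (fun r => energy Om H0 V (u r)) (- D), 0 <= D,
      lam * vL2norm Om (u s) ^+ 2 - 6 * energy Om H0 V (u s) <= y' &
      y' ^+ 2 <= 4 * vL2norm Om (u s) ^+ 2 * D].
Proof.
move=> hlam hV [[a /andP[a0 _] [Hd Hh]] [Heq _ _ HH10 _]] s s0 sT.
(* The Hölder estimates hold on compact time intervals only, so [s] is enclosed in [[s / 2, t2]];
   [T] may be infinite. *)
have [t2 st2 t2T] : exists2 t2, s < t2 & (t2%:E < T)%E.
  case: T sT {Hd Hh Heq HH10} => [r| |] //.
    by rewrite lte_fin => sr; exists ((s + r) / 2); rewrite ?lte_fin; lra.
  by move=> _; exists (s + 1); rewrite ?ltry// ltrDl.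
have s20 : 0 < s / 2 by rewrite divr_gt0.
have ss2 : s / 2 < s by lra.
have [Hu Hg HF HG] := Hh (s / 2) t2 s20 (ltW (lt_trans ss2 st2)) t2T.
set I := [set t | _] in Hu Hg HF HG.
have [M1 M10 E1] := holder_entry (@subset_closure _ Om) Hu.
have [M2 M20 E2] := holder_entry (@subset_refl _ Om) Hg.
have /choice[M3 HM3] : forall b, exists M, 0 <= M /\ entry_holder a I M (dspace b u).
  by move=> b; have [M ? ?] := holder_entry (@subset_refl _ Om) (HF b); exists M.
have /choice[M4 HM4] : forall bc : bool * bool, exists M, 0 <= M /\
    entry_holder a I M (dspace bc.2 (dspace bc.1 u)).
  by move=> [b c]; have [M ? ?] := holder_entry (@subset_refl _ Om) (HG b c); exists M.
(* One constant above all the Hölder bounds; the summand 1 secures the [1 <= M] that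
   [volume_classical] asks for. *)
pose M := 1 + (M1 + M2 + \sum_(b : bool) M3 b + \sum_(bc : bool * bool) M4 bc).
have S30 : 0 <= \sum_(b : bool) M3 b by apply: sumr_ge0 => b _; case: (HM3 b).
have S40 : 0 <= \sum_(bc : bool * bool) M4 bc by apply: sumr_ge0 => b _; case: (HM4 b).
have Mge1 : 1 <= M by rewrite lerDl !addr_ge0.
have M0 : 0 <= M by rewrite (le_trans _ Mge1).
have M3le b : M3 b <= M.
  have : M3 b <= \sum_(b : bool) M3 b.
    by rewrite (bigD1 b)//= lerDl sumr_ge0// => c _; case: (HM3 c).
  by rewrite /M; move: (\sum_(_ : bool) _) (\sum_(_ : bool * bool) _) S30 S40 => x y; lra.
have M4le bc : M4 bc <= M.
  have : M4 bc <= \sum_(bc : bool * bool) M4 bc.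
    by rewrite (bigD1 bc)//= lerDl sumr_ge0// => c _; case: (HM4 c).
  by rewrite /M; move: (\sum_(_ : bool) _) (\sum_(_ : bool * bool) _) S30 S40 => x y; lra.
have {}E1 : entry_holder a I M u.
  apply: entry_holder_le E1; rewrite /M.
  by move: (\sum_(_ : bool) _) (\sum_(_ : bool * bool) _) S30 S40 => x y; lra.
have {}E2 : entry_holder a I M (dt u).
  apply: entry_holder_le E2; rewrite /M.
  by move: (\sum_(_ : bool) _) (\sum_(_ : bool * bool) _) S30 S40 => x y; lra.
have E3 b : entry_holder a I M (dspace b u) by apply: entry_holder_le (M3le b) _; case: (HM3 b).
have E4 b c : entry_holder a I M (dspace c (dspace b u)).
  by apply: entry_holder_le (M4le (b, c)) _; case: (HM4 (b, c)).
have IT t : I t -> 0 < t /\ (t%:E < T)%E.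
  move=> /andP[t1 tt2]; split; first exact: lt_le_trans t1.
  by apply: le_lt_trans t2T; rewrite lee_fin.
pose d0 := Num.min (s / 2) (t2 - s).
have d00 : 0 < d0 by rewrite lt_min s20 subr_gt0.
have Id r : `|r - s| < d0 -> I r.
  by rewrite lt_min !ltr_distl /I /= => /andP[/andP[h1 h2] /andP[h3 h4]]; lra.
have Is : I s by apply: Id; rewrite subrr normr0.
pose f r i := coord (u r) i.
pose F r i b : R * R -> R := fun p => dspace b u r p 0 i.
pose G r i b c : R * R -> R := fun p => dspace c (dspace b u) r p 0 i.
pose g r i : R * R -> R := fun p => dt u r p 0 i.
have c1 r i : I r -> c1_bounded Om M (f r i) (F r i).
  move=> Ir; have [r0 rT] := IT r Ir; split => [|b|b p Op].
  - exact: entry_cont_bounded a0 Ir E1.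
  - exact: entry_cont_bounded a0 Ir (E3 b).
  - have [_ dv _] := Hd r p r0 rT Op; exact: (derive_coord i (dv b)).
have state r : I r -> c2_state Om M (f r) (F r) (G r).
  move=> Ir; have [r0 rT] := IT r Ir => i; split => [||b].
  - exact: HH10 (ltW r0) rT i.
  - exact: c1.
  - split => [|c|c p Op].
    + exact: entry_cont_bounded a0 Ir (E3 b).
    + exact: entry_cont_bounded a0 Ir (E4 b c).
    + have [_ _ dv] := Hd r p r0 rT Op; exact: (derive_coord i (dv b c)).
have Dt r i p : I r -> Om p -> is_derive r 1 (fun q => f q i p) (g r i p).
  move=> Ir Op; have [r0 rT] := IT r Ir.
  have [dv _ _] := Hd r p r0 rT Op; exact: (derive_coord i dv).
(* The bound on u_t turns this into the Lipschitz estimate, and its modulus of continuity turns it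
   into the first-order expansion, both uniformly in [p]. *)
have mvt r i p : `|r - s| < d0 -> Om p -> exists c, [/\ I c, `|c - s| <= `|r - s| &
    f r i p - f s i p = g c i p * (r - s)].
  move=> rd Op; have Ir := Id r rd.
  have Ic c : Num.min r s <= c <= Num.max r s -> I c.
    move=> /andP[h1 h2]; move: Ir Is => /andP[h3 h4] /andP[h5 h6]; apply/andP; split.
      by apply: le_trans h1; rewrite le_min h3.
    by apply: (le_trans h2); rewrite ge_max h4.
  have [|c hc e] := @mean_value R (fun q => f q i p) (fun q => g q i p) r s.
    by move=> z /Ic Iz; exact: Dt.
  exists c; split => //; first exact: Ic.
  move: hc; have [rs|sr] := boolP (r <= s).
    rewrite (min_idPl rs) (max_idPr rs) => /andP[h1 h2].
    by rewrite !ler0_norm ?subr_le0// lerN2 lerD2r.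
  move: sr; rewrite -ltNge => /ltW sr; rewrite (min_idPr sr) (max_idPl sr) => /andP[h1 h2].
  by rewrite !ger0_norm ?subr_ge0// lerD2r.
apply: (@local_evolution R Om oOm bOm H0 lam M d0 s f F G (g s)) => //.
- by move=> r /Id; exact: state.
- by move=> i; exact: entry_cont_bounded a0 Is E2.
- move=> i p Op; rewrite /g Heq// /heat_rhs /lap /G /cross /partial_field /F !mxE.
  by rewrite /dspace.
- move=> r i p rd Op; have [c [Ic _ ->]] := mvt r i p rd Op.
  by rewrite normrM ler_wpM2r//; case: (E2 c c p p i Ic Ic Op Op).
- move=> e e0.
  have [dg [dg0 Hg']] := entry_time_small a0 M0 E2 e0.
  have /choice[dF HdF] := fun b => entry_time_small a0 M0 (E3 b) e0.
  have /choice[dG HdG] := fun bc : bool * bool => entry_time_small a0 M0 (E4 bc.1 bc.2) e0.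
  (* A single radius for u_t and all first and second space derivatives. It does not depend on the
     point, because the Hölder constants hold on all of [Om]. *)
  pose d := \big[Num.min/Num.min dg d0]_(b : bool) dF b.
  pose d' := \big[Num.min/d]_(bc : bool * bool) dG bc.
  exists d'.
    apply: lt_bigmin => [|bc _]; last by case: (HdG bc).
    apply: lt_bigmin => [|b _]; last by case: (HdF b).
    by rewrite lt_min dg0.
  move=> r i p rd' Op.
  have rd : `|r - s| < d by apply: lt_le_trans rd' _; exact: bigmin_le_id.
  have : `|r - s| < Num.min dg d0 by apply: lt_le_trans rd _; exact: bigmin_le_id.
  rewrite lt_min => /andP[rdg rd0]; have Ir := Id r rd0.
  split => [b|b c|].
  - have [_ H] := HdF b; apply: H => //; apply: lt_le_trans rd _; exact: bigmin_le.
  - have [_ H] := HdG (b, c); apply: H => //; apply: lt_le_trans rd' _; exact: bigmin_le.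
  - have [c [Ic cs ->]] := mvt r i p rd0 Op.
    rewrite [X in `|X|](_ : _ = (g c i p - g s i p) * (r - s)); last by ring.
    by rewrite normrM ler_wpM2r// Hg'//; exact: le_lt_trans cs rdg.
- move=> r rd; rewrite /vL2norm sqr_sqrtr; first by apply: eq_bigr => i _; rewrite L2sqE.
  by apply: sumr_ge0 => i _; rewrite L2sqE ip_ge0.
- move=> r /Id Ir; have [r0 rT] := IT r Ir.
  rewrite /energy /field_energy (volume_classical oOm bOm Mge1 hV (HH10 r (ltW r0) rT) (fun i => c1 r i Ir)).
  congr (_ * _ + _); apply: eq_bigr => i _.
  by have gF := c1_gradient oOm bOm (c1 r i Ir); rewrite (grad_innerE oOm bOm gF gF).
Qed.

End Regularity.

(** * Blow-up *)

Lemma blowup_ode (R : realType) (lam s t : R) (Y E : R -> R) : 0 < lam -> s < t ->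
  (forall r, s <= r <= t -> exists D y' : R, [/\ is_derive r 1 Y y', is_derive r 1 E (- D), 0 <= D,
     lam * Y r - 6 * E r <= y' & y' ^+ 2 <= 4 * Y r * D]) ->
  0 <= Y t -> 0 < lam * Y s - 6 * E s -> (t - s) * (lam * Y s - 6 * E s) <= 2 * Y s.
Proof.
move=> l0 st H Yt0 Zs0; pose Z r := lam * Y r - 6 * E r.
have /choice[D /choice[y' H']] : forall r, exists D y' : R, s <= r <= t ->
    [/\ is_derive r 1 Y y', is_derive r 1 E (- D), 0 <= D, Z r <= y' & y' ^+ 2 <= 4 * Y r * D].
  (* The default 0 off [[s, t]] makes the witnesses functions of all times, as the mean value
     theorem requires of a derivative. *)
  move=> r; have [rst|_] := boolP (s <= r <= t); last by exists 0, 0.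
  by have [D [y' h]] := H r rst; exists D, y'.
have mv (k dk : R -> R) r : s <= r <= t -> (forall x, s <= x <= t -> is_derive x 1 k (dk x)) ->
    exists2 c, s <= c <= t & k r - k s = dk c * (r - s).
  move=> /andP[sr rt] K; have rs0 : 0 <= r - s by rewrite subr_ge0.
  have [|c /andP[c1 c2]] := @mean_value_step R k dk s (r - s) rs0.
    by rewrite subrKC => x /andP[x1 x2]; apply: K; rewrite x1 (le_trans x2).
  rewrite subrKC in c2 *; exists c => //; by rewrite c1 (le_trans c2).
have DZ r : s <= r <= t -> is_derive r 1 Z (lam * y' r + 6 * D r).
  move=> /H'[dY dE _ _ _].
  by apply: is_derive_eq (is_deriveBf (is_deriveZf lam dY) (is_deriveZf 6 dE)) _; ring.
pose P r := expR (- lam * r) * Z r.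
have DP r : s <= r <= t -> is_derive r 1 P (expR (- lam * r) * (lam * (y' r - Z r) + 6 * D r)).
  move=> hr; have De : is_derive r 1 (fun x : R => expR (- lam * x)) (expR (- lam * r) * (- lam * 1)).
    exact: (is_derive_chain (is_deriveZf (- lam) (is_derive_id r (1 : R))) (is_derive_expR _)).
  by apply: is_derive_eq (is_deriveMf De (DZ r hr)) _; ring.
have Zpos r : s <= r <= t -> 0 < Z r.
  move=> hr; have [c hc e] := mv P _ r hr DP.
  have [_ _ D0 Zy _] := H' c hc; have /andP[sr _] := hr.
  have : 0 < P r.
    rewrite -(subrK (P s) (P r)) e ltr_wpDl ?mulr_gt0 ?expR_gt0//.
    by rewrite !mulr_ge0 ?expR_ge0 ?subr_ge0// addr_ge0 ?mulr_ge0 ?subr_ge0// ltW.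
  by rewrite pmulr_rgt0 ?expR_gt0.
have ss : s <= s <= t by rewrite lexx ltW.
have tt : s <= t <= t by rewrite lexx ltW.
have Dq r : s <= r <= t -> is_derive r 1 (fun x => Y x * (Z x)^-1)
    (y' r * (Z r)^-1 + Y r * - ((Z r)^-1 ^+ 2 * (lam * y' r + 6 * D r))).
  move=> hr; have Zn : Z r != 0 by rewrite gt_eqF// Zpos.
  have [dY _ _ _ _] := H' r hr; apply: (is_deriveMf dY).
  have := is_deriveV Zn (DZ r hr); rewrite scaleNr -exprVn; exact.
have [c hc e] := mv _ _ t tt Dq.
have [_ _ D0 Zy yD] := H' c hc; have Zc0 := Zpos c hc.
have y0 : 0 < y' c := lt_le_trans Zc0 Zy.
(* Cleared of denominators, so that nothing is divided by [Y c]: [6 * Y c * D c] is at least 3/2 of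
   [y' c ^+ 2], and [y' c >= Z c > 0] leaves at most [- Z c ^+ 2 / 2]. *)
have slope : y' c * (Z c)^-1 + Y c * - ((Z c)^-1 ^+ 2 * (lam * y' c + 6 * D c)) <= - 2^-1.
  have -> : y' c * (Z c)^-1 + Y c * - ((Z c)^-1 ^+ 2 * (lam * y' c + 6 * D c)) =
     (y' c * Z c - Y c * (lam * y' c + 6 * D c)) / Z c ^+ 2 by field; rewrite gt_eqF.
  rewrite ler_pdivrMr ?exprn_gt0//.
  (* The sign of [Y] at intermediate times is not assumed: a negative value would make
     [4 * Y c * D c] nonpositive, below [y' c ^+ 2 > 0]. *)
  have Yc0 : 0 <= Y c.
    rewrite leNgt; apply/negP => Yn; have : 0 < y' c ^+ 2 by rewrite exprn_gt0.
    by rewrite ltNge (le_trans yD)// mulr_le0_ge0// ltW// pmulr_rlt0.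
  have h1 : Z c ^+ 2 <= y' c * Z c by rewrite expr2 ler_pM2r.
  have h2 : y' c * Z c <= y' c ^+ 2 by rewrite expr2 ler_pM2l.
  have h3 : 0 <= Y c * (lam * y' c) by rewrite !mulr_ge0// ltW.
  move: yD h1 h2 h3; move: (Z c) (y' c) (Y c) (D c) => z y x w yD h1 h2 h3.
  by rewrite mulrDr; lra.
have qt0 : 0 <= Y t * (Z t)^-1 by rewrite mulr_ge0// invr_ge0 ltW// Zpos.
have : (t - s) / 2 <= Y s * (Z s)^-1.
  have h : (y' c * (Z c)^-1 + Y c * - ((Z c)^-1 ^+ 2 * (lam * y' c + 6 * D c))) * (t - s) <=
    - 2^-1 * (t - s) by rewrite ler_wpM2r// subr_ge0 ltW.
  rewrite -e /= in h; lra.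
by rewrite ler_pdivlMr ?Zpos// /Z; lra.
Qed.

Lemma ler_sum_term (R : realType) n (x : 'I_n -> R) : (forall i, 0 <= x i) ->
  forall i, x i <= \sum_(j < n) x j.
Proof. by move=> x0 i; rewrite (bigD1 i)//= lerDl sumr_ge0. Qed.

(** * Passage to the initial time *)

Section InitialTime.
Context {R : realType}.
Variable Om : set (R * R).
Hypotheses (oOm : open Om) (bOm : bounded_set Om).

Lemma H1sq_subC (f g : R * R -> R) (F G : bool -> R * R -> R) :
  H1sq Om (f \- g) (fun b => F b \- G b) = H1sq Om (g \- f) (fun b => G b \- F b).
Proof.
have sg (k l : R * R -> R) : ip Om (k \- l) (k \- l) = ip Om (l \- k) (l \- k).
  by apply: eq_Rint => p _ /=; rewrite -mulrNN !opprB.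
rewrite /H1sq /gip (sg f g); congr (_ + (_ + _)); exact: sg.
Qed.

Lemma energy_mass_continuous (H0 : R) V (u0 : R * R -> 'rV[R]_3) : volume_extension Om V ->
  vH10 Om u0 -> forall e, 0 < e -> exists2 d, 0 < d & forall w, vH10 Om w ->
  vH1norm Om (w \- u0) < d ->
  `|vL2norm Om w ^+ 2 - vL2norm Om u0 ^+ 2| <= 3 * e /\
  `|energy Om H0 V w - energy Om H0 V u0| <= (2 + `|H0|) * e.
Proof.
move=> hV Hu0 e e0.
have f2 i := H10_L2 (Hu0 i); have gF i := H10_gradient (Hu0 i).
have F2 i b : L2 Om (wD Om b (coord u0 i)) := gradient_L2 b (gF i).
have /choice[d1 H1] : forall i, exists d : R, 0 < d /\ forall g, L2 Om g ->
    ip Om (coord u0 i \- g) (coord u0 i \- g) < d -> `|ip Om g g - ip Om (coord u0 i) (coord u0 i)| < e.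
  by move=> i; have [d d0 Hd] := ip_near oOm (f2 i) e0; exists d.
have /choice[d2 H2] : forall i, exists d : R, 0 < d /\ forall G, (forall b, L2 Om (G b)) ->
    gip Om (fun b => wD Om b (coord u0 i) \- G b) (fun b => wD Om b (coord u0 i) \- G b) < d ->
    `|gip Om G G - gip Om (fun b => wD Om b (coord u0 i)) (fun b => wD Om b (coord u0 i))| < e.
  by move=> i; have [d d0 Hd] := gip_near oOm (F2 i) e0; exists d.
have [d3 d30 H3] := hV.2 u0 Hu0 e e0.
pose m1 := \big[Num.min/1]_(i < 3) d1 i.
(* Below the radii of all three coordinates, for values and gradients. These radii bound squared
   distances, hence the square root of [m] in the radius for the norm. *)
pose m := \big[Num.min/m1]_(i < 3) d2 i.
have m0 : 0 < m.
  apply: lt_bigmin => [|i _]; last by case: (H2 i).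
  by apply: lt_bigmin => // i _; case: (H1 i).
exists (Num.min d3 (Num.sqrt m)); first by rewrite lt_min d30 sqrtr_gt0.
move=> w Hw; rewrite lt_min => /andP[wd3 wm].
have g2 i := H10_L2 (Hw i); have gW i := H10_gradient (Hw i).
have W2 i b : L2 Om (wD Om b (coord w i)) := gradient_L2 b (gW i).
have gD i : gradient Om (coord (w \- u0) i)
    (fun b => wD Om b (coord w i) \- wD Om b (coord u0 i)).
  have -> : coord (w \- u0) i = coord w i \- coord u0 i.
    by apply/funext => p; rewrite /coord /= !mxE.
  exact: gradientB.
have small i : H1sq Om (coord u0 i \- coord w i)
    (fun b => wD Om b (coord u0 i) \- wD Om b (coord w i)) < m.
  apply: (@le_lt_trans _ _ (vH1norm Om (w \- u0) ^+ 2)); last first.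
    rewrite -(sqr_sqrtr (ltW m0)) ltr_pXn2r// ?nnegrE ?sqrtr_ge0//.
  rewrite (vH1norm_sqr oOm bOm gD).
  apply: le_trans (ler_sum_term (fun j => H1sq_ge0 Om (coord (w \- u0) j) _) i).
  have -> : H1sq Om (coord (w \- u0) i) (fun b => wD Om b (coord w i) \- wD Om b (coord u0 i)) =
      H1sq Om (coord u0 i \- coord w i) (fun b => wD Om b (coord u0 i) \- wD Om b (coord w i)).
    have -> : coord (w \- u0) i = coord w i \- coord u0 i.
      by apply/funext => p; rewrite /coord /= !mxE.
    exact: H1sq_subC.
  exact: lexx.
have near1 i : `|ip Om (coord w i) (coord w i) - ip Om (coord u0 i) (coord u0 i)| <= e.
  have [_ H] := H1 i; apply/ltW/H => //; apply: le_lt_trans (lt_le_trans (small i) _).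
    rewrite /H1sq.
 by rewrite lerDl gip_ge0.
  by apply: (@le_trans _ _ m1); [exact: bigmin_le_id|exact: bigmin_le].
have near2 i : `|gip Om (fun b => wD Om b (coord w i)) (fun b => wD Om b (coord w i)) -
    gip Om (fun b => wD Om b (coord u0 i)) (fun b => wD Om b (coord u0 i))| <= e.
  have [_ H] := H2 i; apply/ltW/H => //; apply: le_lt_trans (lt_le_trans (small i) _).
    rewrite /H1sq.
 by rewrite lerDr ip_ge0.
  exact: bigmin_le.
have vE v : vL2norm Om v ^+ 2 = \sum_(i < 3) ip Om (coord v i) (coord v i).
  rewrite /vL2norm sqr_sqrtr; first by apply: eq_bigr => i _; rewrite L2sqE.
  by apply: sumr_ge0 => i _; rewrite L2sqE ip_ge0.
have dE v : vH10 Om v -> dirichlet Om v =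
    \sum_(i < 3) gip Om (fun b => wD Om b (coord v i)) (fun b => wD Om b (coord v i)).
  move=> Hv; apply: eq_bigr => i _; have gv := H10_gradient (Hv i).
  exact: (grad_innerE oOm bOm gv gv).
split.
  by rewrite !vE -sumrB; apply: norm_sum3_le => i; exact: near1.
have h1 : `|dirichlet Om w - dirichlet Om u0| <= 3 * e.
  by rewrite !dE// -sumrB; apply: norm_sum3_le => i; exact: near2.
have h2 : `|V w - V u0| <= e by apply: ltW; exact: H3.
rewrite /energy; move: (dirichlet _ w) (dirichlet _ u0) (V w) (V u0) h1 h2 => a b x y h1 h2.
have -> : 2^-1 * a + 2 * H0 / 3 * x - (2^-1 * b + 2 * H0 / 3 * y) =
  2^-1 * (a - b) + 2 / 3 * (H0 * (x - y)) by field.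
apply: (le_trans (ler_normD _ _)).
have k1 : `|2^-1 * (a - b)| <= 2^-1 * (3 * e) by rewrite normrM ger0_norm// ler_wpM2l.
have k2 : `|H0 * (x - y)| <= `|H0| * e by rewrite normrM ler_wpM2l.
have k3 : `|2 / 3 * (H0 * (x - y))| <= 2 / 3 * (`|H0| * e).
  by rewrite normrM ger0_norm ?ler_wpM2l.
have k4 : 0 <= `|H0| * e by rewrite mulr_ge0// ltW.
by rewrite (le_trans (lerD k1 k3))//; lra.
Qed.

End InitialTime.

(** The limit of [(t - s) * Zs <= 2 * Ys] as [s] tends to 0, with explicit errors: [t * K * e] for
    replacing [Zs] by [c], [2 * c * e] for the term [s * Zs], in which [Zs <= 2 * c], and [6 * e]
    for the mass. *)
Lemma blowup_limit (R : realType) (t s c K e Zs Ys Y0 : R) : 0 < s -> s < t -> s <= e -> 0 < c ->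
  K * e <= c / 2 -> `|Zs - c| <= K * e -> `|Ys - Y0| <= 3 * e -> (t - s) * Zs <= 2 * Ys ->
  t * c - 2 * Y0 <= (6 + 2 * c + t * K) * e.
Proof.
move=> s0 st se c0 Ke; rewrite !ler_norml => /andP[z1 z2] /andP[_ y2] h.
have t0 : 0 <= t by lra.
have p1 : 0 <= t * (Zs + K * e - c) by apply: mulr_ge0 => //; lra.
have p2 : 0 <= s * (2 * c - Zs) by apply: mulr_ge0; lra.
have p3 : 0 <= c * (e - s) by apply: mulr_ge0; lra.
lra.
Qed.

Lemma blowup_time_le (R : realType) (Om : set (R * R)) (H0 lambda1 : R)
    (V : (R * R -> 'rV[R]_3) -> R) (u0 : R * R -> 'rV[R]_3)
    (T : \bar R) (u : R -> R * R -> 'rV[R]_3) (t : R) :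
  open Om -> bounded_set Om -> first_eigenvalue Om lambda1 -> 0 < lambda1 ->
  volume_extension Om V -> vH10 Om u0 -> regular_solution Om H0 u0 T u ->
  0 < lambda1 * vL2norm Om u0 ^+ 2 - 6 * energy Om H0 V u0 ->
  0 < t -> (t%:E < T)%E ->
  t * (lambda1 * vL2norm Om u0 ^+ 2 - 6 * energy Om H0 V u0) <= 2 * vL2norm Om u0 ^+ 2.
Proof.
move=> oOm bOm hlam l0 hV Hu0 hu c0 t0 tT.
have evol := solution_evolution oOm bOm hlam hV hu.
have [_ [_ _ _ HH10 lim0]] := hu.
pose K := 3 * lambda1 + 6 * (2 + `|H0|).
have K0 : 0 < K by rewrite /K; have := normr_ge0 H0; lra.
set c := _ - _ in c0 *.
rewrite -subr_le0; apply: (@le0_mul_eps _ _ (6 + 2 * c + t * K)) => e e0.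
(* The second bound keeps [Z s] above [c / 2], so the differential inequality can be started at
   [s]. *)
pose e1 := Num.min e (c / 2 / K); have e10 : 0 < e1 by rewrite lt_min e0 !divr_gt0.
have [d d0 Hd] := energy_mass_continuous oOm bOm H0 hV Hu0 e10.
have near0 : \forall s \near 0^'+, `|0 - vH1norm Om (u s \- u0)| < d.
  by move/cvgrPdist_lt: lim0; apply.
near (0 : R)^'+ => s.
have s0 : 0 < s by near: s; exact: nbhs_right_gt.
have se : s < Num.min e1 t by near: s; apply: nbhs_right_lt; rewrite lt_min e10.
have sd : `|0 - vH1norm Om (u s \- u0)| < d by near: s.
move: se; rewrite lt_min => /andP[se st].
have sT : (s%:E < T)%E by apply: lt_trans tT; rewrite lte_fin.
move: sd; rewrite sub0r normrN ger0_norm ?sqrtr_ge0// => sd.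
have [hY hE] := Hd (u s) (HH10 s (ltW s0) sT) sd.
have Ke : K * e1 <= c / 2 by rewrite -ler_pdivlMl// mulrC ge_min lexx orbT.
pose Z r := lambda1 * vL2norm Om (u r) ^+ 2 - 6 * energy Om H0 V (u r).
have hZ : `|Z s - c| <= K * e1.
  rewrite /Z /c; move: (vL2norm Om (u s) ^+ 2) (vL2norm Om u0 ^+ 2)
    (energy Om H0 V (u s)) (energy Om H0 V u0) hY hE => a b x y hY hE.
  have -> : lambda1 * a - 6 * x - (lambda1 * b - 6 * y) = lambda1 * (a - b) - 6 * (x - y) by ring.
  have -> : K * e1 = lambda1 * (3 * e1) + 6 * ((2 + `|H0|) * e1) by rewrite /K; ring.
  rewrite (le_trans (ler_normB _ _))// !normrM (gtr0_norm l0) normr_nat.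
  by apply: lerD; apply: ler_wpM2l => //; exact: ltW.
have Zs0 : 0 < Z s.
  by move: hZ; rewrite ler_norml => /andP[+ _]; move: (Z s) Ke c0 => z; lra.
apply: (@le_trans _ _ ((6 + 2 * c + t * K) * e1)); last first.
  rewrite ler_wpM2l//; last by rewrite ge_min lexx.
  by rewrite !addr_ge0// mulr_ge0// ltW.
apply: (blowup_limit s0 st (ltW se) c0 Ke hZ hY).
apply: (@blowup_ode _ lambda1 s t (fun r => vL2norm Om (u r) ^+ 2)
  (fun r => energy Om H0 V (u r)) l0 st _ (sqr_ge0 _) Zs0) => r /andP[sr rt].
apply: evol; first exact: lt_le_trans sr.
by apply: le_lt_trans tT; rewrite lee_fin.
Unshelve. all: by end_near.
Qed.

Theorem theorem2p1 (R : realType) (Om : set (R * R)) (H0 lambda1 : R)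
    (V : (R * R -> 'rV[R]_3) -> R) (u0 : R * R -> 'rV[R]_3)
    (T : \bar R) (u : R -> R * R -> 'rV[R]_3)
    (hOm : smooth_bounded_domain Om)
    (hH0 : H0 != 0)
    (hlambda1 : first_eigenvalue Om lambda1)
    (hlambda1_gt0 : 0 < lambda1)
    (hV : volume_extension Om V)
    (hu0 : vH10 Om u0)
    (hE : energy Om H0 V u0 < lambda1 / 6 * vL2norm Om u0 ^+ 2)
    (hT_gt0 : (0 < T)%E)
    (hu : regular_solution Om H0 u0 T u)
    (hT : T = max_existence_time Om H0 u0) :
  (T < +oo)%E /\
  (T <= (16 * vL2norm Om u0 ^+ 2 /
         (lambda1 * vL2norm Om u0 ^+ 2 - 6 * energy Om H0 V u0))%:E)%E.
Proof.
have [oOm _ _ bOm _] := hOm.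
set Y0 := vL2norm Om u0 ^+ 2 in hE *; set E0 := energy Om H0 V u0 in hE *.
have Y00 : 0 <= Y0 by exact: sqr_ge0.
have c0 : 0 < lambda1 * Y0 - 6 * E0.
  by move: hE; rewrite mulrAC ltr_pdivlMr//; lra.
have b0 : 0 <= 16 * Y0 / (lambda1 * Y0 - 6 * E0).
  by apply: divr_ge0; [exact: mulr_ge0|exact: ltW].
suff TB : (T <= (16 * Y0 / (lambda1 * Y0 - 6 * E0))%:E)%E.
  by split => //; apply: le_lt_trans TB _; exact: ltry.
rewrite leNgt; apply/negP => bT.
(* If [T] exceeded the bound, the solution would still exist at a time strictly beyond it: the
   midpoint when [T] is finite, one unit further when it is not. *)
have [t bt tT] : exists2 t, 16 * Y0 / (lambda1 * Y0 - 6 * E0) < t & (t%:E < T)%E.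
  case: T bT {hT_gt0 hu hT} => [r| |] //.
    by rewrite lte_fin => br; exists ((16 * Y0 / (lambda1 * Y0 - 6 * E0) + r) / 2);
       rewrite ?lte_fin ?midf_lt//; move: (_ / _) br => b; lra.
  by move=> _; exists (16 * Y0 / (lambda1 * Y0 - 6 * E0) + 1); rewrite ?ltry// ltrDl.
have t0 : 0 < t := le_lt_trans b0 bt.
have h := blowup_time_le oOm bOm hlambda1 hlambda1_gt0 hV hu0 hu c0 t0 tT.
by move: bt; rewrite ltr_pdivrMr// ltNge => /negP; apply; apply: (le_trans h); rewrite ler_wpM2r// ler_nat.
Qed.
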